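(* Let $h:\mathbb{R}^n\to\mathbb{R}$ and $\mathcal{S}=\{x\in\mathbb{R}^n\mid h(x)\ge 0\}$. Assume: (i) $\mathcal{S}$ is nonempty and compact; (ii) $h$ is continuously differentiable and $\nabla h$ is locally Lipschitz, with Lipschitz constant $L_{\nabla h}$ on $\mathcal{S}$; (iii) $\nabla h(x)\neq 0$ for all $x\in\mathbb{R}^n$ with $h(x)=0$; (iv) there is $\gamma\in\mathcal{K}_\infty$ such that $d(x,\partial\mathcal{S})\le\gamma(h(x))$ for all $x\in\mathcal{S}$. Let $P\in\mathbb{R}^{n\times n}$ be symmetric positive definite, let $f:\mathbb{R}^m\times\mathbb{R}^n\to\mathbb{R}^n$ be locally Lipschitz, let $g:\mathbb{R}^m\times\mathbb{R}^n\to\mathbb{R}^m$ be continuous and locally bounded, and let $\mathcal{Z}\subset\mathbb{R}^m$ be compact. Fix $\epsilon$ with $0<\epsilon<\min_{x\in\partial\mathcal{S}}\|\nabla h(x)\|$ and let $\alpha_*$ be the constant defined in the context. Let $r>0$ and let $\mathcal{Z}_0,\mathcal{Z}'$ be compact sets such that $\mathcal{Z}_0\subseteq\mathcal{Z}'$ and $\mathcal{Z}'+r\mathbb{B}\subseteq\mathcal{Z}$. Given any initial condition $(z_0,x_0)\in\mathcal{Z}_0\times\mathcal{S}$ and a $T>0$, assume that any solution $\phi:[0,T]\to\mathbb{R}^m\times\mathbb{R}^n$ of the PDS (see context) with $\phi(0)=(z_0,x_0)$ satisfies $\phi(t)\in\mathcal{Z}'\times\mathcal{S}$ for all $t\in[0,T]$.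 Then there exists $\alpha'\ge\alpha_*$ such that, for any $\alpha\ge\alpha'$ (with $\alpha>0$), the solution $\psi:[0,T]\to\mathbb{R}^m\times\mathbb{R}^n$ of the CBF-based dynamics (see context) with parameter $\alpha$ and $\psi(0)=(z_0,x_0)$ satisfies $\psi(t)\in\mathcal{Z}\times\mathcal{S}$ for all $t\in[0,T]$. Thus, for any increasing sequence $\{\alpha_i\}_{i\in\mathbb{N}}$ with $\alpha_i\ge\alpha'$, $\alpha_i>0$ and $\lim_{i\to\infty}\alpha_i=\infty$, and the respective sequence $\{\psi_i\}_{i\in\mathbb{N}}$ of solutions on $[0,T]$ of the CBF-based dynamics with $\alpha=\alpha_i$ and $\psi_i(0)=(z_0,x_0)$: 1. there is a subsequence $\{\psi_{i_k}\}_{k\in\mathbb{N}}$ that converges uniformly, on any compact subinterval of $[0,T)$, to a solution $\phi:[0,T]\to\mathbb{R}^m\times\mathbb{R}^n$ of the PDS with $\phi(0)=(z_0,x_0)$; 2. if, further, $g$ is locally Lipschitz, the whole sequence $\{\psi_i\}_{i\in\mathbb{N}}$ converges uniformly, on any compact subinterval of $[0,T)$, to the unique solution $\phi:[0,T]\to\mathbb{R}^m\times\mathbb{R}^n$ of the PDS with $\phi(0)=(z_0,x_0)$.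
   Context: Notation: $\|\cdot\|$ is the Euclidean norm; $\|v\|_P=\sqrt{v^\top Pv}$; $\mathbb{B}$ is the closed unit ball; sums of sets are Minkowski sums; $d(x,A)=\min_{y\in A}\|x-y\|$ for closed $A$; $\partial\mathcal{S}$ is the topological boundary. $\mathcal{K}_\infty$ is the set of continuous strictly increasing $\gamma:[0,\infty)\to\mathbb{R}$ with $\gamma(0)=0$ and $\lim_{a\to\infty}\gamma(a)=+\infty$. $\mathcal{L}_fh(z,x):=\nabla h(x)^\top f(z,x)$. Tangent cone: for $x\in\mathcal{S}$, $T_{\mathcal{S}}(x)$ is the set of $w\in\mathbb{R}^n$ for which there exist $x_i\in\mathcal{S}$, $x_i\to x$, and $t_i>0$, $t_i\to0$, with $w=\lim_i (x_i-x)/t_i$. Under the assumptions, $T_{\mathcal{S}}(x)=\mathbb{R}^n$ for $x$ in the interior of $\mathcal{S}$ and $T_{\mathcal{S}}(x)=\{v\mid\nabla h(x)^\top v\ge0\}$ for $x\in\partial\mathcal{S}$. PDS (projected dynamical system, interconnected form): $\dot\zeta=g(\zeta,\xi)$, $\ \dot\xi\in\operatorname{argmin}_{\mu\in T_{\mathcal{S}}(\xi)}\|\mu-f(\zeta,\xi)\|_P^2$, with state $(\zeta,\xi)\in\mathbb{R}^m\times\mathcal{S}$. CBF-based dynamics with parameter $\alpha>0$: $\dot\zeta=g(\zeta,\xi)$, $\ \dot\xi=f^P_{\mathrm{cbf},\alpha}(\zeta,\xi)$, where $f^P_{\mathrm{cbf},\alpha}(z,x)$ is the unique minimizer of $\|\mu-f(z,x)\|_P^2$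 over $\mu\in\mathbb{R}^n$ subject to $\nabla h(x)^\top\mu+\alpha h(x)\ge0$; equivalently $$f^P_{\mathrm{cbf},\alpha}(z,x)=f(z,x)-\min\big(0,\mathcal{L}_fh(z,x)+\alpha h(x)\big)\frac{P^{-1}\nabla h(x)}{\|\nabla h(x)\|_{P^{-1}}^2}$$ (the correction term being $0$ when $x\in\mathcal{S}$ and $\nabla h(x)=0$). Solutions: a solution on $[0,T]$ is an absolutely continuous function with the prescribed initial value that satisfies the differential equation/inclusion (and the state constraint, if any) for almost all $t\in[0,T]$. Constant: $$\alpha_*=\frac{\max_{(z,x)\in\mathcal{Z}\times\mathcal{S}}|\mathcal{L}_fh(z,x)|}{\gamma^{-1}\Big(\frac{\min_{y\in\partial\mathcal{S}}\|\nabla h(y)\|-\epsilon}{L_{\nabla h}}\Big)}.$$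
   Formalization: The formal theorem also assumes that at least one solution of the PDS from (z_0,x_0) exists on all of [0,T]; without this the invariance assumption can hold vacuously (finite-time blow-up of the PDS) and the claim fails. *)

(* Defs.v *)
From HB Require Import structures.
From mathcomp Require Import all_boot all_order all_algebra.
From mathcomp Require Import all_classical all_reals all_analysis.

Set Implicit Arguments.
Unset Strict Implicit.
Unset Printing Implicit Defensive.

Import Order.TTheory GRing.Theory Num.Theory.
Import numFieldNormedType.Exports.

Local Open Scope classical_set_scope.
Local Open Scope ring_scope.

(* The library norm `|v| on vectors is the sup norm, so the Euclidean norm has
   its own definition.  Topological notions (limits, compactness, closure,
   differentiability, local Lipschitz continuity, local boundedness, uniform
   and absolute continuity) do not depend on the norm chosen on R^n, and use
   the library structures on 'cV[R]_n and on products. *)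

Definition dot (R : realType) (n : nat) (u v : 'cV[R]_n) : R :=
  (u^T *m v) 0 0.

Definition enorm (R : realType) (n : nat) (v : 'cV[R]_n) : R :=
  Num.sqrt (dot v v).

Definition pnorm (R : realType) (n : nat) (P : 'M[R]_n) (v : 'cV[R]_n) : R :=
  Num.sqrt ((v^T *m P *m v) 0 0).

Definition sym_posdef (R : realType) (n : nat) (P : 'M[R]_n) : Prop :=
  P^T = P /\ forall v : 'cV[R]_n, v != 0 -> 0 < (v^T *m P *m v) 0 0.

Definition eball (R : realType) (n : nat) : set 'cV[R]_n :=
  [set v | enorm v <= 1].

(* For a nonempty closed set A, the infimum is attained. *)
Definition dist (R : realType) (n : nat) (x : 'cV[R]_n) (A : set 'cV[R]_n) : R :=
  inf [set enorm (x - y) | y in A].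

Definition boundary (T : topologicalType) (A : set T) : set T :=
  closure A `\` A°.

Definition grad (R : realType) (n : nat) (h : 'cV[R]_n -> R) (x : 'cV[R]_n) :
    'cV[R]_n :=
  \col_i 'D_(delta_mx i 0) h x.

Definition C1 (R : realType) (n : nat) (h : 'cV[R]_n -> R) : Prop :=
  (forall x, differentiable h x) /\ continuous (grad h).

(* This asks for a Lipschitz bound near each pair (x, y); for x != y it follows
   from continuity, for x = y it is the usual local Lipschitz condition. *)
Definition locally_lipschitz (R : realType) (V W : normedModType R)
    (F : V -> W) : Prop :=
  [locally [lipschitz F v | v in setT]].

Definition locally_bounded (R : realType) (V W : normedModType R)
    (F : V -> W) : Prop :=
  [locally [bounded F v | v in setT]].

(* gamma is only meaningful on [0, +oo[. *)
Definition Kinfty (R : realType) (gamma : R -> R) : Prop :=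
  [/\ {within `[0, +oo[, continuous gamma},
      {in `[0, +oo[ &, {homo gamma : a b / a < b}},
      gamma 0 = 0 &
      gamma a @[a --> +oo] --> +oo].

Definition superlevel (R : realType) (n : nat) (h : 'cV[R]_n -> R) :
    set 'cV[R]_n :=
  [set x | 0 <= h x].

Definition lieD (R : realType) (m n : nat) (h : 'cV[R]_n -> R)
    (f : 'cV[R]_m * 'cV[R]_n -> 'cV[R]_n) (p : 'cV[R]_m * 'cV[R]_n) : R :=
  dot (grad h p.2) (f p).

Definition tangent_cone (R : realType) (n : nat) (A : set 'cV[R]_n)
    (x : 'cV[R]_n) : set 'cV[R]_n :=
  [set w | exists (x_ : nat -> 'cV[R]_n) (t_ : nat -> R),
    [/\ forall i, A (x_ i), x_ @ \oo --> x, forall i, 0 < t_ i,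
        t_ @ \oo --> (0 : R) &
        (fun i => (t_ i)^-1 *: (x_ i - x)) @ \oo --> w]].

Definition argmin (R : realType) (V : Type) (A : set V) (J : V -> R) : set V :=
  [set mu | A mu /\ forall nu, A nu -> J mu <= J nu].

Definition abs_continuous (R : realType) (V : normedModType R) (a b : R)
    (phi : R -> V) : Prop :=
  forall e : R, 0 < e -> exists2 d : R, 0 < d &
    forall (N : nat) (s t : 'I_N -> R),
      (forall i, a <= s i /\ s i <= t i /\ t i <= b) ->
      trivIset setT (fun i => `]s i, t i[%classic) ->
      \sum_(i < N) (t i - s i) < d ->
      \sum_(i < N) `|phi (t i) - phi (s i)| < e.

(* Solutions on [0, T] of the inclusion phi' \in F(phi) with phi(0) = v0.  Only
   the restriction of phi to [0, T] matters: the derivative is two-sided, and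
   the endpoints form a null set. *)
Definition solution (R : realType) (V : normedModType R) (F : V -> set V)
    (T : R) (v0 : V) (phi : R -> V) : Prop :=
  [/\ abs_continuous 0 T phi,
      phi 0 = v0 &
      {ae @lebesgue_measure R, forall t : R, t \in `[0, T] ->
        derivable phi t 1 /\ F (phi t) (derive1 phi t)}].

Definition pds (R : realType) (m n : nat) (h : 'cV[R]_n -> R) (P : 'M[R]_n)
    (f : 'cV[R]_m * 'cV[R]_n -> 'cV[R]_n) (g : 'cV[R]_m * 'cV[R]_n -> 'cV[R]_m)
    (p : 'cV[R]_m * 'cV[R]_n) : set ('cV[R]_m * 'cV[R]_n) :=
  [set v | [/\ superlevel h p.2, v.1 = g p &
    argmin (tangent_cone (superlevel h) p.2)
      (fun mu => pnorm P (mu - f p) ^+ 2) v.2]].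

(* The minimizer is unique when the constraint is feasible, in particular
   whenever h x >= 0 or grad h x != 0.  Otherwise the value is arbitrary. *)
Definition f_cbf (R : realType) (m n : nat) (h : 'cV[R]_n -> R) (P : 'M[R]_n)
    (f : 'cV[R]_m * 'cV[R]_n -> 'cV[R]_n) (alpha : R)
    (p : 'cV[R]_m * 'cV[R]_n) : 'cV[R]_n :=
  get (argmin [set mu | 0 <= dot (grad h p.2) mu + alpha * h p.2]
    (fun mu => pnorm P (mu - f p) ^+ 2)).

Definition cbf (R : realType) (m n : nat) (h : 'cV[R]_n -> R) (P : 'M[R]_n)
    (f : 'cV[R]_m * 'cV[R]_n -> 'cV[R]_n) (g : 'cV[R]_m * 'cV[R]_n -> 'cV[R]_m)
    (alpha : R) (p : 'cV[R]_m * 'cV[R]_n) : set ('cV[R]_m * 'cV[R]_n) :=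
  [set (g p, f_cbf h P f alpha p)].

(* The minimum of |grad h| over the boundary of {h >= 0}. *)
Definition min_grad (R : realType) (n : nat) (h : 'cV[R]_n -> R) : R :=
  inf [set enorm (grad h y) | y in boundary (superlevel h)].

Definition alpha_star (R : realType) (m n : nat) (h : 'cV[R]_n -> R)
    (f : 'cV[R]_m * 'cV[R]_n -> 'cV[R]_n) (gamma : R -> R) (L eps : R)
    (Z : set 'cV[R]_m) : R :=
  sup [set `|lieD h f p| | p in Z `*` superlevel h] /
  pinv [set a : R | 0 <= a] gamma ((min_grad h - eps) / L).

(* Uniform convergence on every compact subinterval of [0, T[. *)
Definition cvg_loc_uniform (R : realType) (V : normedModType R) (T : R)
    (psi_ : nat -> R -> V) (phi : R -> V) : Prop :=
  forall a b : R, 0 <= a -> a <= b -> b < T ->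
    {uniform `[a, b], psi_ @ \oo --> phi}.

(* Main.v *)
(** For large alpha the CBF velocity agrees on Z x S with a continuous field that is
    defined everywhere and bounded independently of alpha, obtained by clamping the
    multiplier of the constraint. Near the boundary of S this field points inwards,
    so approximate solutions remain almost feasible. Approximate solutions for
    parameters tending to infinity are uniformly Lipschitz, and their limits along
    an ultrafilter solve the PDS: the limit velocity satisfies the variational
    inequality of the projection onto the tangent cone.

    As g is only continuous, solutions need not be unique, and a limit of CBF
    solutions that leave a neighbourhood of Z' is a PDS solution up to the escape
    time only. A Kneser-type connectedness argument repairs this: Euler polygons on
    [0, T] that follow the escaping curve, or a PDS solution, for a while form a
    chain along which the maximal distance to Z' varies continuously, hence some
    of them have maximal distance equal to a fixed positive value. Their limit is
    a PDS solution on the whole of [0, T] that leaves Z', which is excluded.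

    If g is locally Lipschitz, the normal cones of S are hypomonotone because
    grad h is Lipschitz, and Gronwall's inequality gives uniqueness. *)

From HB Require Import structures.
Require Import Defs.
From mathcomp Require Import all_boot all_order all_algebra.
From mathcomp Require Import all_classical all_reals all_analysis.
From mathcomp Require Import measurable_realfun ring lra.

Set Implicit Arguments.
Unset Strict Implicit.
Unset Printing Implicit Defensive.

Import Order.TTheory GRing.Theory Num.Theory.
Import numFieldNormedType.Exports.

Local Open Scope classical_set_scope.
Local Open Scope ring_scope.

(** Velocities of the approximating curves need not converge, so limits are taken of increments
    tested against a continuous linear form: a lower bound for the form on the fields near a point
    passes to the derivative of the limit curve. The multiplier of the constraint has no controlled
    limit either. Only its sign and its bound enter, because the test vectors [P *m (mu - v)], with
    [v] the limit velocity, have a nonnegative product with the inward normal at the boundary; this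
    rests on the fact that at an interior time both [v] and [- v] are tangent to S.

    In the Kneser argument Euler polygons replace exact solutions, since a polygon depends
    continuously on its data even where solutions branch. The price is one cell of the subdivision
    on which the interpolated curve obeys no equation. Its length tends to zero, and in the limit it
    shrinks to a single instant, a null set.

    Curves are known to be differentiable almost everywhere only through their Lipschitz constant,
    which is why all fields involved must share a bound that does not depend on alpha. *)

(** The supremum of the points reached is itself passed. The step leads from a point left of [c] to
    one right of [c], so closedness and openness of the good set are one hypothesis. *)
Lemma real_induction (R : realType) (a b : R) (P : R -> Prop) :
  a <= b -> P a ->
  (forall c, a <= c -> c <= b -> exists2 d, 0 < d & forall x y,
     a <= x -> c - d < x -> x <= c -> c <= y -> y < c + d -> y <= b ->
     P x -> P y) ->
  P b.
Proof.
move=> ab Pa step; pose A := [set x | [/\ a <= x, x <= b & P x]].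
have Aa : A a by [].
have supA : has_sup A.
  by split; [exists a | exists b => x [_ xb _]].
have ac : a <= sup A by apply: ub_le_sup => //; case: supA.
have cb : sup A <= b by apply: ge_sup; [exists a | move=> x []].
have [d d0 hd] := step _ ac cb.
have [x [ax xb Px] cdx] := sup_adherent d0 supA.
have xc : x <= sup A by apply: ub_le_sup => //; case: supA.
pose y := Num.min b (sup A + d / 2).
have yb : y <= b by rewrite ge_min lexx.
have cy : sup A <= y by rewrite le_min cb lerDl divr_ge0// ltW.
have yd : y < sup A + d by rewrite gt_min ltrD2l ltr_pdivrMr// mulr2n mulrDr mulr1 ltrDl d0 orbT.
have Py : P y by exact: (hd x y).
have yc : y <= sup A.
  apply: ub_le_sup; first by case: supA.
  by split => //; exact: le_trans cy.
have : y = b.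
  have [h|h] := leP b (sup A + d / 2); first by rewrite /y min_l.
  by move: yc; rewrite /y min_r ?(ltW h)// => yc; lra.
by move=> <-.
Qed.

(** * Absolutely continuous and Lipschitz curves *)

Section AbsolutelyContinuous.
Variables (R : realType) (V : normedModType R) (a b : R).
Implicit Types (phi : R -> V) (l : seq (R * R)).

(* The intervals are listed from right to left. *)
Fixpoint interval_chain l (x : R) : Prop :=
  if l is p :: l' then [/\ p.1 <= p.2, p.2 <= x & interval_chain l' p.1]
  else a <= x.

Lemma interval_chainW l x y : x <= y -> interval_chain l x -> interval_chain l y.
Proof.
case: l => [|p l] /= xy; first by move/le_trans; apply.
by case=> ? px ?; split => //; exact: le_trans xy.
Qed.

Lemma interval_chain_nth l x i : interval_chain l x -> (i < size l)%N ->
  [/\ a <= (nth (0, 0) l i).1, (nth (0, 0) l i).1 <= (nth (0, 0) l i).2 &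
      (nth (0, 0) l i).2 <= x].
Proof.
elim: l x i => [|p l IH] x i //= [p12 px pl].
have ap : a <= p.1.
  case: (l) pl IH => //= q l' [q12 qp ql'] IH.
  have [] := IH _ 0%N (And3 q12 qp ql') isT.
  by move=> /= aq _ _; exact: le_trans (le_trans aq q12) qp.
case: i => [|i] /= il; first by split.
have [? ? q] := IH _ _ pl il; split => //.
exact: le_trans (le_trans q p12) px.
Qed.

Lemma interval_chain_disjoint l x i j : interval_chain l x ->
  (i < j)%N -> (j < size l)%N -> (nth (0, 0) l j).2 <= (nth (0, 0) l i).1.
Proof.
elim: l x i j => [|p l IH] x i [|j] //= [p12 px pl].
case: i => [|i] /= ij jl; last exact: (IH p.1).
by have [] := interval_chain_nth pl jl.
Qed.

(* Null sets are covered by open sets of small measure, on which absolute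
   continuity controls q; elsewhere q is controlled by its local bound. *)
Lemma ac_subadditive_le0 (C : R) phi (q : R -> R -> R) :
  a <= b -> abs_continuous a b phi -> 0 <= C ->
  (forall u v w, a <= u -> u <= v -> v <= w -> w <= b ->
     q u w <= q u v + q v w) ->
  (forall u v, a <= u -> u <= v -> v <= b -> q u v <= C * `|phi v - phi u|) ->
  {ae @lebesgue_measure R, forall t, t \in `[a, b] -> forall e, 0 < e ->
     exists2 d, 0 < d & forall u v, a <= u -> t - d < u -> u <= t -> t <= v ->
       v < t + d -> v <= b -> q u v <= e * (v - u)} ->
  q a b <= 0.
Proof.
move=> ab ac C0 qD qC [N [mN N0' Nsub]].
have N0 : @lebesgue_measure R (N : set R) = 0%E by exact: N0'.
have qaa : q a a <= 0 by have := qC a a (lexx _) (lexx _) ab; rewrite subrr normr0 mulr0.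
apply/ler_addgt0Pr => e e0; rewrite add0r.
(* [e1] pays for the regular points over the length of the interval and [e2] for the null set, each
   for at most [e / 2]. *)
pose e1 := e / (2 * (b - a + 1)); pose e2 := e / (2 * (C + 1)).
have e10 : 0 < e1 by rewrite divr_gt0// mulr_gt0// ltr_wpDl// subr_ge0.
have e20 : 0 < e2 by rewrite divr_gt0// mulr_gt0// ltr_wpDl.
have [d d0 acd] := ac _ e20.
have [|U [oU NU muU]] := @lebesgue_regularity_outer R N d mN _ d0.
  exact: (eq_ind_r (fun x => x < +oo)%E (ltry 0) N0).
have mU : measurable U by exact: open_measurable.
have {}muU : (@lebesgue_measure R U < d%:E)%E.
  apply: le_lt_trans muU.
  apply: (@le_trans _ _ (@lebesgue_measure R (U `\` N `|` N))).
    by rewrite setDKU.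
  apply: (le_trans (measureU2 _ _ _)) => //; first exact: measurableD.
  rewrite -[leRHS]adde0 leeD2l//.
  exact: (eq_ind_r (fun x => x <= 0)%E (lexx 0%E) N0).
(* The list collects the intervals around points of [N]. Their total length is charged to the part
   of [U] up to [x]; everything else costs at most [e1] per unit of length. *)
pose P x := exists l, [/\ interval_chain l x,
  ((\sum_(p <- l) (p.2 - p.1))%:E <= @lebesgue_measure R (U `&` `]a, x]))%E &
  q a x <= e1 * (x - a) + C * \sum_(p <- l) `|phi p.2 - phi p.1|].
have : P b.
  apply: (@real_induction R a b P ab).
    exists [::]; split => //=; first by rewrite big_nil.
    by rewrite big_nil subrr !mulr0 addr0.
  move=> c ac' cb; have [Nc|Nc] := pselect (N c).
    have := open_subball oU (NU _ Nc) => -[r /= r0 rU].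
    have [s s0 sU] : exists2 s, 0 < s & forall y, `|c - y| < s -> U y.
      exists (r / 2); first by rewrite divr_gt0.
      move=> y cy; apply: (rU (r / 2)) => //=.
        by rewrite /ball_/= sub0r normrN gtr0_norm ?divr_gt0// ltr_pdivrMr// ltr_pMr// ltr1n.
      by rewrite divr_gt0.
    exists s => // x y ax cx xc cy yc yb [l [lx ml ql]].
    have xy : x <= y by exact: le_trans cy.
    exists ((x, y) :: l); split => /=; first by split.
      rewrite big_cons /=.
      have -> : U `&` `]a, y]%classic = (U `&` `]a, x]%classic) `|` `]x, y]%classic.
        apply/seteqP; split => z /=; rewrite !in_itv/=.
          move=> [Uz /andP[az zy]]; rewrite az zy/= andbT.
          by have [zx|xz] := leP z x; [left|right].
        case=> [[Uz /andP[az zx]]|/andP[xz zy]].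
          by split => //; rewrite az (le_trans zx).
        split; last by rewrite zy andbT (le_lt_trans ax).
        apply: sU; rewrite ltr_distlC (lt_trans cx xz)/=.
        exact: le_lt_trans yc.
      rewrite measureU//; last 2 first.
        by apply: measurableI.
        apply/seteqP; split => z //=; rewrite !in_itv/=.
        by move=> [[_ /andP[_ zx]] /andP[xz _]]; move: (le_lt_trans zx xz); rewrite ltxx.
      rewrite addrC EFinD leeD//.
      rewrite -[leRHS]/(@lebesgue_measure R [set` `]x, y]]) lebesgue_measure_itv/=.
      rewrite lte_fin; case: ltP => // yx.
      by rewrite lee_fin subr_le0.
    rewrite big_cons /=; apply: (le_trans (qD a x y _ _ _ _)) => //.
    apply: (le_trans (lerD ql (qC x y _ _ _))) => //.
    have : 0 <= e1 * (y - x) by rewrite mulr_ge0 ?subr_ge0// ltW.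
    by move=> h; lra.
  have [|r r0 hr] := (not_notP _).1 (fun h => Nc (Nsub c h)) _ e1 e10.
    by rewrite in_itv/= ac'.
  exists r => // x y ax cx xc cy yc yb [l [lx ml ql]].
  have xy : x <= y by exact: le_trans cy.
  exists l; split; first exact: interval_chainW lx.
    apply: le_trans ml _; apply: le_measure; rewrite ?inE; try exact: measurableI.
    apply: setIS => z /=; rewrite !in_itv/= => /andP[-> zx].
    exact: le_trans xy.
  apply: (le_trans (qD a x y _ _ _ _)) => //.
  apply: (le_trans (lerD ql (hr x y _ _ _ _ _ _))) => //.
  by rewrite le_eqVlt; apply/orP; left; apply/eqP; ring.
move=> [l [lb ml ql]]; apply: le_trans ql _.
have h2 : \sum_(p <- l) `|phi p.2 - phi p.1| < e2.
  rewrite (big_nth (0, 0)) big_mkord; apply: acd.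
  - by move=> i; have [] := interval_chain_nth lb (ltn_ord i).
  - move=> i j _ _ [z [/=]]; rewrite !in_itv/= => /andP[iz zi] /andP[jz zj].
    apply/val_inj/eqP; case: ltngtP => // ij.
      have := interval_chain_disjoint lb ij (ltn_ord j).
      by rewrite leNgt (lt_trans iz zj).
    have := interval_chain_disjoint lb ij (ltn_ord i).
    by rewrite leNgt (lt_trans jz zi).
  rewrite -(big_mkord xpredT (fun i => (nth (0, 0) l i).2 - (nth (0, 0) l i).1)).
  rewrite -(big_nth (0, 0) xpredT (fun p => p.2 - p.1)) -lte_fin.
  apply: le_lt_trans ml (le_lt_trans _ muU).
  by apply: le_measure; rewrite ?inE//; exact: measurableI.
rewrite (splitr e) lerD//.
  have C1 : 0 < b - a + 1 by rewrite ltr_wpDl// subr_ge0.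
  rewrite (_ : e1 * (b - a) = e / 2 * ((b - a) / (b - a + 1))); last first.
    by rewrite /e1; field; rewrite gt_eqF.
  by rewrite ler_piMr ?divr_ge0 ?(ltW e0)// ler_pdivrMr// mul1r lerDl.
apply: (@le_trans _ _ (C * e2)); first by rewrite ler_wpM2l// ltW.
have C1 : 0 < C + 1 by rewrite ltr_wpDl.
rewrite (_ : C * e2 = e / 2 * (C / (C + 1))); last first.
  by rewrite /e2; field; rewrite gt_eqF.
by rewrite ler_piMr ?divr_ge0 ?(ltW e0)// ler_pdivrMr// mul1r lerDl.
Qed.

End AbsolutelyContinuous.

Section LipschitzCurves.
Variable R : realType.
Implicit Types (V : normedModType R) (a b c t M K : R).

Definition lipschitz_curve V a b M (phi : R -> V) : Prop :=
  forall u v, a <= u -> u <= v -> v <= b -> `|phi v - phi u| <= M * (v - u).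

(** A continuous linear form, kept unbundled so that coordinates, products with a fixed vector and
    their opposites qualify as plain functions. *)
Definition bounded_form V (l : V -> R) : Prop :=
  [/\ forall u v, l (u + v) = l u + l v, forall k v, l (k *: v) = k * l v &
      exists2 C, 0 <= C & forall v, `|l v| <= C * `|v|].

Lemma lebesgue_aeS (P Q : R -> Prop) : (forall t, P t -> Q t) ->
  {ae @lebesgue_measure R, forall t, P t} -> {ae @lebesgue_measure R, forall t, Q t}.
Proof.
by move=> PQ; apply: filterS; first exact: (ae_filter_ringOfSetsType lebesgue_measure).
Qed.

Lemma lebesgue_aeI (P Q : R -> Prop) : {ae @lebesgue_measure R, forall t, P t} ->
  {ae @lebesgue_measure R, forall t, Q t} ->
  {ae @lebesgue_measure R, forall t, P t /\ Q t}.
Proof.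
by apply: filterI; first exact: (ae_filter_ringOfSetsType lebesgue_measure).
Qed.

Lemma lipschitz_curveS V a b c d M (phi : R -> V) : a <= c -> d <= b ->
  lipschitz_curve a b M phi -> lipschitz_curve c d M phi.
Proof.
move=> ac db lip u v cu uv vd; apply: lip => //; [exact: le_trans cu|].
exact: le_trans db.
Qed.

Lemma lipschitz_curve_abs_continuous V a b M (phi : R -> V) :
  lipschitz_curve a b M phi -> abs_continuous a b phi.
Proof.
move=> lip e e0; exists (e / (`|M| + 1)).
  by rewrite divr_gt0// ltr_wpDl.
move=> N s t st _; rewrite ltr_pdivlMr ?ltr_wpDl// => h.
apply: le_lt_trans h; rewrite mulr_suml ler_sum// => i _.
have [? [? ?]] := st i; apply: (le_trans (lip _ _ _ _ _)) => //.
rewrite mulrC ler_wpM2l ?subr_ge0//.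
by rewrite (le_trans (ler_norm M))// lerDl.
Qed.

Lemma abs_continuousS V a b c d (phi : R -> V) : a <= c -> d <= b ->
  abs_continuous a b phi -> abs_continuous c d phi.
Proof.
move=> ac db H e e0; have [r r0 hr] := H e e0; exists r => // N s t st; apply: hr.
move=> i; have [cs [ss td]] := st i.
by split; [exact: le_trans cs|split => //; exact: le_trans db].
Qed.

Lemma abs_continuous_cts V a b (phi : R -> V) t e :
  abs_continuous a b phi -> a <= t -> t <= b -> 0 < e ->
  exists2 d, 0 < d & forall s, a <= s -> s <= b -> `|s - t| < d ->
    `|phi s - phi t| < e.
Proof.
move=> ac at' tb e0; have [d d0 hd] := ac e e0; exists d => // s as' sb st.
have key u v : a <= u -> u <= v -> v <= b -> v - u < d -> `|phi v - phi u| < e.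
  move=> au uv vb uvd; have := hd 1%N (fun=> u) (fun=> v) _ _.
  rewrite !big_ord1; apply => //.
  by move=> i j _ _ _; rewrite (ord1 i) (ord1 j).
case: (leP t s) => ts.
  by apply: key => //; rewrite (le_lt_trans (ler_norm _)).
rewrite distrC; apply: key => //; first exact: ltW.
by rewrite (le_lt_trans (ler_norm _))// distrC.
Qed.

Lemma derivable_local V (phi : R -> V) t e : derivable phi t 1 -> 0 < e ->
  exists2 d, 0 < d & forall s, `|s - t| < d ->
    `|phi s - phi t - (s - t) *: derive1 phi t| <= e * `|s - t|.
Proof.
move=> dphi e0; have /cvgrPdist_le/(_ e e0) := dphi.
rewrite -/(derive phi t 1) -derive1E.
move=> -[d /= d0 hd]; exists d => // s st.
have [->|nst] := eqVneq s t; first by rewrite !subrr scale0r subr0 !normr0 mulr0.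
have st0 : s - t != 0 by rewrite subr_eq0.
have := hd (s - t); rewrite /ball_/= sub0r normrN => /(_ st st0).
rewrite [_ *: 1](_ : _ = s - t); last by rewrite /GRing.scale/= mulr1.
rewrite subrK => H.
rewrite -(ler_pM2l (_ : 0 < `|s - t|^-1)) ?invr_gt0 ?normr_gt0//.
rewrite mulrCA mulVf ?normr_eq0// mulr1.
rewrite -normfV -normrZ scalerBr scalerA mulVf// scale1r distrC.
exact: H.
Qed.

(** The straddle lemma: the increments on the two sides of [t] add up without loss because
    [u <= t <= v]. *)
Lemma derivable_local2 V (phi : R -> V) t e : derivable phi t 1 -> 0 < e ->
  exists2 d, 0 < d & forall u v, t - d < u -> u <= t -> t <= v -> v < t + d ->
    `|phi v - phi u - (v - u) *: derive1 phi t| <= e * (v - u).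
Proof.
move=> dphi e0; have [d d0 hd] := derivable_local dphi e0.
exists d => // u v tu ut tv vt.
have -> : phi v - phi u - (v - u) *: derive1 phi t =
  (phi v - phi t - (v - t) *: derive1 phi t) - (phi u - phi t - (u - t) *: derive1 phi t).
  have -> : phi v - phi u = (phi v - phi t) - (phi u - phi t).
    by rewrite opprB addrA subrK.
  have -> : v - u = (v - t) - (u - t) by ring.
  rewrite (scalerBl (v - t)) !opprB addrACA [RHS]addrACA; congr (_ + _).
  by rewrite addrC.
apply: (le_trans (ler_normB _ _)).
have -> : e * (v - u) = e * (v - t) + e * (t - u) by ring.
rewrite lerD//.
  rewrite -[in leRHS](@ger0_norm _ (v - t)) ?subr_ge0// hd//.
  by rewrite ger0_norm ?subr_ge0// ltrBlDl.
rewrite -[in leRHS](@ger0_norm _ (t - u)) ?subr_ge0// (distrC t) hd//.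
by rewrite distrC ger0_norm ?subr_ge0// ltrBlDl -ltrBlDr.
Qed.

(** Absolute continuity of [F] is inherited from [phi] through the bound on increments; in the
    applications to barriers [F] is [h] along the curve. *)
Lemma ac_nondecreasing V a b C (phi : R -> V) (F : R -> R) :
  a <= b -> abs_continuous a b phi -> 0 <= C ->
  (forall u v, a <= u -> u <= v -> v <= b ->
    `|F v - F u| <= C * `|phi v - phi u|) ->
  {ae @lebesgue_measure R, forall t, t \in `[a, b] ->
    derivable F t 1 /\ 0 <= derive1 F t} ->
  F a <= F b.
Proof.
move=> ab ac C0 FC ae; rewrite -subr_le0.
apply: (@ac_subadditive_le0 R V a b C phi (fun u v => F u - F v)) => //.
- by move=> u v w _ _ _ _; rewrite subrKA.
- move=> u v au uv vb; apply: le_trans (FC u v au uv vb).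
  by rewrite distrC ler_norm.
apply: lebesgue_aeS ae => t H tab e e0; have {H} [dF F0] := H tab.
have [d d0 hd] := derivable_local2 dF e0; exists d => // u v _ tu ut tv vt _.
have /ler_normlP[+ _] := hd u v tu ut tv vt.
have : 0 <= (v - u) * derive1 F t by rewrite mulr_ge0// subr_ge0 (le_trans ut).
rewrite /GRing.scale/=; lra.
Qed.

Lemma ac_lipschitz V a b M (phi : R -> V) :
  abs_continuous a b phi ->
  {ae @lebesgue_measure R, forall t, t \in `[a, b] ->
    derivable phi t 1 /\ `|derive1 phi t| <= M} ->
  lipschitz_curve a b M phi.
Proof.
move=> ac ae u v au uv vb; rewrite -subr_le0.
apply: (@ac_subadditive_le0 R V u v 1 phi
  (fun x y => `|phi y - phi x| - M * (y - x)) uv _ ler01).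
- exact: abs_continuousS ac.
- move=> x y z _ _ _ _.
  have : `|phi z - phi x| <= `|phi z - phi y| + `|phi y - phi x|.
    by rewrite -(subrKA (phi y)) ler_normD.
  lra.
- move=> x y ux xy yv; rewrite mul1r lerBlDr lerDl.
  have [->|xy'] := eqVneq x y; first by rewrite subrr mulr0.
  have xlty : x < y by rewrite lt_neqAle xy'.
  rewrite mulr_ge0 ?subr_ge0//.
  (* The sign of [M] is not given. A negative [M] would make the bound on the derivative fail
     throughout [[x, y]], which would then be a null set. *)
  rewrite leNgt; apply/negP => M0.
  have : (@lebesgue_measure R `[x, y] = 0)%E.
    apply: measure_negligible => //.
    apply: negligibleS ae => t /= txy H.
    have [|_] := H.
      move: txy; rewrite !in_itv/= => /andP[xt ty].
      by rewrite (le_trans au) ?(le_trans ux)// (le_trans ty)// (le_trans yv).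
    by apply/negP; rewrite -ltNge (lt_le_trans M0).
  rewrite lebesgue_measure_itv/= lte_fin xlty => /eqP.
  by rewrite eqe subr_eq0 => /eqP yx; move: xlty; rewrite yx ltxx.
apply: lebesgue_aeS ae => t H tuv e e0.
have [|dphi pM] := H.
  move: tuv; rewrite !in_itv/= => /andP[ut tv].
  by rewrite (le_trans au)//= (le_trans tv).
have [d d0 hd] := derivable_local2 dphi e0; exists d => // x y _ tx xt ty yt _.
have := hd x y tx xt ty yt.
have xy : 0 <= y - x by rewrite subr_ge0 (le_trans xt).
have : `|phi y - phi x| <= `|phi y - phi x - (y - x) *: derive1 phi t| +
   `|(y - x) *: derive1 phi t|.
  by rewrite -[X in `|X| <= _](subrK ((y - x) *: derive1 phi t)) ler_normD.
rewrite normrZ ger0_norm//.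
have : (y - x) * `|derive1 phi t| <= (y - x) * M by rewrite ler_wpM2l.
lra.
Qed.

(** Since the curve is Lipschitz, the identity of the line can serve as the absolutely continuous
    gauge; [|c| + C * |M|] bounds the defect on the exceptional null set. *)
Lemma lipschitz_form_growth V a b M c (phi : R -> V) (l : V -> R) :
  a <= b -> lipschitz_curve a b M phi -> bounded_form l ->
  {ae @lebesgue_measure R, forall t, t \in `[a, b] ->
    derivable phi t 1 /\ c <= l (derive1 phi t)} ->
  c * (b - a) <= l (phi b) - l (phi a).
Proof.
move=> ab lip [lD lZ [C C0 lC]] ae; rewrite -subr_le0.
have lB u v : l (u - v) = l u - l v by rewrite lD -scaleN1r lZ mulN1r.
have idac : abs_continuous a b (id : R -> R).
  apply: (@lipschitz_curve_abs_continuous _ a b 1) => u v _ uv _.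
  by rewrite mul1r ger0_norm// subr_ge0.
apply: (@ac_subadditive_le0 R R a b (`|c| + C * `|M|) id
  (fun x y => c * (y - x) - (l (phi y) - l (phi x))) ab idac).
- by rewrite addr_ge0// mulr_ge0.
- by move=> u v w _ _ _ _; lra.
- move=> u v au uv vb; have uv0 : 0 <= v - u by rewrite subr_ge0.
  rewrite (ger0_norm uv0) mulrDl -lB lerD//.
    by rewrite ler_wpM2r// ler_norm.
  rewrite (le_trans (ler_norm _))// normrN (le_trans (lC _))// -mulrA ler_wpM2l//.
  by rewrite (le_trans (lip _ _ _ _ _))// ler_wpM2r// ler_norm.
apply: lebesgue_aeS ae => t H tab e e0; have {H} [dphi cl] := H tab.
have C1 : 0 < C + 1 by rewrite ltr_wpDl.
have e0' : 0 < e / (C + 1) by rewrite divr_gt0.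
have [d d0 hd] := derivable_local2 dphi e0'; exists d => // u v _ tu ut tv vt _.
have uv : 0 <= v - u by rewrite subr_ge0 (le_trans ut).
have := lC (phi v - phi u - (v - u) *: derive1 phi t); rewrite !lB lZ.
move=> /ler_normlP[h _].
have h2 : C * `|phi v - phi u - (v - u) *: derive1 phi t| <= e * (v - u).
  apply: (@le_trans _ _ ((C + 1) * (e / (C + 1) * (v - u)))).
    rewrite ler_pM ?(hd u v)// lerDl//.
  by rewrite le_eqVlt; apply/orP; left; apply/eqP; field; rewrite gt_eqF.
have : (v - u) * c <= (v - u) * l (derive1 phi t) by rewrite ler_wpM2l.
lra.
Qed.

End LipschitzCurves.

(** * Differentiability almost everywhere of Lipschitz functions of one variable *)

Section Rademacher.
Variable R : realType.
Local Notation mu := (@lebesgue_measure R).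

(** Both measures come from lengths of half-open intervals, so a cover that is cheap for Lebesgue
    measure is cheap for [F] up to the factor [K]. *)
Lemma lipschitz_stieltjes_dominates (F : cumulative R R) (K : R) : 0 <= K ->
  (forall x y, x <= y -> F y - F x <= K * (y - x)) ->
  lebesgue_stieltjes_measure F `<< mu.
Proof.
move=> K0 FK; apply/null_content_dominatesP => A mA A0.
apply/eqP; rewrite eq_le measure_ge0 andbT.
apply/lee_addgt0Pr => e e0; rewrite add0e.
have K1 : 0 < K + 1 by rewrite ltr_wpDl.
have A0' : mu_ext (wlength (idfun : R -> R)) A = 0%E by exact: A0.
have eK : (mu_ext (wlength (idfun : R -> R)) A < (e / (K + 1))%:E)%E.
  by rewrite A0' lte_fin divr_gt0.
have [_ [B [mB AB] <-] sB] := ereal_inf_lt eK.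
apply: (@le_trans _ _ (\sum_(k <oo) wlength F (B k))%E).
  by apply: ereal_inf_lbound; exists B.
apply: (@le_trans _ _ (\sum_(k <oo) (K%:E * wlength (idfun : R -> R) (B k)))%E).
  apply: lee_nneseries => k _ ; first by move=> _; exact: wlength_ge0.
  have /ocitvP[->|[[x y] /= xy ->]] := mB k; first by rewrite !wlength0 mule0.
  have xy' := ltW xy.
  have -> := wlength_itv_bnd F false false xy'.
  have -> := wlength_itv_bnd (idfun : R -> R) false false xy'.
  by rewrite -EFinM lee_fin FK.
rewrite nneseriesZl//.
apply: (@le_trans _ _ (K%:E * (e / (K + 1))%:E)%E).
  by rewrite lee_wpmul2l ?lee_fin// ltW.
rewrite -EFinM lee_fin mulrA ler_pdivrMr// mulrC ler_wpM2l ?(ltW e0)//.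
by rewrite lerDl.
Qed.

(** Domination gives a Radon-Nikodym density; [F] is its integral from minus infinity, and the
    fundamental theorem of calculus differentiates that integral almost everywhere. *)
Lemma lipschitz_cumulative_derivable (F : cumulativeBounded (0 : R) (1 : R))
  (K : R) : 0 <= K ->
  (forall x y, x <= y -> F y - F x <= K * (y - x)) ->
  {ae mu, forall t, derivable F t 1}.
Proof.
move=> K0 FK.
pose nu := lebesgue_stieltjes_measure F.
have numu : nu `<< mu := lipschitz_stieltjes_dominates K0 FK.
pose f := Radon_Nikodym_SigmaFinite.f nu mu.
have ff x : f x \is a fin_num := Radon_Nikodym_SigmaFinite.f_fin_num numu x.
have intf : mu.-integrable setT f := Radon_Nikodym_SigmaFinite.f_integrable numu.
pose r := fine \o f.
have fE : f = EFin \o r by apply/funext => x; rewrite /= fineK.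
rewrite fE in intf.
have /= := @FTC1Ny R r _ _; rewrite -/mu => H.
have FE : (fun x => (\int[mu]_(t in `]-oo, x]) (r t))%R) = F.
  apply/funext => x; rewrite /Rintegral.
  have := cdf_lebesgue_stieltjes_id F x; rewrite /cdf /distribution /pushforward preimage_id.
  have h : nu `]-oo, x]%classic = (\int[mu]_(y in `]-oo, x]) f y)%E.
    exact: (Radon_Nikodym_SigmaFinite.f_integral numu (measurable_itv `]-oo, x])).
  move=> E; have -> : (\int[mu]_(y in `]-oo, x]) (r y)%:E)%E = (F x)%:E.
    by rewrite -E -[RHS]/(nu `]-oo, x]%classic) h fE.
  by [].
rewrite FE in H.
have H2 : {ae mu, forall x, derivable F x 1 /\ derive1 F x = r x}.
  apply: H; last exact: open_integrable_locally openT intf.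
  by move=> y; apply: integrableS intf.
by apply: lebesgue_aeS H2 => t [].
Qed.


Section Extension.
Variables (a b M : R) (phi : R -> R).
Hypotheses (ab : a < b) (M0 : 0 <= M) (lip : lipschitz_curve a b M phi).

Let cl (t : R) := Num.max a (Num.min b t).

Let acl t : a <= cl t. Proof. by rewrite /cl le_max lexx. Qed.
Let clb t : cl t <= b. Proof. by rewrite /cl ge_max (ltW ab) ge_min lexx. Qed.
Let cl_le x y : x <= y -> cl x <= cl y.
Proof.
move=> xy; rewrite /cl ge_max le_max lexx/= le_max; apply/orP; right.
by rewrite le_min !ge_min lexx xy/= orbT.
Qed.
Let cl_id t : a <= t -> t <= b -> cl t = t.
Proof. by move=> at' tb; rewrite /cl min_r// max_r. Qed.
Let cl_lip x y : x <= y -> cl y - cl x <= y - x.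
Proof.
move=> xy; have min_lip : Num.min b y - Num.min b x <= y - x.
  case: (leP b x) => bx; case: (leP b y) => by'; lra.
apply: le_trans min_lip; have : Num.min b x <= Num.min b y.
  by rewrite le_min !ge_min lexx xy/= orbT.
rewrite /cl; move: (Num.min b x) (Num.min b y) => X Y XY.
case: (leP a X) => aX; case: (leP a Y) => aY; lra.
Qed.

(* A nondecreasing function, Lipschitz with constant 2 M + 1, from which phi is
   recovered on [a, b], rescaled to a cumulative distribution function. *)
Let G t := phi (cl t) + (M + 1) * cl t.
Let D := G b - G a.

Let cla : cl a = a. Proof. by rewrite cl_id// ltW. Qed.
Let clb' : cl b = b. Proof. by rewrite cl_id// ltW. Qed.

Let G_lo x y : x <= y -> cl y - cl x <= G y - G x.
Proof.
move=> xy; have /ler_normlP[+ _] := lip (acl x) (cl_le xy) (clb y).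
by rewrite /G; move: (cl x) (cl y) => X Y; lra.
Qed.

Let G_up x y : x <= y -> G y - G x <= (2 * M + 1) * (cl y - cl x).
Proof.
move=> xy; have /ler_normlP[_ +] := lip (acl x) (cl_le xy) (clb y).
by rewrite /G; move: (cl x) (cl y) => X Y; lra.
Qed.

Let D0 : 0 < D.
Proof.
by have := G_lo (ltW ab); rewrite cla clb' -/D; apply: lt_le_trans; rewrite subr_gt0.
Qed.

Let F t := (G t - G a) / D.

Let F_nd : nondecreasing F.
Proof.
move=> x y xy; rewrite ler_pM2r ?invr_gt0// lerD2r -subr_ge0.
by apply: le_trans (G_lo xy); rewrite subr_ge0 cl_le.
Qed.

Let F_lip x y : x <= y -> F y - F x <= (2 * M + 1) / D * (y - x).
Proof.
move=> xy; rewrite /F -mulrBl opprB addrA subrK mulrAC ler_pM2r ?invr_gt0//.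
apply: le_trans (G_up xy) _; rewrite ler_wpM2l ?cl_lip//.
by rewrite addr_ge0 ?mulr_ge0.
Qed.

Let K0 : 0 <= (2 * M + 1) / D.
Proof. by rewrite divr_ge0 ?(ltW D0)// addr_ge0 ?mulr_ge0. Qed.

Let F_rc : right_continuous F.
Proof.
move=> x; apply/cvgrPdist_lt => e e0; near=> y.
have xy : x <= y by near: y; exact: nbhs_right_ge.
rewrite distrC ger0_norm ?subr_ge0 ?F_nd//; apply: le_lt_trans (F_lip xy) _.
apply: (@le_lt_trans _ _ (((2 * M + 1) / D + 1) * (y - x))).
  by rewrite ler_wpM2r ?subr_ge0// lerDl.
rewrite -ltr_pdivlMl ?ltr_wpDl// ltrBlDl.
by near: y; apply: nbhs_right_lt; rewrite ltrDl mulr_gt0// invr_gt0 ltr_wpDl.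
Unshelve. all: by end_near. Qed.

HB.instance Definition _ := isCumulative.Build R _ R F F_nd F_rc.

Let F_Ny : F @ -oo --> (0 : R).
Proof.
apply: cvg_near_cst; near=> t.
have ta : t <= a by near: t; apply: nbhs_ninfty_le; exact: num_real.
by rewrite /F /G cla /cl min_r ?(le_trans ta (ltW ab))// max_l// subrr mul0r.
Unshelve. all: by end_near. Qed.

Let F_y : F @ +oo --> (1 : R).
Proof.
apply: cvg_near_cst; near=> t.
have bt : b <= t by near: t; apply: nbhs_pinfty_ge; exact: num_real.
rewrite /F (_ : G t = G b) ?divff ?gt_eqF//.
by rewrite /G clb' /cl min_l// max_r// ltW.
Unshelve. all: by end_near. Qed.

HB.instance Definition _ := isCumulativeBounded.Build R 0 1 F F_Ny F_y.

Lemma lipschitz_derivable_ae :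
  {ae mu, forall t, t \in `]a, b[ -> derivable phi t 1}.
Proof.
have := lipschitz_cumulative_derivable (F := F) K0 F_lip.
apply: lebesgue_aeS => t dF; rewrite in_itv/= => /andP[at' tb].
have near_phi : {near t, (fun s => D * F s + G a - (M + 1) * s) =1 phi}.
  near=> s; rewrite /F mulrC divfK ?gt_eqF// subrK /G cl_id ?addrK//.
    by near: s; exact: lt_le_nbhsr.
  by near: s; exact: lt_le_nbhsl.
apply: (near_eq_derivable near_phi).
have dD : derivable (fun s => D * F s) t 1 by exact: derivableZ dF.
have dM : derivable (fun s : R => (M + 1) * s) t 1.
  by apply: derivableZ; exact: derivable_id.
exact: (derivableB (derivableD dD (@derivable_cst _ _ _ (G a) t 1)) dM).
Unshelve. all: by end_near. Qed.

End Extension.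

End Rademacher.

(** * Vector calculus *)

Section Vectors.
Variable R : realType.
Implicit Types n m : nat.

Lemma entry_le_norm n (v : 'cV[R]_n) i : `|v i 0| <= `|v|.
Proof.
rewrite [leRHS]/Num.Def.normr/= mx_normrE.
exact: (@le_bigmax _ _ _ _ (fun ij : 'I_n * 'I_1 => `|v ij.1 ij.2|) (i, 0)).
Qed.

Lemma norm_le_entries n (v : 'cV[R]_n) c : 0 <= c ->
  (forall i, `|v i 0| <= c) -> `|v| <= c.
Proof.
move=> c0 H; rewrite [leLHS]/Num.Def.normr/= mx_normrE.
by apply: bigmax_le => //= -[i j] _; rewrite (ord1 j).
Qed.

Lemma norm_fst_le (U V : normedModType R) (p : U * V) : `|p.1| <= `|p|.
Proof. by rewrite prod_normE le_max lexx. Qed.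

Lemma norm_snd_le (U V : normedModType R) (p : U * V) : `|p.2| <= `|p|.
Proof. by rewrite prod_normE le_max lexx orbT. Qed.

Lemma norm_pair_le (U V : normedModType R) (p : U * V) c :
  `|p.1| <= c -> `|p.2| <= c -> `|p| <= c.
Proof. by rewrite prod_normE ge_max => -> ->. Qed.

Lemma dotE n (u v : 'cV[R]_n) : dot u v = \sum_i u i 0 * v i 0.
Proof. by rewrite /dot mxE; apply: eq_bigr => i _; rewrite mxE. Qed.

Lemma dotC n (u v : 'cV[R]_n) : dot u v = dot v u.
Proof. by rewrite !dotE; apply: eq_bigr => i _; rewrite mulrC. Qed.

Lemma dotDr n (u v w : 'cV[R]_n) : dot u (v + w) = dot u v + dot u w.
Proof. by rewrite /dot mulmxDr mxE. Qed.

Lemma dotZr n k (u v : 'cV[R]_n) : dot u (k *: v) = k * dot u v.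
Proof. by rewrite /dot -scalemxAr mxE. Qed.

Lemma dotDl n (u v w : 'cV[R]_n) : dot (u + v) w = dot u w + dot v w.
Proof. by rewrite dotC dotDr !(dotC w). Qed.

Lemma dotZl n k (u v : 'cV[R]_n) : dot (k *: u) v = k * dot u v.
Proof. by rewrite dotC dotZr dotC. Qed.

Lemma dotNr n (u v : 'cV[R]_n) : dot u (- v) = - dot u v.
Proof. by rewrite -scaleN1r dotZr mulN1r. Qed.

Lemma dotNl n (u v : 'cV[R]_n) : dot (- u) v = - dot u v.
Proof. by rewrite -scaleN1r dotZl mulN1r. Qed.

Lemma dotBr n (u v w : 'cV[R]_n) : dot u (v - w) = dot u v - dot u w.
Proof. by rewrite dotDr dotNr. Qed.

Lemma dotBl n (u v w : 'cV[R]_n) : dot (u - v) w = dot u w - dot v w.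
Proof. by rewrite dotDl dotNl. Qed.

Lemma dot0r n (u : 'cV[R]_n) : dot u 0 = 0.
Proof. by rewrite -(scale0r 0) dotZr mul0r. Qed.

Lemma dot0l n (u : 'cV[R]_n) : dot 0 u = 0.
Proof. by rewrite dotC dot0r. Qed.

Lemma dot_mulmx n (P : 'M[R]_n) (u v : 'cV[R]_n) :
  dot u (P *m v) = dot (P^T *m u) v.
Proof. by rewrite /dot trmx_mul trmxK mulmxA. Qed.

Lemma dot_ge0 n (u : 'cV[R]_n) : 0 <= dot u u.
Proof. by rewrite dotE sumr_ge0// => i _; rewrite -expr2 sqr_ge0. Qed.

Lemma dot_sqr_entry n (u : 'cV[R]_n) i : u i 0 ^+ 2 <= dot u u.
Proof.
rewrite dotE (bigD1 i)//= -expr2 lerDl sumr_ge0// => j _.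
by rewrite -expr2 sqr_ge0.
Qed.

Lemma dot_le n (u v : 'cV[R]_n) : `|dot u v| <= n%:R * `|u| * `|v|.
Proof.
rewrite dotE (le_trans (ler_norm_sum _ _ _))//.
apply: (@le_trans _ _ (\sum_(i < n) `|u| * `|v|)).
  by apply: ler_sum => i _; rewrite normrM ler_pM// entry_le_norm.
by rewrite sumr_const card_ord -mulrA mulr_natl.
Qed.

Lemma mulmx_norm_le n (A : 'M[R]_n) :
  exists2 C, 0 <= C & forall v : 'cV[R]_n, `|A *m v| <= C * `|v|.
Proof.
exists (\sum_i \sum_j `|A i j|).
  by rewrite sumr_ge0// => i _; rewrite sumr_ge0.
move=> v; apply: norm_le_entries => [|i].
  by rewrite mulr_ge0// sumr_ge0// => i _; rewrite sumr_ge0.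
rewrite mxE (le_trans (ler_norm_sum _ _ _))//.
apply: (@le_trans _ _ ((\sum_j `|A i j|) * `|v|)).
  rewrite mulr_suml ler_sum// => j _.
  by rewrite normrM ler_wpM2l// entry_le_norm.
rewrite ler_wpM2r// [leRHS](bigD1 i)//= lerDl sumr_ge0// => k _.
by rewrite sumr_ge0.
Qed.

Lemma bounded_form_fst m n i :
  bounded_form (fun p : 'cV[R]_m * 'cV[R]_n => p.1 i 0).
Proof.
split; [by move=> u v; rewrite mxE|by move=> k v; rewrite mxE|].
by exists 1 => // v; rewrite mul1r (le_trans (entry_le_norm _ _))// norm_fst_le.
Qed.

Lemma bounded_form_dot_snd m n (u : 'cV[R]_n) :
  bounded_form (fun p : 'cV[R]_m * 'cV[R]_n => dot u p.2).
Proof.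
split; [by move=> v w; rewrite dotDr|by move=> k v; rewrite dotZr|].
exists (n%:R * `|u|); first by rewrite mulr_ge0.
move=> v; rewrite (le_trans (dot_le _ _))// ler_wpM2l ?mulr_ge0//.
exact: norm_snd_le.
Qed.

Lemma bounded_formN (V : normedModType R) (l : V -> R) :
  bounded_form l -> bounded_form (fun v => - l v).
Proof.
case=> lD lZ [C C0 lC]; split; [by move=> u v; rewrite lD opprD| |].
  by move=> k v; rewrite lZ mulrN.
by exists C => // v; rewrite normrN.
Qed.

Lemma cvg_dot n (T : Type) (F : set_system T) {FF : Filter F}
  (u v : T -> 'cV[R]_n) (a b : 'cV[R]_n) :
  u @ F --> a -> v @ F --> b -> dot (u x) (v x) @[x --> F] --> dot a b.
Proof.
move=> ua vb; rewrite dotE.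
rewrite (_ : (fun x => dot (u x) (v x)) = (fun x => \sum_i u x i 0 * v x i 0)).
  apply: (@cvg_big _ _ +%R 0 _ add_continuous) => // i _.
  apply: cvgM.
    exact: (cvg_comp _ (fun w : 'cV[R]_n => w i 0) ua (@coord_continuous _ _ _ i 0 a)).
  exact: (cvg_comp _ (fun w : 'cV[R]_n => w i 0) vb (@coord_continuous _ _ _ i 0 b)).
by apply/funext => x; rewrite dotE.
Qed.

Lemma cvg_mulmx n (T : Type) (F : set_system T) {FF : Filter F}
  (A : 'M[R]_n) (u : T -> 'cV[R]_n) (a : 'cV[R]_n) :
  u @ F --> a -> A *m u x @[x --> F] --> A *m a.
Proof.
move=> /cvgrPdist_lt ua; have [C C0 AC] := mulmx_norm_le A.
have C1 : 0 < C + 1 by rewrite ltr_wpDl.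
apply/cvgrPdist_lt => e e0; have := ua (e / (C + 1)).
rewrite divr_gt0// => /(_ isT); apply: filterS => x.
rewrite ltr_pdivlMr// => h; rewrite -mulmxBr (le_lt_trans (AC _))//.
by apply: le_lt_trans h; rewrite mulrC ler_wpM2l// lerDl.
Qed.

Lemma compact_cball n (B : R) : compact [set v : 'cV[R]_n | `|v| <= B].
Proof.
have [B0|B0] := leP 0 B; last first.
  rewrite (_ : mkset _ = set0); first exact: compact0.
  rewrite -subset0 => v /=; rewrite leNgt (lt_le_trans B0)//.
have h : compact [set v : 'rV[R]_n | forall i, `[- B, B]%classic (v ord0 i)].
  by apply: (@rV_compact R n (fun=> `[- B, B]%classic)) => i; exact: segment_compact.
rewrite (_ : mkset _ = trmx @` [set v : 'rV[R]_n | forall i, `[- B, B]%classic (v ord0 i)]).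
  have ct : continuous (trmx : 'rV[R]_n -> 'cV[R]_n).
    move=> v; apply/(@cvgrPdist_le _ _ _ (nbhs v)) => e e0; near=> w.
    rewrite -linearB/=; apply: (@le_trans _ _ `|v - w|).
      apply: norm_le_entries => // i; rewrite mxE.
      rewrite [leRHS]/Num.Def.normr/= mx_normrE.
      exact: (@le_bigmax _ _ _ _ (fun ij : 'I_1 * 'I_n => `|(v - w) ij.1 ij.2|) (0, i)).
    by near: w; exact: cvgr_dist_le.
  by apply: continuous_compact => //; exact: continuous_subspaceT.
apply/seteqP; split=> [v /= vB|_ [v /= vB <-]].
  exists v^T; last by rewrite trmxK.
  by move=> i; rewrite /= mxE in_itv/= -ler_norml (le_trans (entry_le_norm _ _)).
apply: norm_le_entries => // i; rewrite mxE.
by have := vB i; rewrite /= in_itv/= -ler_norml.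
Unshelve. all: by end_near. Qed.

Lemma compact_cball_pair m n (B B' : R) :
  compact [set p : 'cV[R]_m * 'cV[R]_n | `|p.1| <= B /\ `|p.2| <= B'].
Proof. exact: (compact_setX (@compact_cball m B) (@compact_cball n B')). Qed.

Lemma continuous_compact_bounded (T : topologicalType) (V : normedModType R)
  (K : set T) (F : T -> V) : compact K -> continuous F ->
  exists2 C, 0 < C & forall x, K x -> `|F x| <= C.
Proof.
move=> cK cF; have : bounded_set (F @` K).
  by apply: compact_bounded; apply: continuous_compact => //; exact: continuous_subspaceT.
move=> /ex_strict_bound_gt0[C C0 /= FC]; exists C => // x Kx.
by apply/ltW/FC; exists x.
Qed.

Lemma derivable_pair (U V : normedModType R) (phi : R -> U * V) t :
  derivable phi t 1 <->
  derivable (fun s => (phi s).1) t 1 /\ derivable (fun s => (phi s).2) t 1.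
Proof.
split=> [/cvg_ex[/= [l1 l2] H]|[/cvg_ex[l1 H1] /cvg_ex[l2 H2]]].
  split; apply/cvg_ex; [exists l1|exists l2].
    exact: (cvg_comp _ fst H cvg_fst).
  exact: (cvg_comp _ snd H cvg_snd).
by apply/cvg_ex; exists (l1, l2); exact: cvg_pair H1 H2.
Qed.

Lemma derive1_pair (U V : normedModType R) (phi : R -> U * V) t :
  derivable phi t 1 -> derive1 phi t =
  (derive1 (fun s => (phi s).1) t, derive1 (fun s => (phi s).2) t).
Proof.
move=> /cvg_ex[/= [l1 l2] H].
have H1 : (h^-1 *: ((phi (h *: 1 + t)).1 - (phi t).1)) @[h --> (0 : R)^'] --> l1.
  exact: (cvg_comp _ fst H cvg_fst).
have H2 : (h^-1 *: ((phi (h *: 1 + t)).2 - (phi t).2)) @[h --> (0 : R)^'] --> l2.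
  exact: (cvg_comp _ snd H cvg_snd).
rewrite !derive1E (_ : 'D_1 phi t = (l1, l2)); last exact: cvg_lim.
rewrite (_ : 'D_1 (fun s => (phi s).1) t = l1); last exact: cvg_lim.
by rewrite (_ : 'D_1 (fun s => (phi s).2) t = l2); last exact: cvg_lim.
Qed.

Lemma lipschitz_curve_derivable m n a b M (phi : R -> 'cV[R]_m * 'cV[R]_n) :
  lipschitz_curve a b M phi ->
  {ae @lebesgue_measure R, forall t, t \in `]a, b[ -> derivable phi t 1}.
Proof.
move=> lip; have [ab|ba] := ltP a b; last first.
  by apply: aeW => t; rewrite in_itv/= => /andP[/lt_trans/[apply]]; rewrite ltNge ba.
have M0 : 0 <= M.
  by rewrite -(pmulr_lge0 M (_ : 0 < b - a)) ?subr_gt0// (le_trans _ (lip a b _ _ _))// ltW.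
have ae_all k (F : 'I_k -> R -> R) : (forall i, lipschitz_curve a b M (F i)) ->
   {ae @lebesgue_measure R, forall t, forall i, t \in `]a, b[ -> derivable (F i) t 1}.
  move=> FL; rewrite /almost_everywhere/=.
  have := @negligible_bigcup _ _ _ (@lebesgue_measure R)
    (fun k' => if insub k' is Some i then ~` [set t | t \in `]a, b[ -> derivable (F i) t 1] else set0).
  move=> H; have {}H := H _.
  apply: negligibleS (H _).
    move=> t /= /existsNP[i Hi]; exists (val i) => //=; rewrite valK.
    exact: Hi.
  move=> j; case: insubP => [i _ _|_]; last exact: negligible_set0.
  exact: (lipschitz_derivable_ae ab M0 (FL i)).
have h1 := ae_all m (fun i s => (phi s).1 i 0) _.
have h2 := ae_all n (fun i s => (phi s).2 i 0) _.
have {}h1 := h1 _; have {}h2 := h2 _.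
apply: lebesgue_aeS (lebesgue_aeI (h1 _) (h2 _)).
- move=> t [H1 H2] tab; apply/derivable_pair; split; apply/derivable_mxP => i j.
    by rewrite (ord1 j); exact: H1.
  by rewrite (ord1 j); exact: H2.
- move=> i u v au uv vb; apply: le_trans (lip _ _ au uv vb).
  apply: le_trans (norm_fst_le _).
  by have := entry_le_norm (phi v - phi u).1 i; rewrite !mxE.
- move=> i u v au uv vb; apply: le_trans (lip _ _ au uv vb).
  apply: le_trans (norm_snd_le _).
  by have := entry_le_norm (phi v - phi u).2 i; rewrite !mxE.
Qed.

End Vectors.

Section Calculus.
Variable R : realType.
Implicit Types n m : nat.

Lemma diff_grad n (h : 'cV[R]_n -> R) x v :
  differentiable h x -> 'd h x v = dot (grad h x) v.
Proof.
move=> dh; rewrite [in LHS](matrix_sum_delta v) dotE linear_sum/=.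
apply: eq_bigr => i _; rewrite big_ord1 linearZ/= mxE deriveE//.
by rewrite /GRing.scale/= mulrC.
Qed.

Lemma derivable_comp_grad n (h : 'cV[R]_n -> R) (x : R -> 'cV[R]_n) t :
  differentiable h (x t) -> derivable x t 1 ->
  derivable (h \o x) t 1 /\ derive1 (h \o x) t = dot (grad h (x t)) (derive1 x t).
Proof.
move=> dh dx; have dx' : differentiable x t by exact/derivable1_diffP.
have dhx : differentiable (h \o x) t by exact: differentiable_comp.
split; first exact/derivable1_diffP.
rewrite !derive1E !deriveE//.
by rewrite -(diff_grad _ dh) diff_comp.
Qed.

Lemma mean_value_grad n (h : 'cV[R]_n -> R) x y :
  (forall z, differentiable h z) ->
  exists s, [/\ 0 <= s, s <= 1 &
    h y - h x = dot (grad h (x + s *: (y - x))) (y - x)].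
Proof.
move=> dh; pose c (s : R) := x + s *: (y - x).
have dc s : is_derive s (1 : R) c (y - x).
  have cvgc : (k^-1 *: (c (k *: 1 + s) - c s)) @[k --> (0 : R)^'] --> y - x.
    apply: cvg_near_cst; near=> k.
    have k0 : k != 0 by near: k; exact: nbhs_dnbhs_neq.
    rewrite /c /= opprD addrACA subrr add0r -scalerBl addrK.
    by rewrite [_ *: 1](_ : _ = k) ?scalerA ?mulVf ?scale1r// /GRing.scale/= mulr1.
  by apply: DeriveDef; [apply/cvg_ex; exists (y - x)|exact: cvg_lim].
have dhc (s : R) : is_derive s (1 : R) (h \o c) (dot (grad h (c s)) (y - x)).
  have [d1 d2] := derivable_comp_grad (dh (c s)) (@ex_derive _ _ _ _ _ _ _ (dc s)).
  apply: DeriveDef => //; rewrite -derive1E d2 derive1E.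
  by rewrite (@derive_val _ _ _ _ _ _ _ (dc s)).
have [|s s01 E] := @MVT_segment R (h \o c) (fun s => dot (grad h (c s)) (y - x)) 0 1 ler01.
  apply: continuous_subspaceT => s; apply: differentiable_continuous.
  exact/derivable1_diffP/(@ex_derive _ _ _ _ _ _ _ (dhc s)).
exists s; move: s01; rewrite in_itv/= => /andP[-> ->]; split=> //.
by move: E; rewrite /c /= scale1r scale0r addr0 subrKC subr0 mulr1.
Unshelve. all: by end_near. Qed.

Lemma segment_cball n (B : R) (x y : 'cV[R]_n) s : 0 <= s -> s <= 1 ->
  `|x| <= B -> `|y| <= B -> `|x + s *: (y - x)| <= B.
Proof.
move=> s0 s1 xB yB.
have -> : x + s *: (y - x) = (1 - s) *: x + s *: y.
  by rewrite scalerBr scalerBl scale1r addrA addrAC.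
apply: (le_trans (ler_normD _ _)); rewrite !normrZ (ger0_norm s0) ger0_norm ?subr_ge0//.
have : s * `|y| <= s * B by rewrite ler_wpM2l.
have : (1 - s) * `|x| <= (1 - s) * B by rewrite ler_wpM2l// subr_ge0.
lra.
Qed.

Lemma C1_lipschitz_cball n (h : 'cV[R]_n -> R) B : C1 h ->
  exists2 C, 0 <= C & forall x y, `|x| <= B -> `|y| <= B ->
    `|h y - h x| <= C * `|y - x|.
Proof.
move=> [dh ch]; have [C C0 hC] := continuous_compact_bounded (@compact_cball R n B) ch.
exists (n%:R * C); first by rewrite mulr_ge0// ltW.
move=> x y xB yB; have [s [s0 s1 ->]] := mean_value_grad x y dh.
rewrite (le_trans (dot_le _ _))// ler_wpM2r// ler_wpM2l// hC//=.
exact: segment_cball.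
Qed.

(** Covering [K] times [K] instead of [K] treats close and distant pairs alike and avoids convexity.
    The bounds are monotone in the constant, so one large [M] serves every piece. *)
Lemma locally_lipschitz_compact (V W : normedModType R) (F : V -> W) (K : set V) :
  compact K -> locally_lipschitz F ->
  exists2 C, 0 <= C & forall x y, K x -> K y -> `|F y - F x| <= C * `|y - x|.
Proof.
move=> cK lF; have := compact_setX cK cK => /compact_near_coveringP.
move=> /(_ R +oo%R (fun M q => `|F q.1 - F q.2| <= M * `|q.1 - q.2|)) H.
have {H} : \forall M \near +oo, K `*` K `<=`
    (fun q => `|F q.1 - F q.2| <= M * `|q.1 - q.2|).
  apply: H => q _; have /pinfty_ex_gt0[M M0] := lF q (conj I I).
  move=> HM0; have HM : \forall q' \near q, `|F q'.1 - F q'.2| <= M * `|q'.1 - q'.2|.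
    have HM1 : nbhs q (fun q' => (setT `*` setT) q' -> `|F q'.1 - F q'.2| <= M * `|q'.1 - q'.2|).
      exact: HM0.
    by apply: (@filterS _ (nbhs q) _ _ _ _ HM1) => q'; apply.
  exists ([set q : V * V | `|F q.1 - F q.2| <= M * `|q.1 - q.2|], [set k : R | M <= k]).
    split => //=; apply: nbhs_pinfty_ge; exact: num_real.
  move=> [a k] [/= h1 h2]; apply: le_trans h1 _.
  by rewrite ler_wpM2r.
move=> /pinfty_ex_gt0[M M0 HM]; exists M; first exact: ltW.
by move=> x y Kx Ky; exact: (HM (y, x)).
Qed.

Lemma locally_lipschitz_continuous (V W : normedModType R) (F : V -> W) :
  locally_lipschitz F -> continuous F.
Proof.
move=> lF x; have /pinfty_ex_gt0[M M0] := lF (x, x) (conj I I).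
move=> HM0; have [[A B] [/= Ax Bx] AB] : \forall q' \near (x, x),
    `|F q'.1 - F q'.2| <= M * `|q'.1 - q'.2|.
  have HM1 : nbhs (x, x) (fun q' => (setT `*` setT) q' -> `|F q'.1 - F q'.2| <= M * `|q'.1 - q'.2|).
    exact: HM0.
  by apply: (@filterS _ (nbhs (x, x)) _ _ _ _ HM1) => q'; apply.
apply/cvgrPdist_le => e e0; near=> y.
have /= H := AB (x, y) (conj (nbhs_singleton Ax) _).
apply: (@le_trans _ _ (M * `|x - y|)).
  by apply: H; near: y.
rewrite -ler_pdivlMl//; near: y; apply: cvgr_dist_le => //.
by rewrite mulr_gt0// invr_gt0.
Unshelve. all: by end_near. Qed.

(** The intermediate point of the mean value theorem is within [|y - x|] of [x], so a Lipschitz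
    gradient makes the error quadratic. *)
Lemma C11_taylor n (h : 'cV[R]_n -> R) B : C1 h -> locally_lipschitz (grad h) ->
  exists2 C, 0 <= C & forall x y, `|x| <= B -> `|y| <= B ->
    `|h y - h x - dot (grad h x) (y - x)| <= C * `|y - x| ^+ 2.
Proof.
move=> [dh ch] lh.
have [C C0 hC] := locally_lipschitz_compact (@compact_cball R n B) lh.
exists (n%:R * C); first by rewrite mulr_ge0.
move=> x y xB yB; have [s [s0 s1 ->]] := mean_value_grad x y dh.
rewrite -dotBl (le_trans (dot_le _ _))// -!mulrA ler_wpM2l// expr2 mulrA.
rewrite ler_wpM2r// (le_trans (hC _ _ _ _))//=.
  exact: segment_cball.
rewrite (addrC x) addrK normrZ ger0_norm// ler_wpM2l//.
by rewrite ler_piMl.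
Qed.

Lemma C1_continuous n (h : 'cV[R]_n -> R) : C1 h -> continuous h.
Proof. by move=> [dh _] x; exact: differentiable_continuous. Qed.

End Calculus.

(** * Projections and tangent cones *)

Section Projection.
Variables (R : realType) (n : nat) (P : 'M[R]_n).
Hypothesis P_posdef : sym_posdef P.
Implicit Types (u v w mu fp a : 'cV[R]_n) (A : set 'cV[R]_n).

Lemma pform_dot v : (v^T *m P *m v) 0 0 = dot v (P *m v).
Proof. by rewrite /dot mulmxA. Qed.

Lemma pform_gt0 v : v != 0 -> 0 < dot v (P *m v).
Proof. by move=> v0; rewrite -pform_dot; exact: P_posdef.2. Qed.

Lemma pform_ge0 v : 0 <= dot v (P *m v).
Proof.
by have [->|/pform_gt0/ltW//] := eqVneq v 0; rewrite dot0l.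
Qed.

Lemma pnorm_sqr v : pnorm P v ^+ 2 = dot v (P *m v).
Proof. by rewrite /pnorm pform_dot sqr_sqrtr// pform_ge0. Qed.

Lemma pform_sym u v : dot u (P *m v) = dot v (P *m u).
Proof. by rewrite dot_mulmx P_posdef.1 dotC. Qed.

Lemma posdef_unitmx : P \in unitmx.
Proof.
rewrite unitmxE unitfE; apply/negP => /det0P[v v0 vP].
have := @pform_gt0 v^T; rewrite -pform_dot trmxK vP mul0mx mxE ltxx.
by move=> H; suff: false by []; apply: H; rewrite -(inj_eq (@trmx_inj _ _ _)) trmxK trmx0.
Qed.

Lemma invmx_sym : (invmx P)^T = invmx P.
Proof. by rewrite trmx_inv P_posdef.1. Qed.

Lemma dot_P_invP u a : dot (P *m u) (invmx P *m a) = dot a u.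
Proof.
by rewrite dot_mulmx invmx_sym mulmxA mulVmx ?posdef_unitmx// mul1mx dotC.
Qed.

Lemma invP_form_gt0 a : a != 0 -> 0 < dot a (invmx P *m a).
Proof.
move=> a0; rewrite -[X in dot X _](mulKVmx posdef_unitmx) dotC -(pform_sym _ _).
apply: pform_gt0; apply: contra_neq a0 => H.
by rewrite -(mulKVmx posdef_unitmx a) H mulmx0.
Qed.

(** Expansion of the squared distance to [fp] around a candidate [v]: the cross term is the one in
    the variational inequality of the projection. *)
Lemma pform_shift u v fp : dot (u - fp) (P *m (u - fp)) =
  dot (u - v) (P *m (u - v)) + 2 * dot (P *m (u - v)) (v - fp) +
  dot (v - fp) (P *m (v - fp)).
Proof.
have -> : u - fp = (u - v) + (v - fp) by rewrite addrA subrK.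
move: (u - v) (v - fp) => d e.
rewrite mulmxDr !dotDl !dotDr (pform_sym e d) (dotC (P *m d) e) (pform_sym e d).
by ring.
Qed.

Lemma argmin_of_variational A v fp : A v ->
  (forall mu, A mu -> 0 <= dot (P *m (mu - v)) (v - fp)) ->
  argmin A (fun mu => pnorm P (mu - fp) ^+ 2) v.
Proof.
move=> Av H; split=> // mu Amu; rewrite !pnorm_sqr (pform_shift mu v).
by rewrite lerDr addr_ge0 ?pform_ge0// mulr_ge0// H.
Qed.

Lemma argmin_variational_unique A v w fp : A v ->
  (forall mu, A mu -> 0 <= dot (P *m (mu - v)) (v - fp)) ->
  argmin A (fun mu => pnorm P (mu - fp) ^+ 2) w -> w = v.
Proof.
move=> Av H [Aw /(_ v Av)]; rewrite !pnorm_sqr (pform_shift w v) gerDr => le0.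
apply/eqP; rewrite -subr_eq0; apply/negPn/negP => /pform_gt0.
have := H _ Aw; lra.
Qed.

(** Only the segment from [v] to [mu] has to lie in [A], because membership in a tangent cone will
    be available for strictly inward directions. *)
Lemma variational_of_argmin A v fp mu :
  argmin A (fun mu => pnorm P (mu - fp) ^+ 2) v ->
  (forall s, 0 < s -> s <= 1 -> A (v + s *: (mu - v))) ->
  0 <= dot (P *m (mu - v)) (v - fp).
Proof.
move=> [Av vmin] H; set d := mu - v; set c := dot _ _.
have key s : 0 < s -> s <= 1 -> 0 <= s * dot d (P *m d) + 2 * c.
  move=> s0 s1; have := vmin _ (H s s0 s1); rewrite !pnorm_sqr.
  have E : v + s *: d - v = s *: d by rewrite addrAC subrr add0r.
  rewrite -/d (pform_shift (v + s *: d) v fp) E lerDr.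
  rewrite -!scalemxAr !dotZl !dotZr -/c.
  have -> : s * (s * dot d (P *m d)) + 2 * (s * c) = s * (s * dot d (P *m d) + 2 * c).
    by ring.
  by rewrite pmulr_rge0.
rewrite leNgt; apply/negP => c0.
(* With this [s] the quadratic term is at most [- c], too small to outweigh the negative [2 * c]. *)
have D0 := pform_ge0 d; pose s := Num.min 1 (- c / (dot d (P *m d) + 1)).
have D1 : 0 < dot d (P *m d) + 1 by rewrite ltr_wpDl.
have s0 : 0 < s by rewrite lt_min ltr01/= divr_gt0// oppr_gt0.
have s1 : s <= 1 by rewrite ge_min lexx.
have := key s s0 s1; apply/negP; rewrite -ltNge.
have : s * dot d (P *m d) <= - c.
  apply: (@le_trans _ _ (- c / (dot d (P *m d) + 1) * dot d (P *m d))).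
    by rewrite ler_wpM2r// ge_min lexx orbT.
  rewrite -mulrA ler_piMr ?oppr_ge0 ?(ltW c0)//.
  by rewrite ler_pdivrMl// mulr1 lerDl.
lra.
Qed.

(** [lam] obeys complementary slackness: it vanishes or the constraint is active. If [a] is zero,
    the second alternative gives [lam = 0] and the quotient by [q = 0] is harmlessly zero. *)
Lemma halfspace_argmin a b fp :
  let q := dot a (invmx P *m a) in
  let lam := Num.max 0 (- (dot a fp + b)) in
  0 < q \/ 0 <= dot a fp + b ->
  argmin [set mu | 0 <= dot a mu + b] (fun mu => pnorm P (mu - fp) ^+ 2) =
  [set fp + (lam / q) *: (invmx P *m a)].
Proof.
move=> q lam H.
have lam0 : 0 <= lam by rewrite le_max lexx.
have q0 : 0 <= q.
  rewrite /q; have [->|/invP_form_gt0/ltW//] := eqVneq a 0.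
  by rewrite dot0l.
set v := fp + _.
have av : dot a v = dot a fp + lam.
  rewrite dotDr dotZr -/q; congr (_ + _).
  case: H => [q1|H]; first by rewrite divfK ?gt_eqF.
  by rewrite /lam max_l ?mul0r// oppr_le0.
have Av : [set mu | 0 <= dot a mu + b] v.
  rewrite /= av addrAC -[X in X + _]opprK -/lam addrC subr_ge0.
  by rewrite le_max lexx orbT.
have VI mu : [set mu | 0 <= dot a mu + b] mu -> 0 <= dot (P *m (mu - v)) (v - fp).
  move=> /= amu; rewrite /v addrAC subrr add0r -/v dotZr dot_P_invP dotBr av.
  have [h|h] := leP (- (dot a fp + b)) 0; first by rewrite /lam max_l// !mul0r.
  rewrite mulr_ge0 ?divr_ge0//.
  have : lam = - (dot a fp + b) by rewrite /lam max_r// ltW.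
  lra.
apply/seteqP; split=> w.
  by move=> /(argmin_variational_unique Av VI) ->.
by move=> ->; exact: argmin_of_variational.
Qed.

End Projection.

Section TangentCone.
Variables (R : realType) (n : nat) (h : 'cV[R]_n -> R).
Hypotheses (h_C1 : C1 h) (h_lip : locally_lipschitz (grad h)).
Implicit Types (x w : 'cV[R]_n).

(** Feasibility of [x_ i] bounds the first-order term from below by the Taylor remainder. Divided by
    [t_ i], the remainder is a bounded factor times [|x_ i - x|] and disappears. *)
Lemma tangent_cone_boundary x w : h x = 0 ->
  tangent_cone (superlevel h) x w -> 0 <= dot (grad h x) w.
Proof.
move=> hx0 [x_ [t_ [Sx xx t0 _ tw]]].
have [C C0 taylor] := C11_taylor (`|x| + 1) h_C1 h_lip.
pose w_ i := (t_ i)^-1 *: (x_ i - x).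
have cvg1 : dot (grad h x) (w_ i) + C * (`|w_ i| * `|x_ i - x|) @[i --> \oo] -->
    dot (grad h x) w + C * (`|w| * `|x - x|).
  apply: cvgD; first exact: (cvg_dot (cvg_cst _) tw).
  apply: cvgM; first exact: cvg_cst.
  apply: cvgM; first exact: cvg_norm tw.
  by apply: cvg_norm; apply: cvgB => //; exact: cvg_cst.
rewrite subrr normr0 mulr0 mulr0 addr0 in cvg1.
apply: (cvgr_to_ge cvg1); near=> i.
have xi : `|x_ i| <= `|x| + 1.
  rewrite -[x_ i](subrK x) addrC (le_trans (ler_normD _ _))// lerD2l distrC.
  by near: i; move/cvgrPdist_le : xx; apply.
have := taylor x (x_ i) _ xi; rewrite lerDl ler01 => /(_ isT).
rewrite hx0 subr0 => /ler_normlP[_].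
have := Sx i; rewrite /superlevel/= => Sxi H.
have : 0 <= (t_ i)^-1 * (dot (grad h x) (x_ i - x) + C * `|x_ i - x| ^+ 2).
  rewrite mulr_ge0 ?invr_ge0 ?(ltW (t0 i))//; lra.
rewrite mulrDr -dotZr -/(w_ i) => /le_trans; apply; rewrite lerD2l.
rewrite /w_ normrZ gtr0_norm ?invr_gt0// expr2.
by rewrite le_eqVlt; apply/orP; left; apply/eqP; ring.
Unshelve. all: by end_near. Qed.

(** With strict inequalities the straight ray is feasible for small times, without any curved
    correction. Directions that are not strictly inward are approached later by perturbation. *)
Lemma tangent_cone_strict x w : 0 <= h x ->
  0 < h x \/ 0 < dot (grad h x) w -> tangent_cone (superlevel h) x w.
Proof.
move=> hx0 H.
have [C C0 taylor] := C11_taylor (`|x| + `|w|) h_C1 h_lip.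
suff [d d0 hd] : exists2 d, 0 < d & forall t, 0 < t -> t <= d -> 0 <= h (x + t *: w).
  exists (fun i => x + (d / i.+1%:R) *: w), (fun i => d / i.+1%:R).
  have cvg0 : (fun i => d / i.+1%:R) @ \oo --> (0 : R).
    rewrite -[X in _ --> X](mulr0 d); apply: cvgM; first exact: cvg_cst.
    exact: (@cvg_harmonic R).
  split=> [i| |i| |]; rewrite ?divr_gt0//.
  - apply: hd; first by rewrite divr_gt0.
    by rewrite ler_pdivrMr// ler_peMr ?(ltW d0)// ler1n.
  - rewrite -[X in _ --> X]addr0; apply: cvgD; first exact: cvg_cst.
    by rewrite -(scale0r w); exact: cvgZr_tmp.
  - rewrite (_ : (fun i => _) = cst w); first exact: cvg_cst.
    apply/funext => i; rewrite /= addrAC subrr add0r scalerA mulVf ?scale1r//.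
    by rewrite gt_eqF// divr_gt0.
have key t : 0 < t -> t <= 1 ->
    h x + t * (dot (grad h x) w - C * t * `|w| ^+ 2) <= h (x + t *: w).
  move=> t0 t1; have := taylor x (x + t *: w).
  rewrite lerDl normr_ge0.
  have -> : `|x + t *: w| <= `|x| + `|w|.
    rewrite (le_trans (ler_normD _ _))// lerD2l normrZ gtr0_norm//.
    by rewrite ler_piMl.
  have -> : x + t *: w - x = t *: w by rewrite addrAC subrr add0r.
  move=> /(_ isT) /(_ isT); rewrite dotZr normrZ gtr0_norm//.
  move=> /ler_normlP[+ _]; rewrite exprMn.
  by move: (h _) (h _) (dot _ _) (`|w|) => a b c e; nra.
have Kw0 : 0 <= C * `|w| ^+ 2 by rewrite mulr_ge0// sqr_ge0.
case: H => H.
  pose K := `|dot (grad h x) w| + C * `|w| ^+ 2.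
  have K0 : 0 <= K by rewrite addr_ge0.
  have K1 : 0 < K + 1 by rewrite ltr_wpDl.
  exists (Num.min 1 (h x / (K + 1))); first by rewrite lt_min ltr01 divr_gt0.
  move=> t t0; rewrite le_min => /andP[t1]; rewrite ler_pdivlMr// => tK.
  apply: le_trans (key t t0 t1).
  have : - `|dot (grad h x) w| <= dot (grad h x) w by rewrite lerNl -normrN ler_norm.
  have : t * (C * t * `|w| ^+ 2) <= t * (C * `|w| ^+ 2).
    by rewrite ler_pM2l// -mulrA mulrCA ler_piMl.
  move: tK; rewrite /K; move: (dot _ _) => c.
  move: (C * `|w| ^+ 2) Kw0 => k k0; move: (C * t * _) => k' tK h1 h2.
  have : t * (- `|c|) <= t * c by rewrite ler_pM2l.
  lra.
pose K := C * `|w| ^+ 2.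
have K1 : 0 < K + 1 by rewrite ltr_wpDl.
exists (Num.min 1 (dot (grad h x) w / (K + 1))); first by rewrite lt_min ltr01 divr_gt0.
move=> t t0; rewrite le_min => /andP[t1]; rewrite ler_pdivlMr// => tK.
apply: le_trans (key t t0 t1); rewrite addr_ge0// mulr_ge0 ?(ltW t0)//.
move: tK; rewrite /K mulrDr mulrA (mulrC t C); lra.
Qed.

End TangentCone.

(** * The barrier field and limits of its trajectories *)

Section Continuity.
Variables (R : realType) (T : topologicalType).

Lemma continuous_pair (U V : topologicalType) (f : T -> U) (g : T -> V) :
  continuous f -> continuous g -> continuous (fun x => (f x, g x)).
Proof. by move=> cf cg x; exact: (cvg_pair (cf x) (cg x)). Qed.

Lemma continuous_snd (U V : topologicalType) (W : topologicalType) (f : V -> W) :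
  continuous f -> continuous (fun p : U * V => f p.2).
Proof. by move=> cf p; apply: (cvg_comp _ f (@cvg_snd _ _ _ _ _) (cf p.2)). Qed.

Lemma continuous_fst (U V : topologicalType) (W : topologicalType) (f : U -> W) :
  continuous f -> continuous (fun p : U * V => f p.1).
Proof. by move=> cf p; apply: (cvg_comp _ f (@cvg_fst _ _ _ _ _) (cf p.1)). Qed.

Lemma continuous_maxr (f g : T -> R) :
  continuous f -> continuous g -> continuous (fun x => Num.max (f x) (g x)).
Proof. by move=> cf cg x; exact: (continuous_max (cf x) (cg x)). Qed.

Lemma continuous_minr (f g : T -> R) :
  continuous f -> continuous g -> continuous (fun x => Num.min (f x) (g x)).
Proof. by move=> cf cg x; exact: (continuous_min (cf x) (cg x)). Qed.

Lemma continuous_dot n (u v : T -> 'cV[R]_n) :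
  continuous u -> continuous v -> continuous (fun x => dot (u x) (v x)).
Proof. by move=> cu cv x; exact: (cvg_dot (cu x) (cv x)). Qed.

Lemma continuous_mulmx n (A : 'M[R]_n) (u : T -> 'cV[R]_n) :
  continuous u -> continuous (fun x => A *m u x).
Proof. by move=> cu x; exact: (cvg_mulmx (A := A) (cu x)). Qed.

Lemma continuous_scale (V : normedModType R) (k : T -> R) (u : T -> V) :
  continuous k -> continuous u -> continuous (fun x => k x *: u x).
Proof. by move=> ck cu x; exact: (cvgZ (ck x) (cu x)). Qed.

Lemma continuous_add (V : normedModType R) (u v : T -> V) :
  continuous u -> continuous v -> continuous (fun x => u x + v x).
Proof. by move=> cu cv x; exact: (cvgD (cu x) (cv x)). Qed.

Lemma continuous_norm (V : normedModType R) (u : T -> V) :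
  continuous u -> continuous (fun x => `|u x|).
Proof. by move=> cu x; apply: cvg_norm; exact: cu. Qed.

Lemma continuous_opp (u : T -> R) : continuous u -> continuous (fun x => - u x).
Proof. by move=> cu x; apply: cvgN; exact: cu. Qed.

Lemma continuous_inv (k : T -> R) : continuous k -> (forall x, 0 < k x) ->
  continuous (fun x => (k x)^-1).
Proof. by move=> ck k0 x; apply: cvgV; [rewrite gt_eqF|exact: ck]. Qed.

End Continuity.

Section Retraction.
Variables (R : realType) (V : normedModType R) (B : R).
Hypothesis B0 : 0 < B.

Definition retract_ball (v : V) : V := (B / Num.max B `|v|) *: v.

Let max_gt0 (v : V) : 0 < Num.max B `|v|.
Proof. by rewrite lt_max B0. Qed.

Lemma retract_ball_id v : `|v| <= B -> retract_ball v = v.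
Proof. by move=> vB; rewrite /retract_ball max_l// divff ?gt_eqF// scale1r. Qed.

Lemma retract_ball_norm v : `|retract_ball v| <= B.
Proof.
rewrite /retract_ball normrZ gtr0_norm ?divr_gt0// mulrAC ler_pdivrMr//.
by rewrite ler_pM2l// le_max lexx orbT.
Qed.

Lemma retract_ball_continuous : continuous retract_ball.
Proof.
move=> v; apply: cvgZ; last exact: cvg_id.
apply: cvgM; first exact: cvg_cst.
have cm : continuous (fun v : V => Num.max B `|v|).
  by apply: continuous_maxr => [w|]; [exact: cvg_cst|exact: norm_continuous].
exact: (continuous_inv cm max_gt0).
Qed.

End Retraction.

Section BarrierField.
Variables (R : realType) (m n : nat) (h : 'cV[R]_n -> R) (P : 'M[R]_n)
  (f : 'cV[R]_m * 'cV[R]_n -> 'cV[R]_n) (g : 'cV[R]_m * 'cV[R]_n -> 'cV[R]_m)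
  (B c M : R).
Local Notation V := ('cV[R]_m * 'cV[R]_n)%type.
Implicit Types (p : V) (x : 'cV[R]_n) (alpha : R).

Definition grad_form x : R := dot (grad h x) (invmx P *m grad h x).

(** The maximum with [c] keeps the quotient continuous at zeros of the gradient. Where
    [c <= grad_form x], the derivative of [h] along this vector is exactly 1. *)
Definition inward_normal x : 'cV[R]_n :=
  (Num.max c (grad_form x))^-1 *: (invmx P *m grad h x).

Definition multiplier alpha p : R :=
  Num.min M (Num.max 0 (- (lieD h f p + alpha * h p.2))).

Definition truncate p : V := (retract_ball B p.1, retract_ball B p.2).

(* A bounded continuous extension of the CBF field to the whole space.  The
   clamping of the multiplier makes the bound independent of alpha. *)
Definition barrier_field alpha p : V :=
  let p' := truncate p in
  (g p', f p' + multiplier alpha p' *: inward_normal p'.2).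

Hypotheses (h_C1 : C1 h) (P_posdef : sym_posdef P) (f_cont : continuous f)
  (g_cont : continuous g) (B0 : 0 < B) (c0 : 0 < c) (M0 : 0 <= M).

Lemma truncate_id p : `|p.1| <= B -> `|p.2| <= B -> truncate p = p.
Proof. by case: p => z x /= zB xB; rewrite /truncate !retract_ball_id. Qed.

Lemma truncate_norm p : `|(truncate p).1| <= B /\ `|(truncate p).2| <= B.
Proof. by split; exact: retract_ball_norm. Qed.

Lemma truncate_continuous : continuous truncate.
Proof.
by apply: continuous_pair; [apply: continuous_fst|apply: continuous_snd];
  exact: retract_ball_continuous.
Qed.

Lemma lieD_continuous : continuous (lieD h f).
Proof. by apply: continuous_dot => //; apply: continuous_snd; exact: h_C1.2. Qed.

Lemma grad_form_continuous : continuous grad_form.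
Proof. by apply: continuous_dot; [|apply: continuous_mulmx]; exact: h_C1.2. Qed.

Lemma inward_normal_continuous : continuous inward_normal.
Proof.
apply: continuous_scale; last by apply: continuous_mulmx; exact: h_C1.2.
apply: continuous_inv; last by move=> x; rewrite lt_max c0.
by apply: continuous_maxr; [exact: cst_continuous|exact: grad_form_continuous].
Qed.

Lemma multiplier_ge0 alpha p : 0 <= multiplier alpha p.
Proof. by rewrite le_min M0 le_max lexx. Qed.

Lemma multiplier_le alpha p : multiplier alpha p <= M.
Proof. by rewrite ge_min lexx. Qed.

Lemma multiplier_continuous alpha : continuous (multiplier alpha).
Proof.
apply: continuous_minr; first by move=> p; exact: cvg_cst.
apply: continuous_maxr; first by move=> p; exact: cvg_cst.
move=> p; apply: cvgN; apply: cvgD; first exact: lieD_continuous.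
apply: cvgM; first exact: cvg_cst.
by apply: continuous_snd; exact: C1_continuous.
Qed.

Lemma barrier_field_continuous alpha : continuous (barrier_field alpha).
Proof.
have H : continuous (fun p => (g p, f p + multiplier alpha p *: inward_normal p.2)).
  apply: continuous_pair => //; apply: continuous_add => //.
  apply: continuous_scale; first exact: multiplier_continuous.
  by apply: continuous_snd; exact: inward_normal_continuous.
move=> p; apply: (@continuous_comp _ _ _ truncate
  (fun p => (g p, f p + multiplier alpha p *: inward_normal p.2)) p).
  exact: truncate_continuous.
exact: H.
Qed.

Lemma barrier_field_bounded : exists2 C, 0 < C &
  forall alpha p, `|barrier_field alpha p| <= C.
Proof.
have cK := @compact_cball_pair R m n B B.
have [Cg Cg0 gC] := continuous_compact_bounded cK g_cont.
have [Cf Cf0 fC] := continuous_compact_bounded cK f_cont.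
have [Cn Cn0 nC] := continuous_compact_bounded (@compact_cball R n B)
  inward_normal_continuous.
exists (Cg + (Cf + M * Cn)); first by rewrite addr_gt0// ltr_pwDl// mulr_ge0// ltW.
move=> alpha p; have [t1 t2] := truncate_norm p.
have h1 := gC (truncate p) (conj t1 t2).
have h2 := fC (truncate p) (conj t1 t2).
have h3 := nC (truncate p).2 t2.
apply: norm_pair_le => /=.
  by rewrite (le_trans h1)// lerDl addr_ge0 ?mulr_ge0// ltW.
rewrite (le_trans (ler_normD _ _))// (le_trans _ (_ : Cf + M * Cn <= _))//; last first.
  by rewrite lerDr ltW.
rewrite lerD// normrZ ger0_norm ?multiplier_ge0// ler_pM ?multiplier_ge0//.
exact: multiplier_le.
Qed.

Hypothesis form_lo : forall x, `|x| <= B -> `|h x| <= c -> c <= grad_form x.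
Hypothesis lieD_le : forall p, `|p.1| <= B -> `|p.2| <= B -> `|lieD h f p| + 1 <= M.

(** On S the term [alpha * h] is nonnegative, so the projection multiplier is at most [|lieD h f p|]
    and the clamp at [M] is inactive. A positive multiplier forces [alpha * h < M], hence [h <= c],
    where the normalisation by [grad_form] is the exact one. *)
Lemma barrier_field_cbf alpha p : 0 < alpha -> M / c <= alpha ->
  `|p.1| <= B -> `|p.2| <= B -> 0 <= h p.2 ->
  barrier_field alpha p = (g p, f_cbf h P f alpha p).
Proof.
move=> alpha0 alphaM p1 p2 hp; rewrite /barrier_field truncate_id//; congr pair.
have L := lieD_le p1 p2; have L' := ler_norm (- lieD h f p); rewrite normrN in L'.
have ah0 : 0 <= alpha * h p.2 by rewrite mulr_ge0// ltW.
have E : multiplier alpha p = Num.max 0 (- (lieD h f p + alpha * h p.2)).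
  rewrite /multiplier min_r// ge_max M0/=; lra.
have q_or : 0 < grad_form p.2 \/ 0 <= lieD h f p + alpha * h p.2.
  have [H|H] := leP 0 (lieD h f p + alpha * h p.2); [by right|left].
  apply: lt_le_trans c0 _; apply: form_lo => //; rewrite ger0_norm//.
  have : alpha * h p.2 <= alpha * c.
    rewrite ler_pdivrMr// in alphaM; lra.
  by rewrite ler_pM2l.
have := @halfspace_argmin R n P P_posdef (grad h p.2) (alpha * h p.2) (f p) q_or.
rewrite -/(lieD h f p) -/(grad_form p.2) => Eargmin.
have -> : f_cbf h P f alpha p = f p +
  (Num.max 0 (- (lieD h f p + alpha * h p.2)) / grad_form p.2) *: (invmx P *m grad h p.2).
  rewrite /f_cbf Eargmin.
  have := @getPex _ [set f p + (Num.max 0 (- (lieD h f p + alpha * h p.2)) / grad_form p.2) *: (invmx P *m grad h p.2)].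
  by apply; eexists.
rewrite E /inward_normal scalerA; congr (_ + _ *: _).
have [H|H] := leP 0 (lieD h f p + alpha * h p.2).
  by rewrite max_l ?oppr_le0// !mul0r.
rewrite [Num.max c _]max_r//; apply: form_lo => //; rewrite ger0_norm//.
have : alpha * h p.2 <= alpha * c by rewrite ler_pdivrMr// in alphaM; lra.
by rewrite ler_pM2l.
Qed.

(** The derivative of [h] is [lieD] plus the multiplier. A multiplier [M] gives at least 1, an
    unclamped one gives exactly [- (alpha * h)], and 0 occurs only if [lieD] alone is at least
    that. *)
Lemma barrier_field_inward alpha p : `|p.2| <= B -> `|h p.2| <= c -> h p.2 <= 0 ->
  Num.min 1 (- (alpha * h p.2)) <= dot (grad h p.2) (barrier_field alpha p).2.
Proof.
move=> p2 hc h0; have [t1 t2] := truncate_norm p.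
have E : (truncate p).2 = p.2 by rewrite /= retract_ball_id.
have L := lieD_le t1 t2; have L' := ler_norm (- lieD h f (truncate p)).
rewrite normrN in L'.
have qc := form_lo p2 hc.
have q0 : 0 < grad_form p.2 by exact: lt_le_trans qc.
rewrite /barrier_field [(_, _).2]/= -[retract_ball B p.2]/((truncate p).2).
rewrite {1}[(truncate p).2]E dotDr dotZr /inward_normal dotZr -/(grad_form p.2).
rewrite max_r// mulVf ?gt_eqF// mulr1.
rewrite -[X in dot (grad h X) (f _)]E -/(lieD h f (truncate p)) /multiplier E.
move: (lieD h f _) L L' => l L L'; move: (alpha * _) => t.
have [h2|h2] := leP (- (l + t)) 0.
  by rewrite [Num.min M 0]min_r// ge_min; apply/orP; right; lra.
rewrite ge_min; have [h3|h3] := leP M (- (l + t)).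
  by apply/orP; left; lra.
by apply/orP; right; lra.
Qed.

End BarrierField.

(** * Derivatives of limits of approximate solutions *)

Section Limits.
Variable R : realType.

Lemma ae_neq (c : R) : {ae @lebesgue_measure R, forall t, t != c}.
Proof.
exists [set c]; split; first exact: measurable_set1.
  exact: lebesgue_measure_set1.
by move=> t /= /negP; rewrite negbK => /eqP.
Qed.

Lemma continuous_dist_le (V W : normedModType R) (F : V -> W) p e :
  continuous F -> 0 < e ->
  exists2 d, 0 < d & forall q, `|q - p| < d -> `|F q - F p| <= e.
Proof.
move=> cF e0; have /cvgrPdist_le/(_ e e0) := cF p.
move=> /nbhs_normP[d /= d0 hd]; exists d => // q qp.
by rewrite distrC; apply: hd; rewrite /= distrC.
Qed.

(** Increments over a short interval [[t, t + r]] are compared. Convergence is used at its two ends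
    only; the common Lipschitz constant keeps every [y k] near [z t] in between. *)
Lemma limit_form_ge (V : normedModType R) (I : Type) (F : set_system I)
  {PF : ProperFilter F} (a b M : R) (y : I -> R -> V) (z : R -> V)
  (G : I -> V -> V) (eps : I -> R) (l : V -> R) (c t : R) :
  a < t -> t < b -> bounded_form l ->
  (\forall k \near F, lipschitz_curve a b M (y k)) ->
  (\forall k \near F, {ae @lebesgue_measure R, forall s, s \in `[a, b] ->
     derivable (y k) s 1 /\ `|derive1 (y k) s - G k (y k s)| <= eps k}) ->
  (forall e, 0 < e -> \forall k \near F, eps k <= e) ->
  (forall s e, s \in `[a, b] -> 0 < e -> \forall k \near F, `|y k s - z s| <= e) ->
  (forall e, 0 < e -> exists2 w, 0 < w &
     \forall k \near F, forall p, `|p - z t| < w -> c - e <= l (G k p)) ->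
  derivable z t 1 -> c <= l (derive1 z t).
Proof.
move=> at' tb [lD lZ [C C0 lC]] ylip yG eps0 yz lG dz.
have lform : bounded_form l by split=> //; exists C.
have lB u v : l (u - v) = l u - l v by rewrite lD -scaleN1r lZ mulN1r.
apply/ler_addgt0Pl => e' e'0.
(* The losses per unit of time are [2 * e] from the field and the approximation, and [C * e] from
   each end and from the difference quotient of [z]. *)
pose e := e' / (2 + 4 * C + 1).
have C1 : 0 < 2 + 4 * C + 1 by lra.
have e0 : 0 < e by rewrite divr_gt0.
have [w w0 hw] := lG e e0.
have [d d0 hd] := derivable_local dz e0.
have M1 : 0 < `|M| + 1 by rewrite ltr_wpDl.
pose r := Num.min (Num.min (d / 2) (b - t)) (w / 4 / (`|M| + 1)).
have r0 : 0 < r by rewrite !lt_min !divr_gt0//= subr_gt0 tb.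
have rd : r < d.
  apply: (@le_lt_trans _ _ (d / 2)); first by rewrite !ge_min lexx.
  by rewrite ltr_pdivrMr// ltr_pMr// ltr1n.
have rb : t + r <= b by rewrite -lerBrDl !ge_min lexx orbT.
have rw : `|M| * r <= w / 4.
  apply: (@le_trans _ _ ((`|M| + 1) * r)); first by rewrite ler_wpM2r ?lerDl ?ltW.
  by rewrite mulrC -ler_pdivlMr// ge_min lexx orbT.
have tI : t \in `[a, b] by rewrite in_itv/= !ltW.
have trI : t + r \in `[a, b].
  by rewrite in_itv/= rb andbT (le_trans (ltW at'))// lerDl ltW.
have er : 0 < e * r by rewrite mulr_gt0.
have w4 : 0 < w / 4 by rewrite divr_gt0.
have Ce : 0 < e / (C + 1) by rewrite divr_gt0// ltr_wpDl.
near F => k.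
have klip : lipschitz_curve a b M (y k) by near: k.
have kG : {ae @lebesgue_measure R, forall s, s \in `[a, b] ->
  derivable (y k) s 1 /\ `|derive1 (y k) s - G k (y k s)| <= eps k} by near: k.
have keps : eps k <= e / (C + 1) by near: k; exact: eps0.
have kt : `|y k t - z t| <= e * r by near: k; exact: yz.
have ktr : `|y k (t + r) - z (t + r)| <= e * r by near: k; exact: yz.
have ktw : `|y k t - z t| <= w / 4 by near: k; exact: yz.
have kw : forall p, `|p - z t| < w -> c - e <= l (G k p) by near: k.
have tr : t <= t + r by rewrite lerDl ltW.
have grow : (c - 2 * e) * (t + r - t) <= l (y k (t + r)) - l (y k t).
  apply: (lipschitz_form_growth tr (lipschitz_curveS (ltW at') rb klip) lform).
  apply: lebesgue_aeS kG => s H str.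
  have /andP[ts sr] : (t <= s) && (s <= t + r) by move: str; rewrite in_itv.
  have sI : s \in `[a, b] by rewrite in_itv/= (le_trans (ltW at') ts) (le_trans sr).
  have {H} [dy yG'] := H sI; split=> //.
  have close : `|y k s - z t| < w.
    rewrite -(subrKA (y k t)) (le_lt_trans (ler_normD _ _))//.
    have := klip t s (ltW at') ts (le_trans sr rb).
    have : M * (s - t) <= `|M| * r.
      apply: (@le_trans _ _ (`|M| * (s - t))).
        by rewrite ler_wpM2r ?subr_ge0// ler_norm.
      by rewrite ler_wpM2l// lerBlDl.
    lra.
  have := kw _ close; have := lC (derive1 (y k) s - G k (y k s)).
  rewrite lB => /ler_normlP[h1 _].
  have : C * `|derive1 (y k) s - G k (y k s)| <= e.
    apply: (@le_trans _ _ ((C + 1) * (e / (C + 1)))).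
      by rewrite ler_pM// ?lerDl// (le_trans yG').
    by rewrite mulrC divfK// gt_eqF// ltr_wpDl.
  lra.
have h1 := lC (y k (t + r) - z (t + r)); have h2 := lC (y k t - z t).
rewrite lB in h1; rewrite lB in h2.
have {}h1 : l (y k (t + r)) - l (z (t + r)) <= C * (e * r).
  by rewrite (le_trans (ler_norm _))// (le_trans h1)// ler_wpM2l.
have {}h2 : l (z t) - l (y k t) <= C * (e * r).
  by rewrite -opprB (le_trans (ler_norm _))// normrN (le_trans h2)// ler_wpM2l.
have := hd (t + r); rewrite (addrC t) addrK gtr0_norm// => /(_ rd) h3.
have := lC (z (r + t) - z t - r *: derive1 z t); rewrite !lB lZ => h4.
have {}h4 : l (z (r + t)) - l (z t) - r * l (derive1 z t) <= C * (e * r).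
  by rewrite (le_trans (ler_norm _))// (le_trans h4)// ler_wpM2l.
rewrite (addrC t) addrK in grow; rewrite (addrC t) in h1.
rewrite -(ler_pM2r r0) mulrDl.
have -> : e' = e * (2 + 4 * C + 1) by rewrite /e divfK// gt_eqF.
have : 0 < e * r by []. 
have : 0 <= C * (e * r) by rewrite mulr_ge0// ltW.
lra.
Unshelve. all: by end_near. Qed.

End Limits.

Lemma lerN_near (R : realType) (x y e : R) : - (x - y) <= e -> 0 <= y -> - e <= x.
Proof. by move=> h1 h2; lra. Qed.

Lemma lerB_near (R : realType) (x y z e : R) :
  - (x - y) <= e / 2 -> - (e / 2) <= z -> y - e <= x + z.
Proof. by move=> h1 h2; lra. Qed.

Section BarrierLimit.
Variables (R : realType) (m n : nat) (h : 'cV[R]_n -> R) (P : 'M[R]_n)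
  (f : 'cV[R]_m * 'cV[R]_n -> 'cV[R]_n) (g : 'cV[R]_m * 'cV[R]_n -> 'cV[R]_m)
  (B c M : R).
Local Notation V := ('cV[R]_m * 'cV[R]_n)%type.
Local Notation field := (barrier_field h P f g B c M).

(** The scalar [s] may be -1: at an interior time the curve lies in [S] on both sides of [t], so the
    opposite of the velocity is tangent too. *)
Lemma tangent_cone_derive (S : set 'cV[R]_n) (xi : R -> 'cV[R]_n) a b t s :
  a < t -> t < b -> (forall s, s \in `[a, b] -> S (xi s)) -> derivable xi t 1 ->
  `|s| = 1 -> tangent_cone S (xi t) (s *: derive1 xi t).
Proof.
move=> at' tb Sxi dxi s1; pose d := Num.min (t - a) (b - t).
have d0 : 0 < d by rewrite lt_min !subr_gt0 at'.
pose t_ i := d / i.+1%:R.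
have t0 i : 0 < t_ i by rewrite divr_gt0.
have td i : t_ i <= d by rewrite ler_pdivrMr// ler_peMr ?(ltW d0)// ler1n.
have cvg0 : t_ @ \oo --> (0 : R).
  rewrite -[X in _ --> X](mulr0 d); apply: cvgM; first exact: cvg_cst.
  exact: (@cvg_harmonic R).
have stE i : `|t + s * t_ i - t| = t_ i.
  by rewrite addrAC subrr add0r normrM s1 mul1r gtr0_norm.
have near_lo e : 0 < e -> \forall i \near \oo,
   `|xi (t + s * t_ i) - xi t - (s * t_ i) *: derive1 xi t| <= e * t_ i.
  move=> e0; have [r r0 hr] := derivable_local dxi e0; near=> i.
  have := hr (t + s * t_ i); rewrite stE (addrC t) addrK; apply.
  rewrite -[t_ i]gtr0_norm// -[t_ i]subr0 distrC; near: i.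
  by move/cvgrPdist_lt : cvg0; apply.
exists (fun i => xi (t + s * t_ i)), t_; split => //.
- move=> i; apply: Sxi; rewrite in_itv/=.
  have := stE i; have := td i; rewrite /d le_min => /andP[h1 h2] h3.
  have := ler_norm (t + s * t_ i - t); have := ler_norm (- (t + s * t_ i - t)).
  rewrite normrN h3 => h4 h5; apply/andP; split; lra.
- apply/cvgrPdist_le => e e0.
  pose D := `|derive1 xi t| + 1.
  have D0 : 0 < D by rewrite ltr_wpDl.
  near=> i; rewrite distrC -[X in `|X|](subrK ((s * t_ i) *: derive1 xi t)).
  rewrite (le_trans (ler_normD _ _))//.
  apply: (@le_trans _ _ (t_ i * D)).
    rewrite /D mulrDr mulr1 [leRHS]addrC lerD//.
      by rewrite -[leRHS]mul1r; near: i; exact: near_lo.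
    by rewrite normrZ normrM s1 mul1r gtr0_norm.
  rewrite -ler_pdivlMr// -[t_ i]gtr0_norm// -[t_ i]subr0 distrC; near: i.
  by move/cvgrPdist_le : cvg0; apply; rewrite divr_gt0.
apply/cvgrPdist_le => e e0; near=> i.
have ti0 : t_ i != 0 by rewrite gt_eqF.
have -> : s *: derive1 xi t - (t_ i)^-1 *: (xi (t + s * t_ i) - xi t) =
    - (t_ i)^-1 *: (xi (t + s * t_ i) - xi t - (s * t_ i) *: derive1 xi t).
  rewrite scaleNr; move: (xi (t + s * t_ i) - xi t) => X.
  by rewrite scalerBr scalerA mulrCA mulVf// mulr1 opprB.
rewrite normrZ normrN gtr0_norm ?invr_gt0// ler_pdivrMl// [leRHS]mulrC.
by near: i; exact: near_lo.
Unshelve. all: by end_near. Qed.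

Hypotheses (h_C1 : C1 h) (h_lip : locally_lipschitz (grad h))
  (P_posdef : sym_posdef P) (f_cont : continuous f)
  (g_cont : continuous g) (B0 : 0 < B) (c0 : 0 < c) (M0 : 0 <= M).
Hypothesis lieD_le : forall p : V, `|p.1| <= B -> `|p.2| <= B -> `|lieD h f p| + 1 <= M.

Lemma multiplier_eq0 alpha p : 0 <= lieD h f p + alpha * h p.2 ->
  multiplier h f M alpha p = 0.
Proof. by move=> H; rewrite /multiplier max_l ?oppr_le0// min_r. Qed.

Lemma barrier_limit_pds (I : Type) (F : set_system I) {PF : ProperFilter F}
  (a b K : R) (y : I -> R -> V) (z : R -> V) (al eps : I -> R) (t : R) :
  a < t -> t < b ->
  (\forall k \near F, lipschitz_curve a b K (y k)) ->
  (\forall k \near F, {ae @lebesgue_measure R, forall s, s \in `[a, b] ->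
     derivable (y k) s 1 /\ `|derive1 (y k) s - field (al k) (y k s)| <= eps k}) ->
  (forall e, 0 < e -> \forall k \near F, eps k <= e) ->
  (forall A, \forall k \near F, A <= al k) ->
  (forall s e, s \in `[a, b] -> 0 < e -> \forall k \near F, `|y k s - z s| <= e) ->
  (forall s, s \in `[a, b] -> 0 <= h (z s).2) ->
  `|(z t).1| < B -> `|(z t).2| < B -> derivable z t 1 ->
  pds h P f g (z t) (derive1 z t).
Proof.
move=> at' tb ylip yG eps0 al0 yz hz z1 z2 dz.
have tI : t \in `[a, b] by rewrite in_itv/= !ltW.
pose p0 := z t; pose v := derive1 z t; rewrite -/p0 -/v.
have Tp0 : truncate B p0 = p0 by rewrite truncate_id ?ltW.
have cT := @truncate_continuous R m n B B0.
have ce : forall e, 0 < e -> forall W : normedModType R, forall Phi : V -> W, continuous Phi ->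
   exists2 d, 0 < d & forall q, `|q - p0| < d -> `|Phi (truncate B q) - Phi p0| <= e.
  move=> e e0 W Phi cPhi.
  have cPT : continuous (Phi \o truncate B).
    by move=> q; apply: continuous_comp; [exact: cT|exact: cPhi].
  have [d d0 hd] := continuous_dist_le p0 cPT e0.
  by exists d => // q /hd; rewrite /= Tp0.
have h0 : 0 <= h p0.2 by exact: hz.
(* Where [h] is positive, the multiplier vanishes near [p0] once alpha is large. Otherwise it is
   merely between 0 and [M], which suffices because its contribution along [u] is almost
   nonnegative. *)
have test u : 0 < h p0.2 \/ 0 <= dot u (inward_normal h P c p0.2) ->
    dot u (f p0) <= dot u v.2.
  move=> H; apply: (limit_form_ge (G := fun k => field (al k)) at' tb (bounded_form_dot_snd m u) ylip yG eps0 yz _ dz).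
  move=> e e0; have e2 : 0 < e / 2 by rewrite divr_gt0.
  have cu : continuous (fun p : V => dot u (f p)).
    by apply: continuous_dot => //; exact: cst_continuous.
  have [w1 w10 hw1] := ce _ e2 _ _ cu.
  case: H => [hpos|un].
    have ch : continuous (fun p : V => h p.2) by apply: continuous_snd; exact: C1_continuous.
    have h2 : 0 < h p0.2 / 2 by rewrite divr_gt0.
    have [w2 w20 hw2] := ce _ h2 _ _ ch.
    exists (Num.min w1 w2); first by rewrite lt_min w10.
    have := al0 (Num.max 0 (2 * M / h p0.2)); apply: filterS => k.
    rewrite ge_max => /andP[ak0 ak] p.
    rewrite lt_min => /andP[/hw1/ler_normlP[q1 q1'] /hw2/ler_normlP[q2 q2']].
    rewrite /barrier_field/= multiplier_eq0 ?scale0r ?addr0; first by lra.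
    have [t1 t2] := truncate_norm B0 p.
    have L := lieD_le t1 t2; have := ler_norm (- lieD h f (truncate B p)).
    rewrite normrN => L'.
    have : M <= al k * h (truncate B p).2.
      apply: (@le_trans _ _ (al k * (h p0.2 / 2))).
        by rewrite ler_pdivrMr// in ak; lra.
      by rewrite ler_wpM2l//; lra.
    lra.
  have cn : continuous (fun p : V => dot u (inward_normal h P c p.2)).
    apply: continuous_dot; first exact: cst_continuous.
    by apply: continuous_snd; exact: inward_normal_continuous.
  have M1 : 0 < M + 1 by rewrite ltr_wpDl.
  have e3 : 0 < e / 2 / (M + 1) by rewrite divr_gt0.
  have [w2 w20 hw2] := ce _ e3 _ _ cn.
  exists (Num.min w1 w2); first by rewrite lt_min w10.
  apply: nearW => k p; rewrite lt_min => /andP[/hw1/ler_normlP[q1 q1'] /hw2/ler_normlP[q2 q2']].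
  rewrite /barrier_field; set p' := truncate B p; rewrite [(_, _).2]/= dotDr dotZr.
  set lam := multiplier _ _ _ _ _.
  have lam0 : 0 <= lam by exact: multiplier_ge0.
  have lamM : lam <= M by exact: multiplier_le.
  have : - (e / 2) <= lam * dot u (inward_normal h P c p'.2).
    apply: (@le_trans _ _ (lam * - (e / 2 / (M + 1)))).
      rewrite mulrN lerN2 mulrCA ler_piMr ?(ltW e2)// ler_pdivrMr// mul1r.
      by rewrite (le_trans lamM)// lerDl.
    apply: (ler_wpM2l lam0); exact: (lerN_near q2 un).
  exact: lerB_near q1.
have v1 : v.1 = g p0.
  have coord s i : `|s| = 1 -> s * g p0 i 0 <= s * v.1 i 0.
    move=> s1; have bs : bounded_form (fun p : V => s * p.1 i 0).
      have [D Z [C C0 lC]] := @bounded_form_fst R m n i.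
      split; [by move=> p q; rewrite D mulrDr|by move=> k p; rewrite Z mulrCA|].
      by exists C => // p; rewrite normrM s1 mul1r.
    apply: (limit_form_ge (G := fun k => field (al k)) at' tb bs ylip yG eps0 yz _ dz).
    move=> e e0; have [w w0 hw] := ce _ e0 _ _ g_cont.
    exists w => //; apply: nearW => k p /hw H.
    have := le_trans (entry_le_norm (g (truncate B p) - g p0) i) H.
    rewrite !mxE /= => H'.
    have : `|s * (g (truncate B p) i 0 - g p0 i 0)| <= e by rewrite normrM s1 mul1r.
    by move=> /ler_normlP[]; lra.
  (* The one-sided bound, used for a coordinate and for its opposite, gives equality. *)
  apply/matrixP => i j; rewrite (ord1 j); apply/eqP; rewrite eq_le.
  have := coord 1 i (normr1 _); have := coord (-1) i.
  by rewrite normrN normr1 !mul1r !mulN1r lerN2 => /(_ erefl) -> ->.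
have dz2 : derivable (fun s => (z s).2) t 1 by move/derivable_pair : dz => [].
have v2 : v.2 = derive1 (fun s => (z s).2) t by rewrite /v derive1_pair.
have Tv s : `|s| = 1 -> tangent_cone (superlevel h) p0.2 (s *: v.2).
  by rewrite v2; apply: (tangent_cone_derive at' tb _ dz2).
have Tv1 : tangent_cone (superlevel h) p0.2 v.2.
  by rewrite -[v.2]scale1r; apply: Tv; rewrite normr1.
split => //; apply: (argmin_of_variational P_posdef) => // mu Tmu.
rewrite dotBr subr_ge0; apply: test.
have [hpos|h0'] := ltP 0 (h p0.2); [by left|right].
have hp0 : h p0.2 = 0 by apply/eqP; rewrite eq_le h0' h0.
(* The sign is that of [dot (grad h p0.2) (mu - v.2)], nonnegative because both [mu] and [- v.2] are
   tangent at a boundary point. *)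
rewrite /inward_normal dotZr dot_P_invP// mulr_ge0//.
  by rewrite invr_ge0 le_max (ltW c0).
have := tangent_cone_boundary h_C1 h_lip hp0 (Tv (-1) _).
rewrite normrN normr1 => /(_ erefl).
have := tangent_cone_boundary h_C1 h_lip hp0 Tmu.
rewrite scaleN1r dotNr dotBr; lra.
Unshelve. all: by end_near. Qed.

End BarrierLimit.

(** * Approximate invariance of the superlevel set *)

Section Invariance.
Variable R : realType.

Lemma compact_pos_lower (T : topologicalType) (K : set T) (F : T -> R) :
  compact K -> continuous F -> (forall x, K x -> 0 < F x) ->
  exists2 e, 0 < e & forall x, K x -> e <= F x.
Proof.
move=> cK cF F0; have [K0|K0] := pselect (K !=set0); last first.
  by exists 1 => // x Kx; exfalso; apply: K0; exists x.
have [x xK xmin] := compact_EVT_min K0 cK (continuous_subspaceT cF).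
exists (F x); first by apply: F0; move: xK; rewrite inE.
by move=> y Ky; apply: xmin; rewrite inE.
Qed.

Lemma last_crossing (F : R -> R) (x s c : R) : x <= s -> c <= F x -> F s < c ->
  (forall t e, x <= t -> t <= s -> 0 < e ->
     exists2 d, 0 < d & forall u, x <= u -> u <= s -> `|u - t| < d -> `|F u - F t| < e) ->
  exists t, [/\ x <= t, t < s, F t = c & forall u, t < u -> u <= s -> F u < c].
Proof.
move=> xs cFx Fsc ctsF.
pose A := [set t | [/\ x <= t, t <= s & c <= F t]].
have Ax : A x by [].
have supA : has_sup A by split; [exists x|exists s => t []].
have xt : x <= sup A by apply: ub_le_sup => //; case: supA.
have ts : sup A <= s by apply: ge_sup; [exists x|move=> t []].
have Ft : c <= F (sup A).
  rewrite leNgt; apply/negP => Ftc.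
  have [d d0 hd] := ctsF _ (c - F (sup A)) xt ts (eq_ind_r is_true Ftc (subr_gt0 _ _)).
  have [t [xt' ts' cFt] tA] := sup_adherent d0 supA.
  have tA' : t <= sup A by apply: ub_le_sup; [case: supA|].
  have := hd t xt' ts'; rewrite distrC ger0_norm ?subr_ge0// => /(_ ltac:(lra)) /ltr_normlP[].
  lra.
have tls : sup A < s.
  rewrite lt_neqAle ts andbT; apply/eqP => E; move: Ft; rewrite E leNgt Fsc//.
have after u : sup A < u -> u <= s -> F u < c.
  move=> tu us; rewrite ltNge; apply/negP => cFu.
  have : u <= sup A.
    by apply: ub_le_sup; [case: supA|split => //; rewrite (le_trans xt) ?ltW].
  by rewrite leNgt tu.
exists (sup A); split => //; apply/eqP; rewrite eq_le Ft andbT leNgt; apply/negP => Ftc.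
have [d d0 hd] := ctsF _ (F (sup A) - c) xt ts (eq_ind_r is_true Ftc (subr_gt0 _ _)).
pose u := Num.min s (sup A + d / 2).
have d2 : 0 < d / 2 by rewrite divr_gt0.
have us : u <= s by rewrite ge_min lexx.
have tu : sup A < u by rewrite lt_min tls ltrDl.
have := after u tu us; have := hd u (le_trans xt (ltW tu)) us.
have ud : u <= sup A + d / 2 by rewrite ge_min lexx orbT.
rewrite ger0_norm ?subr_ge0 ?(ltW tu)// => /(_ ltac:(lra)) /ltr_normlP[]; lra.
Qed.

(** Monotonicity of [h] is required in the layer [- e1 <= h <= - eta] only: no curve gets below it
    without crossing it, and the sphere of radius [B] lies beyond it, so the curve cannot leave the
    ball either. *)
Lemma barrier_invariance (U : normedModType R) n (h : 'cV[R]_n -> R)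
  (B e1 eta a b : R) (phi : R -> U * 'cV[R]_n) :
  C1 h -> a <= b -> 0 < eta -> eta < e1 ->
  (forall x, `|x| = B -> h x < - e1) ->
  abs_continuous a b phi ->
  {ae @lebesgue_measure R, forall t, t \in `[a, b] -> derivable phi t 1 /\
     (`|(phi t).2| <= B -> - e1 <= h (phi t).2 -> h (phi t).2 <= - eta ->
      0 <= dot (grad h (phi t).2) (derive1 phi t).2)} ->
  `|(phi a).2| <= B -> - eta <= h (phi a).2 ->
  forall t, t \in `[a, b] -> `|(phi t).2| <= B /\ - eta <= h (phi t).2.
Proof.
move=> hC1 ab eta0 eta1 hB ac ae phia ha.
pose good t := `|(phi t).2| <= B /\ - eta <= h (phi t).2.
pose F t := h (phi t).2.
have ctsxi t e : a <= t -> t <= b -> 0 < e -> exists2 d, 0 < d &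
    forall u, a <= u -> u <= b -> `|u - t| < d -> `|(phi u).2 - (phi t).2| < e.
  move=> at' tb e0; have [d d0 hd] := abs_continuous_cts ac at' tb e0.
  exists d => // u au ub ut; apply: le_lt_trans (hd u au ub ut).
  exact: (norm_snd_le (phi u - phi t)).
have ctsF t e : a <= t -> t <= b -> 0 < e -> exists2 d, 0 < d &
    forall u, a <= u -> u <= b -> `|u - t| < d -> `|F u - F t| < e.
  move=> at' tb e0; have e2 : 0 < e / 2 by rewrite divr_gt0.
  have [r r0 hr] := continuous_dist_le (phi t).2 (C1_continuous hC1) e2.
  have [d d0 hd] := ctsxi t r at' tb r0.
  exists d => // u au ub ut; apply: le_lt_trans (hr _ (hd u au ub ut)) _.
  by rewrite ltr_pdivrMr// ltr_pMr// ltr1n.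
suff H : forall s, a <= s -> s <= b -> good s.
  by move=> t; rewrite in_itv/= => /andP[]; exact: H.
pose Q t := forall s, a <= s -> s <= t -> good s.
suff : Q b by move=> Qb s as' sb; exact: Qb.
apply: (real_induction ab); first by move=> s as' sa; have -> : s = a by apply/eqP; rewrite eq_le sa as'.
move=> t at' tb.
(* On or outside the sphere there is nothing to propagate: just before [t] the curve is still in the
   ball with [h >= - eta], and continuity gives a contradiction. *)
have [xiB|xiB] := ltP `|(phi t).2| B; last first.
  have [E|xiB'] := eqVneq `|(phi t).2| B.
    have hn : 0 < - eta - F t by have := hB _ E; rewrite /F; lra.
    have [d d0 hd] := ctsF t _ at' tb hn.
    exists d => // x y ax tx xt ty yt yb Qx; exfalso.
    have [_] := Qx x ax (lexx _); have := hd x ax (le_trans xt tb).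
    rewrite distrC ger0_norm ?subr_ge0// -/(F x) => /(_ ltac:(lra)) /ltr_normlP[]; lra.
  have xiB2 : 0 < `|(phi t).2| - B by rewrite subr_gt0 lt_neqAle eq_sym xiB'.
  have [d d0 hd] := ctsxi t _ at' tb xiB2.
  exists d => // x y ax tx xt ty yt yb Qx; exfalso.
  have [xB _] := Qx x ax (lexx _); have := hd x ax (le_trans xt tb).
  rewrite distrC ger0_norm ?subr_ge0// => /(_ ltac:(lra)).
  have := lerB_dist (phi t).2 (phi x).2; rewrite distrC; lra.
have xiB0 : 0 < B - `|(phi t).2| by rewrite subr_gt0.
have [d2 d20 hd2] := ctsxi t _ at' tb xiB0.
have inB u : a <= u -> u <= b -> `|u - t| < d2 -> `|(phi u).2| <= B.
  move=> au ub ut; have := hd2 u au ub ut.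
  have := lerB_dist (phi u).2 (phi t).2; lra.
have [Ft|Ft] := ltP (F t) (- eta).
  have hn : 0 < - eta - F t by lra.
  have [d d0 hd] := ctsF t _ at' tb hn.
  exists d => // x y ax tx xt ty yt yb Qx; exfalso.
  have [_] := Qx x ax (lexx _); have := hd x ax (le_trans xt tb).
  rewrite distrC ger0_norm ?subr_ge0// -/(F x) => /(_ ltac:(lra)) /ltr_normlP[]; lra.
have hn : 0 < e1 - eta by rewrite subr_gt0.
have [d1 d10 hd1] := ctsF t _ at' tb hn.
exists (Num.min d1 d2); first by rewrite lt_min d10.
move=> x y ax tx xt ty yt yb Qx s as' sy.
have [sx|xs] := leP s x; first exact: Qx.
have near_t u : x <= u -> u <= y -> `|u - t| < d1 /\ `|u - t| < d2.
  move=> xu uy; apply/andP; rewrite -lt_min ltr_distl.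
  by rewrite (lt_le_trans tx xu) (le_lt_trans uy yt).
have Floc u : x <= u -> u <= y -> - e1 <= F u.
  move=> xu uy; have [ud _] := near_t u xu uy.
  have := hd1 u (le_trans ax xu) (le_trans uy yb) ud => /ltr_normlP[]; move: Ft; clear; lra.
have Bloc u : x <= u -> u <= y -> `|(phi u).2| <= B.
  move=> xu uy; have [_ ud] := near_t u xu uy.
  exact: inB (le_trans ax xu) (le_trans uy yb) ud.
split; first exact: (Bloc s (ltW xs) sy).
rewrite leNgt; apply/negP => Fs.
have [_ Fx] := Qx x ax (lexx _).
(* After its last visit to the level [- eta] the curve stays in the layer, where [h] does not
   decrease, and so it cannot end below that level. *)
have [|t0 [xt0 t0s Ft0 after]] := @last_crossing F x s (- eta) (ltW xs) Fx Fs.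
  move=> u e xu us e0; have [d d0 hd] := ctsF u e (le_trans ax xu) (le_trans us (le_trans sy yb)) e0.
  exists d => // w xw ws; apply: hd; first exact: le_trans xw.
  exact: le_trans ws (le_trans sy yb).
have [C C0 hC] := C1_lipschitz_cball B hC1.
suff : F t0 <= F s by rewrite Ft0 leNgt Fs.
apply: (@ac_nondecreasing R _ t0 s C phi F (ltW t0s) _ C0).
- apply: abs_continuousS ac; first exact: le_trans ax xt0.
  exact: le_trans sy yb.
- move=> u v tu uv vs.
  have xu : x <= u by exact: le_trans tu.
  have vy : v <= y by exact: le_trans sy.
  apply: le_trans (hC (phi u).2 (phi v).2 _ _) _.
  + by apply: Bloc => //; exact: le_trans vy.
  + by apply: Bloc => //; exact: le_trans uv.
  by rewrite ler_wpM2l//; exact: (norm_snd_le (phi v - phi u)).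
apply: lebesgue_aeS (lebesgue_aeI ae (ae_neq t0)) => u [H ut0].
rewrite in_itv/= => /andP[tu us].
have xu : x <= u by exact: le_trans tu.
have uy : u <= y by exact: le_trans sy.
have [|dphi Hu] := H.
  by rewrite in_itv/= (le_trans ax xu) (le_trans uy yb).
have dphi2 : derivable (fun s => (phi s).2) u 1 by move/derivable_pair : dphi => [].
have [dF F'] := derivable_comp_grad (hC1.1 (phi u).2) dphi2.
have FE : F = h \o (fun s => (phi s).2) by [].
rewrite FE; split => //; rewrite F'.
rewrite derive1_pair// in Hu; apply: Hu; first exact: Bloc.
  exact: Floc.
by apply/ltW/after => //; rewrite lt_neqAle eq_sym ut0.
Qed.

End Invariance.

(** * Limits of curves along ultrafilters *)

Section FilterLimits.
Variable R : realType.

Lemma ultra_compact_cvg (T : topologicalType) (I : Type) (U : set_system I)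
  (K : set T) (f : I -> T) : UltraFilter U -> compact K -> (forall k, K (f k)) ->
  exists2 p, K p & f @ U --> p.
Proof.
move=> UU cK fK; have PU : ProperFilter U by exact: ultra_proper.
have [|p [Kp clp]] := cK (f @ U) _.
  exact: (@filterS _ U _ setT (f @^-1` K) (fun k _ => fK k) filterT).
exists p => // A pA; have [//|nA] := in_ultra_setVsetC (f @^-1` A) UU.
by have [q [qnA qA]] := clp (~` A) A nA pA.
Qed.

(** One ultrafilter fixes the limits at all times simultaneously, which replaces the diagonal
    extraction of the Arzela-Ascoli theorem. *)
Lemma ultra_limit_curve (V : normedModType R) (I : Type) (U : set_system I)
  (K : set V) (y : I -> R -> V) (J : set R) :
  UltraFilter U -> compact K -> (forall k t, J t -> K (y k t)) ->
  exists z : R -> V, forall t e, J t -> 0 < e -> \forall k \near U, `|y k t - z t| <= e.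
Proof.
move=> UU cK yK; have PU : ProperFilter U by exact: ultra_proper.
have H t : exists p : V, J t -> forall e, 0 < e -> \forall k \near U, `|y k t - p| <= e.
  have [Jt|nJt] := pselect (J t); last by exists 0.
  have [p _ yp] := ultra_compact_cvg UU cK (fun k => yK k t Jt).
  exists p => _ e e0; move/cvgrPdist_le : yp => /(_ e e0).
  by apply: filterS => k; rewrite distrC.
have [z hz] := choice H.
by exists z => t e Jt; exact: hz.
Qed.

Lemma limit_lipschitz_curve (V : normedModType R) (I : Type) (F : set_system I)
  {PF : ProperFilter F} (a b M : R) (y : I -> R -> V) (z : R -> V) :
  (\forall k \near F, lipschitz_curve a b M (y k)) ->
  (forall s e, s \in `[a, b] -> 0 < e -> \forall k \near F, `|y k s - z s| <= e) ->
  lipschitz_curve a b M z.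
Proof.
move=> ylip yz u v au uv vb; apply/ler_addgt0Pr => e e0.
have e2 : 0 < e / 2 by rewrite divr_gt0.
have uI : u \in `[a, b] by rewrite in_itv/= au (le_trans uv).
have vI : v \in `[a, b] by rewrite in_itv/= vb (le_trans au).
near F => k.
have h1 : lipschitz_curve a b M (y k) by near: k.
have h2 : `|y k u - z u| <= e / 2 by near: k; exact: yz.
have h3 : `|y k v - z v| <= e / 2 by near: k; exact: yz.
have h4 := h1 u v au uv vb.
have : `|z v - z u| <= `|z v - y k v| + `|y k v - y k u| + `|y k u - z u|.
  rewrite -(subrKA (y k v)) -[X in _ + X](subrKA (y k u)).
  by rewrite (le_trans (ler_normD _ _))// -[leRHS]addrA lerD2l ler_normD.
rewrite (distrC (z v) (y k v)); lra.
Unshelve. all: by end_near. Qed.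

Lemma lipschitz_unif_near (V : normedModType R) (I : Type) (F : set_system I)
  {PF : ProperFilter F} (a b M : R) (y : I -> R -> V) (z : R -> V) e : a < b -> 
  (\forall k \near F, lipschitz_curve a b M (y k)) ->
  (forall s e, s \in `[a, b] -> 0 < e -> \forall k \near F, `|y k s - z s| <= e) ->
  0 < e -> \forall k \near F, forall s, s \in `[a, b] -> `|y k s - z s| <= e.
Proof.
move=> ab ylip yz e0.
have zlip : lipschitz_curve a b M z by exact: limit_lipschitz_curve ylip yz.
have M0 : 0 <= M.
  by rewrite -(pmulr_lge0 M (_ : 0 < b - a)) ?subr_gt0// (le_trans _ (zlip a b _ _ _))// ltW.
have e3 : 0 < e / 3 by rewrite divr_gt0.
have ba : 0 < b - a by rewrite subr_gt0.
(* With this mesh each of the two curves moves by at most [e / 3] between nodes, and [e / 3] remains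
   for the finitely many nodes. *)
pose N := Num.bound (M * (b - a) / (e / 3)).
have N0 : 0 <= M * (b - a) / (e / 3) by rewrite divr_ge0 ?mulr_ge0// ltW.
have NP : M * (b - a) / (e / 3) < N%:R by have := archi_boundP N0.
have N1 : 0 < N%:R :> R by exact: le_lt_trans NP.
pose node (i : 'I_N.+1) := a + (b - a) * (i%:R / N%:R).
have nodeI i : node i \in `[a, b].
  have i1 : i%:R / N%:R <= 1 :> R by rewrite ler_pdivrMr// mul1r ler_nat -ltnS.
  rewrite in_itv/= lerDl mulr_ge0 ?divr_ge0 ?(ltW ba)//=.
  rewrite -lerBrDl ler_piMr// ltW//.
have grid : \forall k \near F, forall i, `|y k (node i) - z (node i)| <= e / 3.
  by apply: filter_forall => i; exact: yz.
near=> k => s; rewrite in_itv/= => /andP[as' sb].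
have klip : lipschitz_curve a b M (y k) by near: k.
have kgrid : forall i, `|y k (node i) - z (node i)| <= e / 3 by near: k.
have s0 : 0 <= (s - a) / (b - a) * N%:R.
  by rewrite mulr_ge0 ?divr_ge0 ?subr_ge0// ltW.
pose i := Num.truncn ((s - a) / (b - a) * N%:R).
have /andP[i1 i2] := truncn_itv s0.
have iN : (i < N.+1)%N.
  rewrite ltnS -(ler_nat R) (le_trans i1)// ler_piMl ?(ltW N1)//.
  by rewrite ler_pdivrMr// mul1r lerD2r.
pose j := Ordinal iN.
have nj1 : node j <= s.
  rewrite /node /= -lerBrDl mulrA ler_pdivrMr// (mulrC (b - a)) -ler_pdivlMr//.
  by rewrite mulrAC.
have nj2 : s - node j <= (b - a) / N%:R.
  have -> : s - node j = ((s - a) * N%:R - (b - a) * i%:R) / N%:R.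
    by rewrite /node/=; field; rewrite gt_eqF.
  have i2' : (s - a) * N%:R < (i%:R + 1) * (b - a).
    by rewrite -ltr_pdivrMr// mulrAC natr1.
  rewrite ler_pM2r ?invr_gt0// lerBlDr (le_trans (ltW i2'))//.
  by rewrite mulrDl mul1r addrC (mulrC (b - a)).
have step : M * (s - node j) <= e / 3.
  apply: (@le_trans _ _ (M * ((b - a) / N%:R))); first by rewrite ler_wpM2l.
  by rewrite mulrA ler_pdivrMr// [leRHS]mulrC -ler_pdivrMr// ltW.
have /andP[aj jb] : (a <= node j) && (node j <= b) by have := nodeI j; rewrite in_itv.
have h1 := klip _ _ aj nj1 sb; have h2 := zlip _ _ aj nj1 sb; have h3 := kgrid j.
have : `|y k s - z s| <= `|y k s - y k (node j)| + `|y k (node j) - z (node j)| + `|z (node j) - z s|.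
  rewrite -(subrKA (y k (node j))) -[X in _ + X](subrKA (z (node j))).
  by rewrite (le_trans (ler_normD _ _))// -[leRHS]addrA lerD2l ler_normD.
rewrite (distrC (z (node j))); lra.
Unshelve. all: by end_near. Qed.

(** Only [p] is confined to [K], while [q] is free: halving the local radius [d] leaves room for
    both the recentring from [p] to a nearby [p'] and the distance to [q]. *)
Lemma compact_unif_dist (V W : normedModType R) (G : V -> W) (K : set V) e :
  compact K -> continuous G -> 0 < e ->
  exists2 w, 0 < w & forall p q, K p -> `|q - p| < w -> `|G q - G p| <= e.
Proof.
move=> /compact_near_coveringP cK cG e0.
have := cK R (0 : R)^'+ (fun w p => forall q, `|q - p| < w -> `|G q - G p| <= e) _.
have e2 : 0 < e / 2 by rewrite divr_gt0.
move=> H; have {H} : \forall w \near (0 : R)^'+, K `<=` (fun p => forall q, `|q - p| < w -> `|G q - G p| <= e).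
  apply: H => p _; have [d d0 hd] := continuous_dist_le p cG e2.
  have d2 : 0 < d / 2 by rewrite divr_gt0.
  exists ([set p' | `|p - p'| < d / 2], [set w : R | w < d / 2]).
    split => /=.
      by apply/nbhs_normP; exists (d / 2).
    by apply: nbhs_right_lt.
  move=> [p' w] [/= pp' wd] q qp'.
  have h1 : `|G p' - G p| <= e / 2 by apply: hd; rewrite distrC (lt_trans pp')// ltr_pdivrMr// ltr_pMr// ltr1n.
  have h2 : `|G q - G p| <= e / 2.
    apply: hd; rewrite -(subrKA p') (le_lt_trans (ler_normD _ _))//.
    by rewrite (splitr d) ltrD// ?(lt_trans qp')// distrC.
  have : `|G q - G p'| <= `|G q - G p| + `|G p - G p'| by rewrite -(subrKA (G p)) ler_normD.
  rewrite (distrC (G p)); lra.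
move=> H; near (0 : R)^'+ => w; exists w.
  by near: w; exact: nbhs_right_gt.
have Hw : K `<=` (fun p => forall q, `|q - p| < w -> `|G q - G p| <= e) by near: w.
by move=> p q Kp; exact: Hw.
Unshelve. all: by end_near. Qed.

End FilterLimits.

(** * Euler polygons and the Kneser chain *)

Section EulerPolygons.
Variables (R : realType) (V : normedModType R) (G : V -> V) (K T : R) (N : nat).
Implicit Types (c : R -> V) (i j k : nat).

Definition node i : R := i%:R * (T / N%:R).

Definition euler_ray i c : R -> V := fun t =>
  if t <= node i then c t else c (node i) + (t - node i) *: G (c (node i)).

(** Each ray runs on forever and is overwritten by the next one; the result follows [c] up to node
    [i] and then makes [k] Euler steps. Acting on whole curves makes continuity in [c] a plain
    induction. *)
Fixpoint euler k i c : R -> V :=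
  if k is k'.+1 then euler k' i.+1 (euler_ray i c) else c.

Hypotheses (G_bound : forall p, `|G p| <= K) (G_cont : continuous G)
  (T0 : 0 < T) (N0 : (0 < N)%N).

Let N0R : 0 < N%:R :> R. Proof. by rewrite ltr0n. Qed.
Let step0 : 0 < T / N%:R. Proof. by rewrite divr_gt0. Qed.

Lemma node_ge0 i : 0 <= node i.
Proof. by rewrite mulr_ge0// ltW. Qed.

Lemma nodeS i : node i.+1 = node i + T / N%:R.
Proof. by rewrite /node -natr1 mulrDl mul1r. Qed.

Lemma node_le i j : (i <= j)%N -> node i <= node j.
Proof. by move=> ij; rewrite ler_pM2r// ler_nat. Qed.

Lemma nodeN : node N = T.
Proof. by rewrite /node mulrCA divff ?mulr1// gt_eqF. Qed.

Lemma node_leT i : (i <= N)%N -> node i <= T.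
Proof. by rewrite -[leRHS]nodeN; exact: node_le. Qed.

Lemma euler_ray_before i c t : t <= node i -> euler_ray i c t = c t.
Proof. by rewrite /euler_ray => ->. Qed.

Lemma euler_ray_after i c t : node i <= t ->
  euler_ray i c t = c (node i) + (t - node i) *: G (c (node i)).
Proof.
rewrite /euler_ray => it; case: ifP => // ti.
have -> : t = node i by apply/eqP; rewrite eq_le ti.
by rewrite subrr scale0r addr0.
Qed.

Lemma euler_ray_lipschitz i c : (i <= N)%N ->
  lipschitz_curve 0 T K c -> lipschitz_curve 0 T K (euler_ray i c).
Proof.
move=> iN clip u v u0 uv vT.
have K0 : 0 <= K by exact: le_trans (normr_ge0 _) (G_bound (c 0)).
have [vi|iv] := leP v (node i).
  by rewrite !euler_ray_before ?(le_trans uv)// clip.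
have [iu|ui] := leP (node i) u.
  rewrite !euler_ray_after ?(ltW iv)// opprD addrACA subrr add0r -scalerBl.
  rewrite opprB addrA subrK normrZ ger0_norm ?subr_ge0// mulrC ler_wpM2r//.
  by rewrite subr_ge0.
rewrite (euler_ray_before _ (ltW ui)) (euler_ray_after _ (ltW iv)) addrAC.
rewrite (le_trans (ler_normD _ _))//.
have h1 := clip u (node i) u0 (ltW ui) (node_leT iN).
have h2 : `|(v - node i) *: G (c (node i))| <= K * (v - node i).
  by rewrite normrZ gtr0_norm ?subr_gt0// mulrC ler_wpM2r ?subr_ge0 ?(ltW iv).
lra.
Qed.

Lemma euler_lipschitz k i c : (i + k <= N)%N ->
  lipschitz_curve 0 T K c -> lipschitz_curve 0 T K (euler k i c).
Proof.
elim: k i c => [//|k IH] i c ikN clip /=.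
apply: IH; first by rewrite addSn -addnS.
by apply: euler_ray_lipschitz => //; rewrite (leq_trans _ ikN)// leq_addr.
Qed.

Lemma euler_before k i c t : t <= node i -> euler k i c t = c t.
Proof.
elim: k i c => [//|k IH] i c ti /=.
by rewrite IH ?euler_ray_before// (le_trans ti)// node_le.
Qed.

Lemma euler_segment k i c q t : (q < k)%N ->
  node (i + q) <= t -> t <= node (i + q).+1 ->
  euler k i c t = euler k i c (node (i + q)) +
    (t - node (i + q)) *: G (euler k i c (node (i + q))).
Proof.
elim: k i c q => [//|k IH] i c [|q] /= qk.
  rewrite addn0 => it ti.
  rewrite !euler_before//; last by rewrite node_le.
  by rewrite euler_ray_after// euler_ray_before.
by rewrite -addSnnS; exact: IH.
Qed.

Lemma euler_continuous k i (c : R -> R -> V) :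
  (forall t, continuous (c ^~ t)) -> forall t, continuous (fun s => euler k i (c s) t).
Proof.
elim: k i c => [//|k IH] i c cc /=; apply: IH => t.
have [ti|ti] := leP t (node i).
  rewrite (_ : (fun s => euler_ray i (c s) t) = c ^~ t); first exact: cc.
  by apply/funext => s; rewrite euler_ray_before.
rewrite (_ : (fun s => euler_ray i (c s) t) =
  (fun s => c s (node i) + (t - node i) *: G (c s (node i)))); last first.
  by apply/funext => s; rewrite euler_ray_after// ltW.
apply: continuous_add => //; apply: continuous_scale; first exact: cst_continuous.
by move=> s; apply: continuous_comp; [exact: cc|exact: G_cont].
Qed.

Lemma euler_ext k i c c' : (forall t, 0 <= t -> c t = c' t) ->
  forall t, 0 <= t -> euler k i c t = euler k i c' t.
Proof.
elim: k i c c' => [//|k IH] i c c' cc' /=; apply: IH => t t0.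
by rewrite /euler_ray; case: ifP => _; rewrite ?cc' ?node_ge0.
Qed.

Lemma euler_ext0 c c' : c 0 = c' 0 ->
  forall t, 0 <= t -> euler N 0 c t = euler N 0 c' t.
Proof.
move=> cc'; have -> : N = N.-1.+1 by rewrite prednK.
move=> /=; apply: euler_ext => t t0.
have n0 : node 0 = 0 by rewrite /node mul0r.
by rewrite !euler_ray_after n0 // cc'.
Qed.

Lemma lebesgue_ae_forall (P : nat -> R -> Prop) :
  (forall i, {ae @lebesgue_measure R, forall t, P i t}) ->
  {ae @lebesgue_measure R, forall t, forall i, P i t}.
Proof.
move=> H; have := @negligible_bigcup _ _ _ (@lebesgue_measure R)
  (fun i => ~` [set t | P i t]) H.
by apply: negligibleS => t /= /existsNP[i Pi]; exists i.
Qed.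

(** Inside a cell the velocity is the field at the left node, at distance at most [K] times the step
    from the current point. The nodes are a null set. *)
Lemma euler_ae k i c (e : R) : (i + k <= N)%N ->
  lipschitz_curve 0 T K c ->
  (forall p t, `|p - euler k i c t| <= K * (T / N%:R) ->
     0 <= t -> t <= T -> `|G p - G (euler k i c t)| <= e) ->
  {ae @lebesgue_measure R, forall t, t \in `[node i, node (i + k)] ->
     derivable (euler k i c) t 1 /\
     `|derive1 (euler k i c) t - G (euler k i c t)| <= e}.
Proof.
move=> ikN clip Ge; set E := euler k i c.
have Elip : lipschitz_curve 0 T K E by exact: euler_lipschitz.
apply: lebesgue_aeS (lebesgue_ae_forall (fun j => ae_neq (node j))) => t tj.
rewrite in_itv/= => /andP[it tk].
have t0 : 0 <= t by exact: le_trans (node_ge0 i) it.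
have tT : t <= T by rewrite (le_trans tk)// node_leT.
have s0 : 0 <= t / (T / N%:R) by rewrite divr_ge0// ltW.
pose j := Num.truncn (t / (T / N%:R)).
have /andP[j1 j2] := truncn_itv s0.
have jt : node j <= t by rewrite /node -ler_pdivlMr.
have tj1 : t < node j.+1 by rewrite /node -ltr_pdivrMr.
have jt' : node j < t by rewrite lt_neqAle jt eq_sym tj.
have ij : (i <= j)%N.
  rewrite leqNgt; apply/negP => ji; move: tj1; rewrite ltNge; apply/negP.
  by rewrite negbK (le_trans _ it)// node_le.
have jk : (j < i + k)%N.
  rewrite ltnNge; apply/negP => kj; move: jt'; rewrite ltNge; apply/negP.
  by rewrite negbK (le_trans tk)// node_le.
have ijE : (i + (j - i) = j)%N by rewrite subnKC.
have seg s : node j <= s -> s <= node j.+1 -> E s = E (node j) + (s - node j) *: G (E (node j)).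
  by move=> h1 h2; have := @euler_segment k i c (j - i) s; rewrite ijE; apply; rewrite // ltn_subLR.
have cvgE : (d^-1 *: (E (d *: 1 + t) - E t)) @[d --> (0 : R)^'] --> G (E (node j)).
  apply: cvg_near_cst; near=> d.
  have d0 : d != 0 by near: d; exact: nbhs_dnbhs_neq.
  have dE : d *: (1 : R) = d by rewrite /GRing.scale/= mulr1.
  have dlt : `|d| < Num.min (t - node j) (node j.+1 - t).
    by near: d; apply: dnbhs0_lt; rewrite lt_min !subr_gt0 jt'.
  move: dlt; rewrite lt_min => /andP[/ltr_normlP[a1 a2] /ltr_normlP[b1 b2]].
  have [e1 e2] : node j <= d + t /\ d + t <= node j.+1 by split; lra.
  rewrite dE (seg _ e1 e2) (seg _ jt (ltW tj1)).
  rewrite opprD addrACA subrr add0r -scalerBl scalerA.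
  rewrite (_ : d + t - node j - (t - node j) = d); last by ring.
  by rewrite mulVf// scale1r.
have dEt : derivable E t 1 by apply/cvg_ex; exists (G (E (node j))).
split => //; rewrite derive1E (_ : 'D_1 E t = G (E (node j))); last exact: cvg_lim.
apply: Ge => //; rewrite distrC.
apply: (le_trans (Elip _ _ (node_ge0 j) jt tT)).
rewrite ler_wpM2l//; first exact: le_trans (normr_ge0 _) (G_bound 0).
by rewrite lerBlDl -nodeS ltW.
Unshelve. all: by end_near. Qed.

End EulerPolygons.

Section KneserChain.
Variables (R : realType) (V : normedModType R) (G : V -> V) (K T : R) (N : nat)
  (D : V -> R) (theta : R).
Hypotheses (G_bound : forall p, `|G p| <= K) (G_cont : continuous G)
  (T0 : 0 < T) (N0 : (0 < N)%N) (D_cont : continuous D).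

(** Looking at nodes only makes this a finite maximum, hence continuous along families of curves
    that vary continuously at each fixed time. *)
Fixpoint node_max k (y : R -> V) : R :=
  if k is k'.+1 then Num.max (node_max k' y) (D (y (node T N k))) else D (y (node T N 0)).

Lemma node_max_ge k y i : (i <= k)%N -> D (y (node T N i)) <= node_max k y.
Proof.
elim: k => [|k IH]; first by rewrite leqn0 => /eqP ->.
rewrite leq_eqVlt => /orP[/eqP ->|ik]; first by rewrite /= le_max lexx orbT.
by rewrite /= le_max IH.
Qed.

Lemma node_max_attained k y : exists2 i, (i <= k)%N & D (y (node T N i)) = node_max k y.
Proof.
elim: k => [|k [i ik IH]]; first by exists 0%N.
rewrite /=; have [_|_] := leP (node_max k y) (D (y (node T N k.+1))).
  by exists k.+1.
by exists i => //; rewrite leqW.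
Qed.

Lemma node_max_continuous k (y : R -> R -> V) :
  (forall t, continuous (y ^~ t)) -> continuous (fun s => node_max k (y s)).
Proof.
move=> cy; have cD t : continuous (fun s => D (y s t)).
  by move=> s; apply: continuous_comp; [exact: cy|exact: D_cont].
by elim: k => [|k IH] /=; [exact: cD|apply: continuous_maxr].
Qed.

Lemma discrete_crossing (u : nat -> R) (k : nat) (v : R) : (0 < k)%N ->
  u 0%N <= v -> v <= u k -> exists2 j, (j < k)%N & u j <= v /\ v <= u j.+1.
Proof.
elim: k => // k IH _ u0 uk; have [vk|kv] := leP v (u k); last first.
  by exists k => //; split => //; exact: ltW.
case: k IH uk vk => [|k] IH uk vk; first by exists 0%N.
by have [j jk H] := IH isT u0 vk; exists j => //; exact: ltnW.
Qed.

(* The curves following c up to some node and the Euler polygon afterwards join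
   the Euler polygon to c, through a path along which the maximum of D over the
   nodes varies continuously. *)
Lemma kneser_chain c : lipschitz_curve 0 T K c ->
  (node_max N (euler G T N N 0 c) <= theta /\ theta <= node_max N c) \/
  (node_max N c <= theta /\ theta <= node_max N (euler G T N N 0 c)) ->
  exists j c', [/\ (j < N)%N, lipschitz_curve 0 T K c',
    forall t, t <= node T N j -> c' t = c t &
    node_max N (euler G T N (N - j.+1) j.+1 c') = theta].
Proof.
move=> clip H; pose Y j := euler G T N (N - j) j c.
have Y0 : Y 0%N = euler G T N N 0 c by rewrite /Y subn0.
have YN : Y N = c by rewrite /Y subnn.
have [j jN between] : exists2 j, (j < N)%N &
    Num.min (node_max N (Y j)) (node_max N (Y j.+1)) <= theta <=
    Num.max (node_max N (Y j)) (node_max N (Y j.+1)).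
  case: H => -[h1 h2].
    have u0 : node_max N (Y 0%N) <= theta by rewrite Y0.
    have uN : theta <= node_max N (Y N) by rewrite YN.
    have [j jN [j1 j2]] := @discrete_crossing (fun j => node_max N (Y j)) N theta N0 u0 uN.
    by exists j => //; rewrite ge_min j1/= le_max j2 orbT.
  have u0 : - node_max N (Y 0%N) <= - theta by rewrite Y0 lerN2.
  have uN : - theta <= - node_max N (Y N) by rewrite YN lerN2.
  have [j jN [j1 j2]] := @discrete_crossing (fun j => - node_max N (Y j)) N (- theta) N0 u0 uN.
  by exists j => //; rewrite ge_min le_max; move: j1 j2; rewrite !lerN2 => -> ->; rewrite orbT.
(* Both ends of the segment agree with [c] up to node [j], and convex combinations keep the
   Lipschitz constant. Euler steps from node [j.+1] turn the ends into [Y j] and [Y j.+1]. *)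
pose cs (s : R) : R -> V := fun t => (1 - s) *: euler_ray G T N j c t + s *: c t.
have cs0 : cs 0 = euler_ray G T N j c.
  by apply/funext => t; rewrite /cs subr0 scale1r scale0r addr0.
have cs1 : cs 1 = c by apply/funext => t; rewrite /cs subrr scale0r scale1r add0r.
have ccs t : continuous (cs ^~ t).
  apply: continuous_add; apply: continuous_scale; try exact: cst_continuous.
  - by move=> s; apply: cvgB; [exact: cvg_cst|exact: cvg_id].
  - by move=> s; exact: cvg_id.
pose Phi s := node_max N (euler G T N (N - j.+1) j.+1 (cs s)).
have cPhi : continuous Phi.
  by apply: node_max_continuous; apply: euler_continuous.
have Phi0 : Phi 0 = node_max N (Y j).
  rewrite /Phi cs0 /Y; congr node_max.
  by have -> : (N - j = (N - j.+1).+1)%N by rewrite subnSK.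
have Phi1 : Phi 1 = node_max N (Y j.+1) by rewrite /Phi cs1.
have [|s s01 Es] := @IVT R Phi 0 1 theta ler01 (continuous_subspaceT cPhi).
  by rewrite Phi0 Phi1.
move: s01; rewrite in_itv/= => /andP[s0 s1].
exists j, (cs s); split => //; last first.
  by move=> t tj; rewrite /cs euler_ray_before// -scalerDl subrK scale1r.
have rlip := euler_ray_lipschitz G_bound T0 N0 (ltnW jN) clip.
move=> u v u0 uv vT; rewrite /cs opprD addrACA -!scalerBr.
rewrite (le_trans (ler_normD _ _))// !normrZ (ger0_norm s0) ger0_norm ?subr_ge0//.
have : s * `|c v - c u| <= s * (K * (v - u)) by rewrite ler_wpM2l// clip.
have : (1 - s) * `|euler_ray G T N j c v - euler_ray G T N j c u| <= (1 - s) * (K * (v - u)).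
  by rewrite ler_wpM2l ?subr_ge0// rlip.
lra.
Qed.

End KneserChain.

Lemma derivable_eq_itv (R : realType) (V : normedModType R) (y c : R -> V) (a b t : R) :
  (forall u, a <= u -> u <= b -> y u = c u) -> a < t -> t < b -> derivable c t 1 ->
  derivable y t 1 /\ derive1 y t = derive1 c t.
Proof.
move=> yc at' tb dc.
have H : \forall u \near t, c u = y u.
  exists (Num.min (t - a) (b - t)) => /=; first by rewrite lt_min !subr_gt0 at'.
  move=> u /=; rewrite lt_min => /andP[/ltr_normlP[_ u1] /ltr_normlP[u2 _]].
  by rewrite yc//; lra.
split; first by apply: near_eq_derivable dc; rewrite ?oner_neq0.
rewrite !derive1E; apply/esym/near_eq_derive => //; rewrite oner_neq0.
Qed.

Lemma approx_step (R : realType) (x y a b k : R) :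
  - (x - y) <= k -> b <= y -> a <= b -> k <= a -> 0 <= x.
Proof. by lra. Qed.

Lemma quarter_gt (R : realType) (u r : R) : `|u - r| <= r / 4 -> 0 < r -> r / 2 < u.
Proof. by move=> /ler_normlP[]; lra. Qed.

Lemma quarter_le (R : realType) (u v r : R) :
  `|u - v| <= r / 4 -> v <= r / 2 -> 0 <= r -> u <= r.
Proof. by move=> /ler_normlP[]; lra. Qed.

Lemma half_quarter (R : realType) (r : R) : `|r / 2| <= r / 4 -> (0 < r) = false.
Proof. by move=> /ler_normlP[? ?]; apply/negbTE; rewrite -leNgt; lra. Qed.

Lemma near_ge0 (R : realType) (u v e : R) : `|u - v| <= e -> 0 <= v -> - e <= u.
Proof. by move=> /ler_normlP[]; lra. Qed.

Lemma near_le (R : realType) (u v r e : R) : `|u - v| <= e -> u <= r -> v <= r + e.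
Proof. by move=> /ler_normlP[]; lra. Qed.

Lemma half_ge0 (R : realType) (u v w e : R) :
  `|u - v| <= e / 2 -> - w <= u -> w <= e / 2 -> 0 <= e + v.
Proof. by move=> /ler_normlP[]; lra. Qed.

(** * Escape and confinement of trajectories of the barrier field *)

Section Tracking.
Variables (R : realType) (m n : nat) (h : 'cV[R]_n -> R) (P : 'M[R]_n)
  (f : 'cV[R]_m * 'cV[R]_n -> 'cV[R]_n) (g : 'cV[R]_m * 'cV[R]_n -> 'cV[R]_m)
  (B c M K T : R).
Local Notation V := ('cV[R]_m * 'cV[R]_n)%type.
Local Notation field := (barrier_field h P f g B c M).
Implicit Types (p : V) (alpha e eta : R) (phi psi y : R -> V).

Hypotheses (h_C1 : C1 h) (h_lip : locally_lipschitz (grad h))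
  (P_posdef : sym_posdef P) (f_cont : continuous f) (g_cont : continuous g)
  (B0 : 0 < B) (c0 : 0 < c) (M0 : 0 <= M) (T0 : 0 < T).
Hypothesis form_lo : forall x, `|x| <= B -> `|h x| <= c -> c <= grad_form h P x.
Hypothesis lieD_le : forall p, `|p.1| <= B -> `|p.2| <= B -> `|lieD h f p| + 1 <= M.
Hypothesis field_le : forall alpha p, `|field alpha p| <= K.
Hypothesis sphere_neg : forall x, `|x| = B -> h x < - c.
Hypothesis S_ball : forall x, 0 <= h x -> `|x| <= B - 1.

Let K0 : 0 <= K. Proof. exact: le_trans (normr_ge0 _) (field_le 0 0). Qed.
Let SB x : 0 <= h x -> `|x| <= B.
Proof. by move=> /S_ball; lra. Qed.

Definition approx_solution alpha e a b y : Prop :=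
  {ae @lebesgue_measure R, forall t, t \in `[a, b] ->
     derivable y t 1 /\ `|derive1 y t - field alpha (y t)| <= e}.

Lemma approx_solutionS alpha e a b a' b' y : a <= a' -> b' <= b ->
  approx_solution alpha e a b y -> approx_solution alpha e a' b' y.
Proof.
move=> aa bb; apply: lebesgue_aeS => t H; rewrite in_itv/= => /andP[at' tb].
by apply: H; rewrite in_itv/= (le_trans aa)// (le_trans tb).
Qed.

(** A velocity error [e] costs at most [C * e] in the derivative of [h], with [C] from a bound on
    the gradient, while in the layer below [- eta] the field raises [h] at rate at least
    [Num.min 1 (alpha * eta)]. *)
Lemma approx_invariance : exists2 C, 0 < C & forall alpha e eta a b y,
  0 < alpha -> 0 < eta -> eta < c -> C * e <= Num.min 1 (alpha * eta) -> a <= b ->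
  abs_continuous a b y -> approx_solution alpha e a b y ->
  `|(y a).2| <= B -> - eta <= h (y a).2 ->
  forall t, t \in `[a, b] -> `|(y t).2| <= B /\ - eta <= h (y t).2.
Proof.
have [C C0 hC] := continuous_compact_bounded (@compact_cball R n B) h_C1.2.
exists (n%:R * C + 1); first by rewrite ltr_wpDl// mulr_ge0// ltW.
move=> alpha e eta a b y al0 eta0 etac Ce ab ac ay yaB hya.
apply: (barrier_invariance h_C1 ab eta0 etac sphere_neg ac) => //.
apply: lebesgue_aeS ay => t H /H[dy ye]; split=> // yB h1 h2.
have hc : `|h (y t).2| <= c by rewrite ler_norml h1/=; lra.
have h0 : h (y t).2 <= 0 by lra.
have := barrier_field_inward g B0 c0 M0 form_lo lieD_le alpha yB hc h0.
set G := field alpha (y t) => HG.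
have e0 : 0 <= e by exact: le_trans (normr_ge0 _) ye.
have D : `|dot (grad h (y t).2) ((derive1 y t).2 - G.2)| <= (n%:R * C + 1) * e.
  rewrite (le_trans (dot_le _ _))// ler_pM ?mulr_ge0//.
    by rewrite ler_wpDr// ler_wpM2l// hC.
  exact: le_trans (norm_snd_le (derive1 y t - G)) ye.
have mono : Num.min 1 (alpha * eta) <= Num.min 1 (- (alpha * h (y t).2)).
  rewrite le_min !ge_min lexx/= -mulrN ler_pM2l//.
  by apply/orP; right; rewrite lerNr.
move: D; rewrite dotBr => /ler_normlP[D _].
exact: approx_step D HG mono Ce.
Qed.

Lemma field_invariance alpha a b y : 0 < alpha -> a <= b ->
  abs_continuous a b y -> approx_solution alpha 0 a b y -> 0 <= h (y a).2 ->
  forall t, t \in `[a, b] -> 0 <= h (y t).2.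
Proof.
move=> al0 ab ac ay ya t tab; have [C C0 inv] := approx_invariance.
apply/ler_addgt0Pl => e e0; pose eta := Num.min (c / 2) e.
have eta0 : 0 < eta by rewrite lt_min divr_gt0.
have etac : eta < c by rewrite gt_min ltr_pdivrMr// ltr_pMr// ltr1n.
have [|||_] := inv alpha 0 eta a b y al0 eta0 etac _ ab ac ay _ _ t tab.
- by rewrite mulr0 le_min ler01 mulr_ge0// ltW.
- exact: SB.
- by rewrite (le_trans _ ya)// oppr_le0 ltW.
have ee : eta <= e by rewrite ge_min lexx orbT.
by move=> hy; rewrite -lerBlDl sub0r (le_trans _ hy)// lerN2.
Qed.

(** The CBF field is identified with the barrier field on S only, so invariance must precede that
    identification. It follows from the constraint, which makes the derivative of [h] nonnegative
    where [h <= 0]. *)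
Lemma cbf_invariance alpha a b y : 0 < alpha -> a <= b ->
  abs_continuous a b y ->
  {ae @lebesgue_measure R, forall t, t \in `[a, b] ->
     derivable y t 1 /\ cbf h P f g alpha (y t) (derive1 y t)} ->
  0 <= h (y a).2 -> forall t, t \in `[a, b] -> 0 <= h (y t).2.
Proof.
move=> al0 ab ac ay ya t tab.
apply/ler_addgt0Pl => e e0; pose eta := Num.min (c / 2) e.
have eta0 : 0 < eta by rewrite lt_min divr_gt0.
have etac : eta < c by rewrite gt_min ltr_pdivrMr// ltr_pMr// ltr1n.
have [||] := @barrier_invariance R 'cV[R]_m n h B c eta a b y h_C1 ab eta0 etac sphere_neg ac _ (SB ya) _ t tab.
- apply: lebesgue_aeS ay => s H /H[dy ->]; split=> // yB h1 h2.
  have hc : `|h (y s).2| <= c by rewrite ler_norml h1/=; lra.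
  have q0 : 0 < grad_form h P (y s).2 by exact: lt_le_trans c0 (form_lo yB hc).
  have E := @halfspace_argmin R n P P_posdef (grad h (y s).2) (alpha * h (y s).2)
    (f (y s)) (or_introl q0).
  have : 0 <= dot (grad h (y s).2) (f_cbf h P f alpha (y s)) + alpha * h (y s).2.
    have ex : argmin [set mu | 0 <= dot (grad h (y s).2) mu + alpha * h (y s).2]
      (fun mu => pnorm P (mu - f (y s)) ^+ 2) !=set0 by rewrite E; eexists; reflexivity.
    by have [] := getPex ex.
  have : alpha * h (y s).2 <= 0.
    by rewrite pmulr_rle0//; lra.
  rewrite /=; lra.
- by rewrite (le_trans _ ya)// oppr_le0 ltW.
have ee : eta <= e by rewrite ge_min lexx orbT.
by move=> _ hy; rewrite -lerBlDl sub0r (le_trans _ hy)// lerN2.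
Qed.

(** [N] is chosen before the curve [cv]: all polygons concerned stay in the ball of radius
    [|p0| + K * T], near which the field is uniformly continuous. *)
Lemma field_modulus alpha e d p0 : 0 < e -> 0 < d ->
  exists N, [/\ (0 < N)%N, T / N%:R <= d &
    forall cv i k, (i + k <= N)%N -> lipschitz_curve 0 T K cv -> cv 0 = p0 ->
      approx_solution alpha e (node T N i) (node T N (i + k))
        (euler (field alpha) T N k i cv)].
Proof.
move=> e0 d0; pose r := `|p0| + K * T.
have cG : continuous (field alpha) by exact: barrier_field_continuous.
have [w w0 hw] := compact_unif_dist (@compact_cball_pair R m n r r) cG e0.
have K1 : 0 < K + 1 by rewrite ltr_wpDl.
pose d' := Num.min d (w / 2 / (K + 1)).
have d'0 : 0 < d' by rewrite lt_min d0 !divr_gt0.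
pose N := (Num.bound (T / d')).+1.
have NR : T / N%:R <= d'.
  rewrite ler_pdivrMr// mulrC -ler_pdivrMr//.
  have : T / d' < (Num.bound (T / d'))%:R by apply: archi_boundP; rewrite divr_ge0// ltW.
  by move=> /ltW/le_trans; apply; rewrite ler_nat.
have KN : K * (T / N%:R) < w.
  apply: (@le_lt_trans _ _ ((K + 1) * d')).
    by rewrite ler_pM ?divr_ge0 ?(ltW T0)// lerDl.
  apply: (@le_lt_trans _ _ (w / 2)).
    by rewrite mulrC -ler_pdivlMr// ge_min lexx orbT.
  by rewrite ltr_pdivrMr// ltr_pMr// ltr1n.
exists N; split=> //; first by rewrite (le_trans NR)// ge_min lexx.
move=> cv i k ikN clip cv0.
apply: (@euler_ae R V (field alpha) K T N (field_le alpha) T0) => //.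
move=> p t pt t0 tT; set E := euler _ _ _ _ _ _ in pt *.
have Elip : lipschitz_curve 0 T K E by exact: euler_lipschitz.
have E0 : E 0 = p0 by rewrite /E euler_before ?node_ge0.
have Er : `|E t| <= r.
  rewrite -(subrK (E 0) (E t)) (le_trans (ler_normD _ _))// addrC lerD//.
    by rewrite E0.
  apply: (le_trans (Elip _ _ (lexx _) t0 tT)).
  by rewrite subr0 ler_wpM2l.
have EK : [set p : V | `|p.1| <= r /\ `|p.2| <= r] (E t).
  by split; [exact: le_trans (norm_fst_le _) Er|exact: le_trans (norm_snd_le _) Er].
by apply: hw => //; exact: le_lt_trans pt KN.
Qed.

Lemma bounded_form_snd i : bounded_form (fun p => p.2 i 0).
Proof.
split; [by move=> u v; rewrite mxE|by move=> k v; rewrite mxE|].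
by exists 1 => // v; rewrite mul1r (le_trans (entry_le_norm _ _))// norm_snd_le.
Qed.

Lemma limit_ode (I : Type) (F : set_system I) {PF : ProperFilter F}
  (a b : R) (G : V -> V) (y : I -> R -> V) (z : R -> V) (eps : I -> R) (t : R) :
  continuous G -> a < t -> t < b ->
  (\forall k \near F, lipschitz_curve a b K (y k)) ->
  (\forall k \near F, {ae @lebesgue_measure R, forall s, s \in `[a, b] ->
     derivable (y k) s 1 /\ `|derive1 (y k) s - G (y k s)| <= eps k}) ->
  (forall e, 0 < e -> \forall k \near F, eps k <= e) ->
  (forall s e, s \in `[a, b] -> 0 < e -> \forall k \near F, `|y k s - z s| <= e) ->
  derivable z t 1 -> derive1 z t = G (z t).
Proof.
move=> cG at' tb ylip yG eps0 yz dz.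
have one l : bounded_form l -> l (G (z t)) <= l (derive1 z t).
  move=> bl; apply: (limit_form_ge (G := fun=> G) at' tb bl ylip yG eps0 yz _ dz).
  have [lD lZ [C C0 lC]] := bl.
  have lB u v : l (u - v) = l u - l v by rewrite lD -scaleN1r lZ mulN1r.
  have C1 : 0 < C + 1 by rewrite ltr_wpDl.
  move=> e e0; have eC : 0 < e / (C + 1) by rewrite divr_gt0.
  have [w w0 hw] := continuous_dist_le (z t) cG eC.
  exists w => //; apply: nearW => k p /hw H; have := lC (G p - G (z t)).
  rewrite lB => /ler_normlP[h1 _].
  have : C * `|G p - G (z t)| <= e.
    apply: (@le_trans _ _ ((C + 1) * (e / (C + 1)))); last by rewrite mulrC divfK ?gt_eqF.
    by rewrite ler_pM// lerDl.
  lra.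
have two l : bounded_form l -> l (derive1 z t) = l (G (z t)).
  move=> bl; apply/eqP; rewrite eq_le one// andbT.
  by have := one _ (bounded_formN bl); rewrite lerN2.
have E1 : (derive1 z t).1 = (G (z t)).1.
  by apply/matrixP => i j; rewrite (ord1 j); exact: (two _ (@bounded_form_fst R m n i)).
have E2 : (derive1 z t).2 = (G (z t)).2.
  by apply/matrixP => i j; rewrite (ord1 j); exact: (two _ (bounded_form_snd i)).
by rewrite [LHS]surjective_pairing E1 E2 -surjective_pairing.
Qed.

Lemma lipschitz_curve_ball p0 y a b t : lipschitz_curve a b K y -> y a = p0 ->
  t \in `[a, b] ->
  [set p : V | `|p.1| <= `|p0| + K * (b - a) /\ `|p.2| <= `|p0| + K * (b - a)] (y t).
Proof.
move=> ylip ya; rewrite in_itv/= => /andP[at' tb].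
suff H : `|y t| <= `|p0| + K * (b - a).
  by split; [exact: le_trans (norm_fst_le _) H|exact: le_trans (norm_snd_le _) H].
rewrite -(subrK (y a) (y t)) (le_trans (ler_normD _ _))// addrC lerD ?ya//.
rewrite -ya (le_trans (ylip _ _ (lexx _) at' tb))// ler_wpM2l// lerD2r//.
Qed.

(** Peano's existence theorem, by Euler polygons with vanishing step. *)
Lemma field_solution_exists alpha p0 : exists psi,
  [/\ lipschitz_curve 0 T K psi, psi 0 = p0 & approx_solution alpha 0 0 T psi].
Proof.
have ek (k : nat) : 0 < k.+1%:R^-1 :> R by rewrite invr_gt0.
have [Nk HN] := choice (fun k => field_modulus alpha p0 (ek k) (ek k)).
have clip : lipschitz_curve 0 T K (cst p0 : R -> V).
  by move=> u v _ uv _; rewrite subrr normr0 mulr_ge0// subr_ge0.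
pose y k := euler (field alpha) T (Nk k) (Nk k) 0 (cst p0).
have ylip k : lipschitz_curve 0 T K (y k).
  have [N0 _ _] := HN k; exact: (euler_lipschitz (field_le alpha) T0 N0).
have y0 k : y k 0 = p0 by have [N0 _ _] := HN k; rewrite /y euler_before ?node_ge0.
have yapp k : approx_solution alpha k.+1%:R^-1 0 T (y k).
  have [N0 _ /(_ (cst p0) 0%N (Nk k) (leqnn _) clip erefl)] := HN k.
  by rewrite add0n nodeN// /node mul0r.
have [U [UU Uoo]] := ultraFilterLemma (_ : ProperFilter \oo).
have PU : ProperFilter U by exact: ultra_proper.
have [z hz] := ultra_limit_curve (J := [set t | t \in `[0, T]]) UU
  (@compact_cball_pair R m n (`|p0| + K * (T - 0)) (`|p0| + K * (T - 0)))
  (fun k t tI => lipschitz_curve_ball (ylip k) (y0 k) tI).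
have zlip : lipschitz_curve 0 T K z.
  by apply: (limit_lipschitz_curve (F := U) (y := y)) => //; exact: nearW.
have z0 : z 0 = p0.
  have T0I : 0 \in `[0, T] by rewrite in_itv/= lexx ltW.
  apply/eqP; rewrite -subr_eq0 -normr_le0; apply/ler_addgt0Pr => e e0; rewrite add0r.
  have /filter_ex[k] := hz 0 e T0I e0.
  by rewrite y0 distrC.
exists z; split=> //.
apply: lebesgue_aeS (lebesgue_aeI (lipschitz_curve_derivable zlip)
  (lebesgue_aeI (ae_neq 0) (ae_neq T))) => t [dz [t0 tT]]; rewrite in_itv/= => /andP[t0' tT'].
have t0l : 0 < t by rewrite lt_neqAle eq_sym t0.
have tTl : t < T by rewrite lt_neqAle tT.
have {}dz : derivable z t 1 by apply: dz; rewrite in_itv/= t0l.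
split=> //; rewrite (limit_ode (F := U) (G := field alpha) (y := y)
  (eps := fun k => k.+1%:R^-1) _ t0l tTl) ?subrr ?normr0//.
- exact: barrier_field_continuous.
- exact: nearW.
- by apply: nearW => k; exact: yapp.
- move=> e e0; apply: Uoo; have := @cvg_harmonic R => /cvgrPdist_le/(_ e e0).
  by apply: filterS => k; rewrite sub0r normrN ger0_norm// /harmonic/= invr_ge0.
Qed.

Lemma stopped_lipschitz tb psi : 0 <= tb -> lipschitz_curve 0 tb K psi ->
  lipschitz_curve 0 T K (fun t => psi (Num.min t tb)).
Proof.
move=> tb0 plip u v u0 uv vT.
have [h1|h1] := leP u tb; have [h2|h2] := leP v tb.
- exact: plip.
- by rewrite (le_trans (plip u tb u0 h1 (lexx _)))// ler_wpM2l// lerD2r ltW.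
- by have := lt_le_trans h1 uv; rewrite ltNge h2.
- by rewrite subrr normr0 mulr_ge0// subr_ge0.
Qed.

Lemma node_before N t : (0 < N)%N -> 0 <= t -> t <= T ->
  exists2 i, (i <= N)%N & node T N i <= t /\ t <= node T N i + T / N%:R.
Proof.
move=> N0 t0 tT.
have [||i iN [h1 h2]] := @discrete_crossing R (node T N) N t N0.
- by rewrite /node mul0r.
- by rewrite nodeN.
by exists i; [exact: ltnW|rewrite -nodeS].
Qed.

Lemma node_max_ext (D : V -> R) N k y y' : (forall t, 0 <= t -> y t = y' t) ->
  node_max T N D k y = node_max T N D k y'.
Proof.
move=> yy; have N0 i : 0 <= node T N i by rewrite mulr_ge0// divr_ge0// ltW.
by elim: k => [|k IH] /=; rewrite ?IH yy.
Qed.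

Variables (Z' : set 'cV[R]_m) (d : 'cV[R]_m -> R) (rho : R) (p0 : V) (phi0 : R -> V).
Hypotheses (d_lip : forall z w, `|d z - d w| <= `|z - w|)
  (d_eq0 : forall z, Z' z -> d z = 0) (rho0 : 0 < rho)
  (d_ball : forall z, d z <= rho -> `|z| < B) (p0_in : 0 <= h p0.2)
  (phi0_sol : solution (pds h P f g) T p0 phi0)
  (phi0_lip : lipschitz_curve 0 T K phi0)
  (pds_inv : forall phi, solution (pds h P f g) T p0 phi ->
    forall t, t \in `[0, T] -> (Z' `*` superlevel h) (phi t)).

(** The curve is prescribed up to [tb] only and solves the barrier field exactly, so that CBF
    solutions and solutions of the barrier field are covered at once. *)
Definition escapes alpha : Prop := exists tb psi,
  [/\ 0 <= tb <= T, lipschitz_curve 0 tb K psi, psi 0 = p0,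
      approx_solution alpha 0 0 tb psi & d (psi tb).1 = rho].

Let D p := d p.1.
Let D_lip p q : `|D p - D q| <= `|p - q|.
Proof. exact: le_trans (d_lip _ _) (norm_fst_le (p - q)). Qed.

Let D_cont : continuous D.
Proof.
move=> p; apply/cvgrPdist_lt => e e0; near=> q.
by rewrite (le_lt_trans (D_lip _ _))//; near: q; exact: cvgr_dist_lt.
Unshelve. all: by end_near. Qed.

(** The tolerances of the chain: [rho / 4] for the motion between nodes, 1 for the gap between S and
    the sphere of radius [B], and [eta] for the loss of [h] on the cell where no equation holds. *)
Lemma escape_modulus e eta : 0 < e -> 0 < eta -> exists2 dd, 0 < dd &
  [/\ dd <= e, K * dd <= rho / 4, K * dd <= 1 &
  forall u v, `|u| <= B -> `|v| <= B -> `|v - u| <= K * dd -> `|h v - h u| <= eta].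
Proof.
move=> e0 eta0; have [C C0 hC] := C1_lipschitz_cball B h_C1.
have K1 : 0 < K + 1 by rewrite ltr_wpDl.
have C1' : 0 < C + 1 by rewrite ltr_wpDl.
pose k := Num.min (Num.min (rho / 4) 1) (eta / (C + 1)).
have k0 : 0 < k by rewrite !lt_min !divr_gt0 ?ltr01//.
have dk : K * Num.min e (k / (K + 1)) <= k.
  apply: (@le_trans _ _ ((K + 1) * (k / (K + 1)))); last by rewrite mulrC divfK ?gt_eqF.
  by rewrite ler_pM ?lerDl// ?le_min ?ge_min ?lexx ?orbT// ?(ltW e0) ?divr_ge0 ?ltW.
exists (Num.min e (k / (K + 1))); first by rewrite lt_min e0 divr_gt0.
split.
- by rewrite ge_min lexx.
- by rewrite (le_trans dk)// /k !ge_min lexx.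
- by rewrite (le_trans dk)// /k !ge_min lexx orbT.
move=> x y xB yB yx; rewrite (le_trans (hC _ _ xB yB))//.
apply: (@le_trans _ _ ((C + 1) * (eta / (C + 1)))); last by rewrite mulrC divfK ?gt_eqF.
rewrite ler_pM ?lerDl// (le_trans yx)// (le_trans dk)//.
by rewrite ge_min lexx orbT.
Qed.

(** [[s, s']] is the cell of interpolation. The level [rho / 2] at the nodes leaves a margin for
    times between nodes, while the escaping curve is still above it at the node preceding [tb]. *)
Lemma escape_chain : exists2 C, 0 < C & forall alpha e eta,
  0 < alpha -> 0 < e -> 0 < eta -> eta < c -> C * e <= Num.min 1 (alpha * eta) ->
  escapes alpha -> exists s s' y,
  [/\ [/\ 0 <= s, s <= s', s' <= T & s' - s <= e],
      [/\ lipschitz_curve 0 T K y, y 0 = p0 & exists2 t, t \in `[0, T] & d (y t).1 = rho / 2],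
      forall t, t \in `[0, T] -> d (y t).1 <= rho /\ - eta <= h (y t).2,
      approx_solution alpha e s' T y &
      (forall t, t <= s -> y t = phi0 t) \/ approx_solution alpha 0 0 s y].
Proof.
have [C C0 inv] := approx_invariance; exists C => // alpha e eta al0 e0 eta0 etac Ce.
move=> [tb [psi [/andP[tb0 tbT] plip psi0 papp dpsi]]].
have [dd dd0 [dde ddr dd1 ddh]] := escape_modulus e0 eta0.
have [N [N0 Ndd Napp]] := field_modulus alpha p0 e0 dd0.
have KN t u : t <= u -> u <= t + T / N%:R -> K * (u - t) <= K * dd.
  by move=> tu ut; rewrite ler_wpM2l// lerBlDr addrC (le_trans ut)// lerD2l.
pose cp t := psi (Num.min t tb).
have cplip : lipschitz_curve 0 T K cp by exact: stopped_lipschitz.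
have cp0 : cp 0 = p0 by rewrite /cp min_l.
pose th := rho / 2.
have th0 : 0 < th by rewrite divr_gt0.
have [i0 i0N [i0tb tbi0]] := node_before N0 tb0 tbT.
have i0pos : 0 <= node T N i0 by exact: node_ge0.
have Dtb : th < D (cp (node T N i0)).
  have h1 : `|D (cp (node T N i0)) - D (psi tb)| <= rho / 4.
    rewrite /cp min_l// (le_trans (D_lip _ _))// distrC (le_trans _ ddr)//.
    by rewrite (le_trans (plip _ _ (i0pos) i0tb (lexx _)))// KN.
  by move: h1; rewrite [D (psi tb)]dpsi => h1; exact: quarter_gt h1 rho0.
have nmcp : th < node_max T N D N cp by exact: lt_le_trans Dtb (node_max_ge _ _ _ _ i0N).
have nmphi : node_max T N D N phi0 <= th.
  have [i iN <-] := node_max_attained T N D N phi0.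
  have [|Zi _] := pds_inv phi0_sol (t := node T N i).
    by rewrite in_itv/= node_ge0// node_leT.
  by rewrite /D d_eq0// ltW.
have [_ phi00 phi0ae] := phi0_sol.
have GK := field_le alpha.
have Gc : continuous (field alpha) by exact: barrier_field_continuous.
have EE : node_max T N D N (euler (field alpha) T N N 0 cp) =
          node_max T N D N (euler (field alpha) T N N 0 phi0).
  by apply: node_max_ext; apply: euler_ext0; rewrite ?cp0 ?phi00.
have [c1 [c1lip c10 c1nm c1S c1alt]] : exists c1, [/\ lipschitz_curve 0 T K c1, c1 0 = p0,
   (node_max T N D N (euler (field alpha) T N N 0 c1) <= th /\ th <= node_max T N D N c1) \/
   (node_max T N D N c1 <= th /\ th <= node_max T N D N (euler (field alpha) T N N 0 c1)),
   forall t, t \in `[0, T] -> 0 <= h (c1 t).2 & c1 = phi0 \/ c1 = cp].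
  (* The polygon from [p0] is either at most at the level, and is joined to the escaping curve, or
     above it, and is joined to [phi0], whose distance to Z' is zero. *)
  have [le|lt] := leP (node_max T N D N (euler (field alpha) T N N 0 cp)) th.
    exists cp; split=> //; [by left; split=> //; exact: ltW| |by right].
    move=> t; rewrite in_itv/= => /andP[t0 tT].
    apply: (field_invariance al0 tb0 (lipschitz_curve_abs_continuous plip) papp).
      by rewrite psi0.
    by rewrite in_itv/= le_min t0 tb0 ge_min lexx orbT.
  exists phi0; split=> //; [by right; split=> //; rewrite -EE ltW| |by left].
  by move=> t tI; case: (pds_inv phi0_sol tI).
have [j [c' [jN c'lip c'c c'nm]]] := kneser_chain GK Gc T0 N0 D_cont c1lip c1nm.
set y := euler (field alpha) T N (N - j.+1) j.+1 c' in c'nm.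
have jE : (j.+1 + (N - j.+1))%N = N by rewrite subnKC.
have ylip : lipschitz_curve 0 T K y by apply: euler_lipschitz; rewrite ?jE.
have yc' t : t <= node T N j.+1 -> y t = c' t by exact: euler_before.
have jj : node T N j <= node T N j.+1 by rewrite node_le.
have yc t : t <= node T N j -> y t = c1 t.
  by move=> tj; rewrite yc' ?c'c//; exact: le_trans jj.
have j0 : 0 <= node T N j by exact: node_ge0.
have jT : node T N j.+1 <= T by exact: node_leT.
have y0 : y 0 = p0 by rewrite yc.
have yapp : approx_solution alpha e (node T N j.+1) T y.
  have c'0 : c' 0 = p0 by rewrite c'c.
  have := Napp c' j.+1 (N - j.+1)%N; rewrite jE => /(_ (leqnn _) c'lip c'0).
  by rewrite nodeN.
have yS t : t \in `[0, T] -> `|(y t).2| <= B /\ - eta <= h (y t).2.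
  (* On the cell of interpolation nothing but the Lipschitz bound is known; it suffices because the
     curve is still in S at node [j]. *)
  have near_j t' : node T N j <= t' -> t' <= node T N j.+1 ->
      `|(y t').2| <= B /\ - eta <= h (y t').2.
    move=> jt tj.
    have hj : 0 <= h (y (node T N j)).2.
      by rewrite yc// c1S// in_itv/= j0 (le_trans jj).
    have dj : `|(y t').2 - (y (node T N j)).2| <= K * dd.
      apply: (le_trans (norm_snd_le (y t' - y (node T N j)))).
      apply: (le_trans (ylip _ _ j0 jt _)); first exact: le_trans tj jT.
      by rewrite KN// -nodeS.
    have tB : `|(y t').2| <= B.
      rewrite -(subrK (y (node T N j)).2 (y t').2) (le_trans (ler_normD _ _))//.
      by rewrite -(subrKC 1 B) lerD// ?(le_trans dj)// S_ball.
    by split=> //; exact: near_ge0 (ddh _ _ (SB hj) tB dj) hj.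
  rewrite in_itv/= => /andP[t0 tT]; have [tj|jt] := leP t (node T N j.+1).
    have [tj'|jt'] := leP t (node T N j); last by exact: near_j (ltW jt') tj.
    have ht : 0 <= h (y t).2 by rewrite yc// c1S// in_itv/= t0.
    by split; [exact: SB|rewrite (le_trans _ ht)// oppr_le0 ltW].
  have [n1 n2] := near_j _ jj (lexx _).
  apply: (inv alpha e eta (node T N j.+1) T y al0 eta0 etac Ce jT) => //.
    by apply: abs_continuousS (lipschitz_curve_abs_continuous ylip) => //; exact: node_ge0.
  by rewrite in_itv/= (ltW jt).
exists (node T N j), (node T N j.+1), y; split=> //.
- by split=> //; rewrite nodeS addrAC subrr add0r (le_trans Ndd).
- split=> //; have [i iN Di] := node_max_attained T N D N y.
  exists (node T N i); first by rewrite in_itv/= node_ge0// node_leT.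
  by rewrite -[d _]/(D _) Di c'nm.
- move=> t tI; split; last by have [] := yS _ tI.
  move: tI; rewrite in_itv/= => /andP[t0 tT].
  have [i iN [it ti]] := node_before N0 t0 tT.
  have ipos : 0 <= node T N i by exact: node_ge0.
  have h1 : D (y (node T N i)) <= th by rewrite -c'nm node_max_ge.
  have h2 : `|D (y t) - D (y (node T N i))| <= rho / 4.
    rewrite (le_trans (D_lip _ _))// (le_trans _ ddr)//.
    by rewrite (le_trans (ylip _ _ (ipos) it tT))// KN.
  exact: quarter_le h2 h1 (ltW rho0).
case: c1alt => Ec1; first by left=> t tj; rewrite yc// Ec1.
(* If node [j] came after [tb], the curve would agree with the escaping one at node [i0], where the
   level is exceeded. *)
right; have jtb : node T N j <= tb.
  rewrite leNgt; apply/negP => tbj.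
  have : D (y (node T N i0)) <= th by rewrite -c'nm node_max_ge.
  rewrite yc; first by rewrite Ec1 leNgt Dtb.
  exact: le_trans i0tb (ltW tbj).
apply: lebesgue_aeS (lebesgue_aeI papp (ae_neq (node T N j))) => t [H tj].
rewrite in_itv/= => /andP[t0 tj'].
have tlt : t < node T N j by rewrite lt_neqAle tj.
have [|dpsi' Hpsi] := H; first by rewrite in_itv/= t0 (le_trans tj').
have ypsi u : u <= node T N j -> y u = psi u.
  by move=> uj; rewrite yc// Ec1 /cp min_l// (le_trans uj).
have tt1 : t - 1 < t by rewrite ltrBlDr ltrDl.
have [dy Ey] := derivable_eq_itv (fun u _ => ypsi u) tt1 tlt dpsi'.
have Eyt := ypsi t tj'.
by split; [exact: dy|rewrite Ey Eyt; exact: Hpsi].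
Qed.

(** Let [tau] be the limit of the [s k]. After [tau] the limit curve comes from approximate
    solutions. Before [tau] the ultrafilter decides which alternative prevails: the limit equals
    [phi0], or it comes from exact solutions of the field. *)
Lemma chain_limit (U : set_system nat) (al ek etak s s' : nat -> R) (y : nat -> R -> V) :
  UltraFilter U -> \oo `<=` U ->
  (forall A, \forall k \near U, A <= al k) ->
  (forall e, 0 < e -> \forall k \near U, ek k <= e) ->
  (forall e, 0 < e -> \forall k \near U, etak k <= e) ->
  (forall k, [/\ 0 <= s k, s k <= s' k, s' k <= T & s' k - s k <= ek k]) ->
  (forall k, lipschitz_curve 0 T K (y k)) -> (forall k, y k 0 = p0) ->
  (forall k t, t \in `[0, T] -> d (y k t).1 <= rho /\ - etak k <= h (y k t).2) ->
  (forall k, approx_solution (al k) (ek k) (s' k) T (y k)) ->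
  (forall k, (forall t, t <= s k -> y k t = phi0 t) \/
             approx_solution (al k) 0 0 (s k) (y k)) ->
  exists2 z, solution (pds h P f g) T p0 z &
    forall e, 0 < e -> \forall k \near U, forall t, t \in `[0, T] -> `|y k t - z t| <= e.
Proof.
move=> UU Uoo alU ekU etaU ss ylip y0 yin yafter ybefore.
have PU : ProperFilter U by exact: ultra_proper.
have [z hz] := ultra_limit_curve (J := [set t | t \in `[0, T]]) UU
  (@compact_cball_pair R m n (`|p0| + K * (T - 0)) (`|p0| + K * (T - 0)))
  (fun k t tI => lipschitz_curve_ball (ylip k) (y0 k) tI).
have ylipU : \forall k \near U, lipschitz_curve 0 T K (y k) by exact: nearW.
have zlip : lipschitz_curve 0 T K z by exact: limit_lipschitz_curve ylipU hz.
have z0 : z 0 = p0.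
  have T0I : 0 \in `[0, T] by rewrite in_itv/= lexx ltW.
  apply/eqP; rewrite -subr_eq0 -normr_le0; apply/ler_addgt0Pr => e e0; rewrite add0r.
  have /filter_ex[k] := hz 0 e T0I e0.
  by rewrite y0 distrC.
have zd t : t \in `[0, T] -> d (z t).1 <= rho.
  move=> tI; apply/ler_addgt0Pr => e e0.
  have /filter_ex[k yz] := hz t e tI e0.
  have [ydr _] := yin k t tI; exact: near_le (le_trans (D_lip (y k t) (z t)) yz) ydr.
have zh t : t \in `[0, T] -> 0 <= h (z t).2.
  move=> tI; apply/ler_addgt0Pl => e e0.
  have e2 : 0 < e / 2 by rewrite divr_gt0.
  have [w w0 hw] := continuous_dist_le (z t).2 (C1_continuous h_C1) e2.
  have w2 : 0 < w / 2 by rewrite divr_gt0.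
  have [k [yz ek2]] := filter_ex (filterI (hz t (w / 2) tI w2) (etaU _ e2)).
  have [_ yh] := yin k t tI.
  have /hw h1 : `|(y k t).2 - (z t).2| < w.
    apply: le_lt_trans (norm_snd_le (y k t - z t)) _.
    by rewrite (le_lt_trans yz)// ltr_pdivrMr// ltr_pMr// ltr1n.
  exact: half_ge0 h1 yh ek2.
have sI k : [set x | x \in `[0, T]] (s k).
  by have [s0 ss1 s1 _] := ss k; rewrite /= in_itv/= s0 (le_trans ss1).
have [tau _ stau] := ultra_compact_cvg UU (@segment_compact R 0 T) sI.
have ssU e : 0 < e -> \forall k \near U, tau - e < s k /\ s' k < tau + e.
  move=> e0; have e2 : 0 < e / 2 by rewrite divr_gt0.
  have := stau => /cvgrPdist_lt/(_ _ e2) H1.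
  apply: filterS (filterI H1 (ekU _ e2)) => k [/ltr_normlP[h1 h2] h3].
  by have [_ _ _ h4] := ss k; split; lra.
exists z; last by move=> e e0; apply: lipschitz_unif_near ylipU hz e0.
have [_ _ phi0ae] := phi0_sol.
split; [exact: lipschitz_curve_abs_continuous zlip|exact: z0|].
apply: lebesgue_aeS (lebesgue_aeI (lebesgue_aeI (lipschitz_curve_derivable zlip) phi0ae)
  (lebesgue_aeI (ae_neq 0) (lebesgue_aeI (ae_neq T) (ae_neq tau))))
  => t [[dz dphi] [t0 [tT ttau]]] tI.
have [t0' tT'] : 0 <= t /\ t <= T by move: tI; rewrite in_itv/= => /andP.
have t0l : 0 < t by rewrite lt_neqAle eq_sym t0.
have tTl : t < T by rewrite lt_neqAle tT.
have {}dz : derivable z t 1 by apply: dz; rewrite in_itv/= t0l.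
have zB1 : `|(z t).1| < B by apply: d_ball; exact: zd.
have zB2 : `|(z t).2| < B by have := S_ball (zh t tI); lra.
move: ttau; rewrite neq_lt => /orP[ttau|taut].
  pose b := Num.min T ((t + tau) / 2).
  have tb : t < b by rewrite lt_min tTl/=; lra.
  have bT : b <= T by rewrite ge_min lexx.
  have btau : 0 < tau - b by rewrite subr_gt0 gt_min; apply/orP; right; lra.
  have bI u : u \in `[0, b] -> u \in `[0, T].
    by rewrite !in_itv/= => /andP[-> /le_trans->].
  have sb : \forall k \near U, b <= s k.
    by apply: filterS (ssU _ btau) => k [h1 _]; rewrite opprB addrCA subrr addr0 in h1; exact: ltW.
  have [UA|UA] := in_ultra_setVsetC [set k | approx_solution (al k) 0 0 (s k) (y k)] UU.
    split=> //.
    apply: (barrier_limit_pds h_C1 h_lip P_posdef f_cont g_cont B0 c0 M0 lieD_le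
      (F := U) (a := 0) (b := b) (K := K) (y := y) (al := al) (eps := fun=> 0)) => //.
    - by apply: nearW => k; apply: lipschitz_curveS (ylip k).
    - by apply: filterS2 UA sb => k Hk bk; apply: approx_solutionS Hk.
    - by move=> e e0; apply: nearW => k; exact: ltW.
    - by move=> u e /bI; exact: hz.
    - by move=> u /bI; exact: zh.
  have zphi u : u \in `[0, b] -> z u = phi0 u.
    move=> uI; apply/eqP; rewrite -subr_eq0 -normr_le0; apply/ler_addgt0Pr => e e0.
    rewrite add0r; have [k [[nA bk] yz]] := filter_ex (filterI (filterI UA sb) (hz u e (bI _ uI) e0)).
    have [yphi|/nA//] := ybefore k.
    by rewrite distrC -yphi//; move: uI; rewrite in_itv/= => /andP[_ /le_trans->].
  have [dphi0 Hphi0] := dphi tI.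
  have tIb : t \in `[0, b] by rewrite in_itv/= t0' ltW.
  have zphi' u : 0 <= u -> u <= b -> z u = phi0 u.
    by move=> u0 ub; apply: zphi; rewrite in_itv/= u0.
  have [_ Ez] := derivable_eq_itv zphi' t0l tb dphi0.
  have Ezt := zphi t tIb.
  by split; [exact: dz|rewrite Ezt Ez; exact: Hphi0].
pose a := Num.max 0 ((t + tau) / 2).
have ta : a < t by rewrite gt_max t0l/=; lra.
have a0 : 0 <= a by rewrite le_max lexx.
have atau : 0 < a - tau by rewrite subr_gt0 lt_max; apply/orP; right; lra.
have aI u : u \in `[a, T] -> u \in `[0, T].
  by rewrite !in_itv/= => /andP[/(le_trans a0)-> ->].
split=> //.
apply: (barrier_limit_pds h_C1 h_lip P_posdef f_cont g_cont B0 c0 M0 lieD_le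
  (F := U) (a := a) (b := T) (K := K) (y := y) (al := al) (eps := ek)) => //.
- by apply: nearW => k; apply: lipschitz_curveS (ylip k).
- apply: filterS (ssU _ atau) => k [_ h1]; rewrite addrCA subrr addr0 in h1.
  by apply: approx_solutionS (yafter k) => //; exact: ltW.
- by move=> u e /aI; exact: hz.
- by move=> u /aI; exact: zh.
Qed.

Lemma no_escape : exists A, forall alpha, A <= alpha -> ~ escapes alpha.
Proof.
have [C C0 hC] := escape_chain.
apply: contrapT => /forallNP H.
have {H} bad (k : nat) : exists2 alpha, k.+1%:R <= alpha & escapes alpha.
  have /existsNP[alpha] := H k.+1%:R.
  by move=> /not_implyP[? /contrapT ?]; exists alpha.
have {}bad (k : nat) : exists alpha, k.+1%:R <= alpha /\ escapes alpha.
  by have [alpha ? ?] := bad k; exists alpha.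
have [al al_] := choice bad.
have alk k := (al_ k).1; have albad k := (al_ k).2.
(* As [al k >= k.+1], the product [al k * etak k] is at least [c / 2]; with [kap] the error
   [C * ek k] is at most [Num.min 1 (c / 2)], as the chain requires. *)
pose kap := Num.min 1 (c / 2) / C.
have kap0 : 0 < kap by rewrite divr_gt0// lt_min ltr01 divr_gt0.
pose ek (k : nat) := kap / k.+1%:R.
pose etak (k : nat) := (c / 2) / k.+1%:R.
have kS (k : nat) : 0 < k.+1%:R :> R by [].
have small (x : R) : 0 < x -> forall e, 0 < e -> \forall k \near \oo, x / k.+1%:R <= e.
  move=> x0 e e0; have ex : 0 < e / x by rewrite divr_gt0.
  have := @cvg_harmonic R => /cvgrPdist_le/(_ _ ex).
  apply: filterS => k; rewrite sub0r normrN ger0_norm /harmonic/= ?invr_ge0//.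
  by rewrite ler_pdivlMr// mulrC.
have chain k := hC (al k) (ek k) (etak k).
have chain1 k : exists q : R * R * (R -> V), let s := q.1.1 in let s' := q.1.2 in let y := q.2 in
  [/\ [/\ 0 <= s, s <= s', s' <= T & s' - s <= ek k],
      [/\ lipschitz_curve 0 T K y, y 0 = p0 & exists2 t, t \in `[0, T] & d (y t).1 = rho / 2],
      forall t, t \in `[0, T] -> d (y t).1 <= rho /\ - etak k <= h (y t).2,
      approx_solution (al k) (ek k) s' T y &
      (forall t, t <= s -> y t = phi0 t) \/ approx_solution (al k) 0 0 s y].
  have [||||||s [s' [y H]]] := chain k.
  - exact: lt_le_trans (alk k).
  - by rewrite divr_gt0.
  - by rewrite !divr_gt0.
  - rewrite (@le_lt_trans _ _ (c / 2))//; last by rewrite ltr_pdivrMr// ltr_pMr// ltr1n.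
    by rewrite ler_pdivrMr// ler_pMr ?divr_gt0// ler1n.
  - rewrite /ek /kap mulrA mulrCA divff ?gt_eqF// mulr1.
    have m0 : 0 <= Num.min 1 (c / 2) by rewrite le_min ler01 divr_ge0// ltW.
    rewrite (@le_trans _ _ (Num.min 1 (c / 2)))//.
      by rewrite ler_pdivrMr// ler_peMr// ler1n.
    rewrite le_min !ge_min lexx/=; apply/orP; right.
    by rewrite /etak mulrCA ler_peMr ?divr_ge0 ?(ltW c0)// ler_pdivlMr// mul1r.
  - exact: albad.
  by exists (s, s', y).
have [q Hq] := choice chain1.
have [U [UU Uoo]] := ultraFilterLemma (_ : ProperFilter \oo).
have PU : ProperFilter U by exact: ultra_proper.
have [|||||||||z zsol zy] := @chain_limit U al ek etak (fun k => (q k).1.1)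
  (fun k => (q k).1.2) (fun k => (q k).2) UU Uoo.
- move=> A; apply: Uoo; near=> k; rewrite (le_trans _ (alk k))//.
  rewrite (@le_trans _ _ k%:R) ?ler_nat//; near: k; exact: nbhs_infty_ger.
- by move=> e e0; apply: Uoo; exact: small.
- by move=> e e0; apply: Uoo; apply: small => //; rewrite divr_gt0.
- by move=> k; have [] := Hq k.
- by move=> k; have [_ []] := Hq k.
- by move=> k; have [_ []] := Hq k.
- by move=> k t tI; have [_ _ /(_ t tI)] := Hq k.
- by move=> k; have [] := Hq k.
- by move=> k; have [] := Hq k.
have r4 : 0 < rho / 4 by rewrite divr_gt0.
have /filter_ex[k /= Hk] := zy _ r4.
have [_ [_ _ [t tI dt]] _ _ _] := Hq k.
(* [d] is [rho / 2] on the approximating curve and 0 on the limit, although the two are within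
   [rho / 4]. *)
have [Zz _] := pds_inv zsol tI.
have := le_trans (D_lip _ _) (Hk t tI).
by rewrite /D dt d_eq0// subr0 => /half_quarter; rewrite rho0.
Unshelve. all: by end_near. Qed.

Let d_p0 : d p0.1 = 0.
Proof.
have [_ phi00 _] := phi0_sol; have [|Zp _] := pds_inv phi0_sol (t := 0).
  by rewrite in_itv/= lexx ltW.
by rewrite -phi00 d_eq0.
Qed.

(** The curve need only follow the field as long as it is within [rho] of Z', since a first exit
    would be an escape. This avoids circularity for CBF solutions, for which agreement with the
    field is known only there. *)
Lemma confined alpha psi : ~ escapes alpha -> abs_continuous 0 T psi -> psi 0 = p0 ->
  (forall tb, 0 <= tb <= T -> (forall t, t \in `[0, tb] -> d (psi t).1 <= rho) ->
     lipschitz_curve 0 tb K psi /\ approx_solution alpha 0 0 tb psi) ->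
  forall t, t \in `[0, T] -> d (psi t).1 < rho.
Proof.
move=> noesc ac psi0 H t; rewrite in_itv/= => /andP[t0 tT].
rewrite ltNge; apply/negP => ge.
(* In reversed time the last crossing of the level [rho] becomes the first exit of [psi]. *)
pose F u := D (psi (t - u)).
have F0 : rho <= F 0 by rewrite /F subr0.
have Ft : F t < rho by rewrite /F subrr psi0 /D d_p0.
have Fc s e : 0 <= s -> s <= t -> 0 < e ->
     exists2 w, 0 < w & forall u, 0 <= u -> u <= t -> `|u - s| < w -> `|F u - F s| < e.
  move=> s0 st e0.
  have [||w w0 hw] := abs_continuous_cts (t := t - s) ac _ _ e0.
  - by rewrite subr_ge0.
  - by rewrite lerBlDr (le_trans tT)// lerDl.
  exists w => // u u0 ut us; rewrite (le_lt_trans (D_lip _ _))// hw ?subr_ge0//.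
    by rewrite lerBlDr (le_trans tT)// lerDl.
  by rewrite (_ : t - u - (t - s) = - (u - s)) ?normrN//; ring.
have [u [u0 ut Fu Flt]] := last_crossing t0 F0 Ft Fc.
apply: noesc; exists (t - u), psi.
have tbI : 0 <= t - u <= T.
  by rewrite subr_ge0 (ltW ut) lerBlDr (le_trans tT)// lerDl.
have [||psilip psiapp] := H (t - u) => //.
move=> s; rewrite in_itv/= => /andP[s0 su].
have us : u <= t - s by rewrite lerBrDr addrC -lerBrDr.
have Fs : F (t - s) = d (psi s).1 by rewrite /F subKr.
rewrite -Fs; move: us; rewrite le_eqVlt => /orP[/eqP <-|us]; first by rewrite Fu.
by apply/ltW/Flt => //; rewrite lerBlDr lerDl.
Qed.

Lemma cbf_confined alpha psi : 0 < alpha -> M / c <= alpha -> ~ escapes alpha ->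
  solution (cbf h P f g alpha) T p0 psi ->
  [/\ lipschitz_curve 0 T K psi, approx_solution alpha 0 0 T psi &
    forall t, t \in `[0, T] -> d (psi t).1 <= rho /\ 0 <= h (psi t).2].
Proof.
move=> al0 Mc noesc [ac psi0 psiae].
have hS t : t \in `[0, T] -> 0 <= h (psi t).2.
  by apply: (cbf_invariance al0 (ltW T0) ac psiae); rewrite psi0.
have step tb : 0 <= tb <= T -> (forall t, t \in `[0, tb] -> d (psi t).1 <= rho) ->
     lipschitz_curve 0 tb K psi /\ approx_solution alpha 0 0 tb psi.
  move=> /andP[tb0 tbT] dpsi.
  have sub t : t \in `[0, tb] -> t \in `[0, T].
    by rewrite !in_itv/= => /andP[-> /le_trans->].
  have app : {ae @lebesgue_measure R, forall t, t \in `[0, tb] ->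
      derivable psi t 1 /\ derive1 psi t = field alpha (psi t)}.
    apply: lebesgue_aeS psiae => t H tI; have [dpsi' ->] := H (sub t tI).
    split; first exact: dpsi'.
    apply/esym/barrier_field_cbf => //.
    - exact/ltW/d_ball/dpsi.
    - exact/SB/hS/sub.
    - exact/hS/sub.
  split.
    apply: ac_lipschitz; first exact: abs_continuousS ac.
    by apply: lebesgue_aeS app => t H /H[? ->]; split.
  by apply: lebesgue_aeS app => t H /H[? ->]; rewrite subrr normr0.
have conf := confined noesc ac psi0 step.
have [||lipT appT] := step T; rewrite ?lexx ?(ltW T0)//.
  by move=> t /conf/ltW.
by split=> // t tI; split; [exact/ltW/conf|exact: hS].
Qed.

(** A Peano solution of the barrier field is confined to the region where the barrier field and the
    CBF field agree. *)
Lemma cbf_exists alpha : 0 < alpha -> M / c <= alpha -> ~ escapes alpha ->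
  exists psi, solution (cbf h P f g alpha) T p0 psi.
Proof.
move=> al0 Mc noesc; have [psi [plip psi0 papp]] := field_solution_exists alpha p0.
have ac := lipschitz_curve_abs_continuous plip.
have hS t : t \in `[0, T] -> 0 <= h (psi t).2.
  by apply: (field_invariance al0 (ltW T0) ac papp); rewrite psi0.
have conf : forall t, t \in `[0, T] -> d (psi t).1 < rho.
  apply: (confined noesc ac psi0) => tb /andP[tb0 tbT] _; split.
    exact: lipschitz_curveS plip.
  exact: approx_solutionS papp.
exists psi; split; [exact: ac|exact: psi0|].
apply: lebesgue_aeS papp => t H tI; have [dpsi E] := H tI.
split; first exact: dpsi.
rewrite /cbf/= (_ : (_, _) = field alpha (psi t)).
  by apply/eqP; rewrite -subr_eq0 -normr_le0.
apply/esym/barrier_field_cbf => //.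
- exact/ltW/d_ball/ltW/conf.
- exact/SB/hS.
- exact: hS.
Qed.

(** A degenerate chain: [s = s' = 0] and all errors are zero, so only the part after the cell
    remains. *)
Lemma cbf_limit (U : set_system nat) (al : nat -> R) (psi : nat -> R -> V) :
  UltraFilter U -> \oo `<=` U -> (forall A, \forall k \near U, A <= al k) ->
  (forall k, [/\ 0 < al k, M / c <= al k & ~ escapes (al k)]) ->
  (forall k, solution (cbf h P f g (al k)) T p0 (psi k)) ->
  exists2 z, solution (pds h P f g) T p0 z &
    forall e, 0 < e -> \forall k \near U, forall t, t \in `[0, T] -> `|psi k t - z t| <= e.
Proof.
move=> UU Uoo alU alk psik.
have PU : ProperFilter U by exact: ultra_proper.
have conf k : [/\ lipschitz_curve 0 T K (psi k), approx_solution (al k) 0 0 T (psi k) &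
    forall t, t \in `[0, T] -> d (psi k t).1 <= rho /\ 0 <= h (psi k t).2].
  by have [k1 k2 k3] := alk k; exact: (cbf_confined k1 k2 k3 (psik k)).
apply: (@chain_limit U al (fun=> 0) (fun=> 0) (fun=> 0) (fun=> 0) psi) => //.
- by move=> e e0; apply: nearW => k; exact: ltW.
- by move=> e e0; apply: nearW => k; exact: ltW.
- by move=> k; rewrite subrr !lexx (ltW T0).
- by move=> k; have [] := conf k.
- by move=> k; have [] := psik k.
- by move=> k t tI; rewrite oppr0; have [_ _ /(_ t tI)] := conf k.
- by move=> k; have [] := conf k.
- move=> k; right; have [_ H _] := conf k; exact: approx_solutionS (lexx _) (ltW T0) H.
Qed.

End Tracking.

(** * Uniqueness for the projected system *)

Lemma derivable_dot (R : realType) n (x y : R -> 'cV[R]_n) t :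
  derivable x t 1 -> derivable y t 1 ->
  derivable (fun s => dot (x s) (y s)) t 1 /\
  derive1 (fun s => dot (x s) (y s)) t = dot (derive1 x t) (y t) + dot (x t) (derive1 y t).
Proof.
move=> dx dy.
have cty : y (k *: 1 + t) @[k --> 0^'] --> y t.
  have dy' : differentiable y t by exact/derivable1_diffP.
  have cy' := differentiable_continuous dy'.
  apply/cvgrPdist_lt => e e0; have /cvgrPdist_lt/(_ e e0)[w /= w0 hw] := cy'.
  exists w => //= k; rewrite /ball_/= sub0r normrN => kw _; apply: hw => /=.
  by rewrite opprD addrCA subrr addr0 normrN normrZ normr1 mulr1.
have lim : (fun k => k^-1 *: (dot (x (k *: 1 + t)) (y (k *: 1 + t)) - dot (x t) (y t))) @ 0^'
   --> dot (derive1 x t) (y t) + dot (x t) (derive1 y t).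
  rewrite (_ : (fun k => _) = (fun k => dot (k^-1 *: (x (k *: 1 + t) - x t)) (y (k *: 1 + t)) +
      dot (x t) (k^-1 *: (y (k *: 1 + t) - y t)))); last first.
    apply/funext => k; rewrite dotZl dotZr -mulrDr dotBl dotBr.
    by congr (_ * _); ring.
  have dx' : (fun k => k^-1 *: (x (k *: 1 + t) - x t)) @ 0^' --> derive1 x t.
    by rewrite derive1E; exact: dx.
  have dy' : (fun k => k^-1 *: (y (k *: 1 + t) - y t)) @ 0^' --> derive1 y t.
    by rewrite derive1E; exact: dy.
  exact: cvgD (cvg_dot dx' cty) (cvg_dot (cvg_cst (x t)) dy').
split; first by apply/cvg_ex; eexists; exact: lim.
by rewrite derive1E; apply: cvg_lim lim.
Qed.

Lemma gronwall_eq0 (R : realType) (E : R -> R) T k L N : 0 <= T -> 0 <= k ->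
  lipschitz_curve 0 T L E -> (forall t, t \in `[0, T] -> 0 <= E t <= N) -> E 0 = 0 ->
  {ae @lebesgue_measure R, forall t, t \in `[0, T] ->
    derivable E t 1 /\ derive1 E t <= k * E t} ->
  E T = 0.
Proof.
move=> T0 k0 Elip E0 Ei Eae.
pose F t := - (E t * expR (- (k * t))).
have e1 t : 0 <= t -> expR (- (k * t)) <= 1.
  by move=> t0; rewrite -expR0 ler_expR oppr_le0 mulr_ge0.
have elip u v : 0 <= u -> u <= v -> `|expR (- (k * v)) - expR (- (k * u))| <= k * (v - u).
  move=> u0 uv; have -> : - (k * v) = - (k * u) + - (k * (v - u)) by ring.
  rewrite expRD -{2}[expR (- (k * u))]mulr1 -mulrBr normrM ger0_norm ?expR_ge0//.
  have kv : 0 <= k * (v - u) by rewrite mulr_ge0// subr_ge0.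
  rewrite -[leRHS]mul1r ler_pM ?expR_ge0// ?e1//.
  rewrite distrC ger0_norm ?subr_ge0 -?expR0 ?ler_expR ?oppr_le0//.
  by have := expR_ge1Dx (- (k * (v - u))); rewrite expR0; lra.
have Flip : lipschitz_curve 0 T (L + N * k) F.
  move=> u v u0 uv vT; have v0 := le_trans u0 uv.
  have uI : u \in `[0, T] by rewrite in_itv/= u0 (le_trans uv).
  rewrite /F -opprD normrN.
  have -> : E v * expR (- (k * v)) - E u * expR (- (k * u)) =
     (E v - E u) * expR (- (k * v)) + E u * (expR (- (k * v)) - expR (- (k * u))) by ring.
  rewrite (le_trans (ler_normD _ _))// [leRHS]mulrDl lerD// normrM.
    rewrite -[leRHS]mulr1 ler_pM ?Elip//.
    by rewrite ger0_norm ?expR_ge0// e1.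
  have /andP[Eu0 EuN] := E0 u uI.
  by rewrite -mulrA ler_pM ?elip// ger0_norm.
have FF : F 0 <= F T.
  apply: (ac_nondecreasing T0 (lipschitz_curve_abs_continuous Flip) ler01).
    by move=> u v _ _ _; rewrite mul1r.
  apply: lebesgue_aeS Eae => t H tI; have [dE E'] := H tI.
  have iE : is_derive t 1 E (derive1 E t) by rewrite derive1E; exact: DeriveDef.
  have ik : is_derive t 1 (fun s => - (k * s)) (- k).
    have : is_derive t 1 (- (k *: (id : R -> R))) (- (k *: (1 : R))).
      by apply: is_deriveN; apply: is_deriveZ.
    by rewrite /GRing.scale/= mulr1.
  have ie : is_derive t 1 (fun s => expR (- (k * s))) (expR (- (k * t)) * - k).
    exact: (is_derive1_comp (is_derive_expR _) ik).
  have iF : is_derive t 1 F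
     (- (E t *: (expR (- (k * t)) * - k) + expR (- (k * t)) *: derive1 E t)).
    exact: (is_deriveN (is_deriveM iE ie)).
  split; first by case: iF.
  rewrite derive1E (@derive_val _ _ _ _ _ _ _ iF).
  rewrite /GRing.scale/= mulrCA -mulrDr -mulrN mulr_ge0 ?expR_ge0//.
  by move: E'; lra.
have : E T * expR (- (k * T)) <= 0.
  by move: FF; rewrite /F Ei mul0r oppr0 oppr_ge0.
have TI : T \in `[0, T] by rewrite in_itv/= T0 lexx.
rewrite pmulr_lle0 ?expR_gt0// => ET; have /andP[ET0 _] := E0 T TI.
by apply/eqP; rewrite eq_le ET ET0.
Qed.

Lemma derivable_mulmx (R : realType) n (A : 'M[R]_n) (x : R -> 'cV[R]_n) t :
  derivable x t 1 ->
  derivable (fun s => A *m x s) t 1 /\ derive1 (fun s => A *m x s) t = A *m derive1 x t.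
Proof.
move=> dx.
have dx' : (fun k => k^-1 *: (x (k *: 1 + t) - x t)) @ 0^' --> derive1 x t.
  by rewrite derive1E; exact: dx.
have lim : (fun k => k^-1 *: (A *m x (k *: 1 + t) - A *m x t)) @ 0^' --> A *m derive1 x t.
  rewrite (_ : (fun k => _) = (fun k => A *m (k^-1 *: (x (k *: 1 + t) - x t)))).
    exact: cvg_mulmx dx'.
  by apply/funext => k; rewrite -scalemxAr mulmxBr.
split; first by apply/cvg_ex; eexists; exact: lim.
by rewrite derive1E; apply: cvg_lim lim.
Qed.

Lemma derivable_sub (R : realType) (U : normedModType R) (x y : R -> U) t :
  derivable x t 1 -> derivable y t 1 ->
  derivable (fun s => x s - y s) t 1 /\
  derive1 (fun s => x s - y s) t = derive1 x t - derive1 y t.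
Proof. by move=> dx dy; split; [exact: derivableB|rewrite !derive1E; exact: deriveB]. Qed.

Lemma norm_sqr_le_dot (R : realType) n (v : 'cV[R]_n) : `|v| ^+ 2 <= dot v v.
Proof.
have : `|v| <= Num.sqrt (dot v v).
  apply: norm_le_entries => [|i]; first exact: sqrtr_ge0.
  by rewrite -sqrtr_sqr ler_sqrt ?dot_ge0// dot_sqr_entry.
move=> H; rewrite -(sqr_sqrtr (dot_ge0 v)) lerXn2r ?nnegrE ?sqrtr_ge0//.
Qed.

Lemma norm_pair_sqr_le (R : realType) (U W : normedModType R) (p : U * W) :
  `|p| ^+ 2 <= `|p.1| ^+ 2 + `|p.2| ^+ 2.
Proof.
have [le|/ltW le] := leP `|p.1| `|p.2|.
  by rewrite ler_wpDl ?exprn_ge0// lerXn2r ?nnegrE// norm_pair_le.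
by rewrite ler_wpDr ?exprn_ge0// lerXn2r ?nnegrE// norm_pair_le.
Qed.

Lemma opp_le_of (R : realType) (a x b : R) : 0 <= a + x -> x <= b -> - b <= a.
Proof. by lra. Qed.

Lemma opp_le_slack (R : realType) (a b d e : R) : b <= e -> - (a + b) <= d -> - a <= d + e.
Proof. by lra. Qed.

Lemma dot_diff (R : realType) n (a b : 'cV[R]_n) :
  dot a a - dot b b = dot (a - b) (a + b).
Proof. by rewrite !dotBl !dotDr [dot b a]dotC; ring. Qed.

Lemma double_le (R : realType) (a b c : R) : a + b <= c -> a + a + (b + b) <= 2 * c.
Proof. by lra. Qed.

Lemma subr_cross (U : zmodType) (a b c d : U) : a - b - (c - d) = a - c - (b - d).
Proof. by rewrite !opprB addrACA [RHS]addrACA [- c - b]addrC. Qed.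

Lemma four_le (R : realType) (t1 t2 t3 t4 a b c : R) : t1 <= a -> t2 <= b -> - t3 <= b ->
  t4 <= c -> t1 + (t2 + t4 - t3) <= a + b + b + c.
Proof. by lra. Qed.

Section Comparison.
Variables (R : realType) (n : nat) (P : 'M[R]_n).
Hypothesis P_posdef : sym_posdef P.

Lemma posdef_lower : exists2 l, 0 < l & forall v : 'cV[R]_n, l * `|v| ^+ 2 <= dot v (P *m v).
Proof.
(* The added term keeps [F] positive at the origin and vanishes on the unit sphere, so a minimum
   over the ball does the work of one over the sphere. *)
pose F (v : 'cV[R]_n) := dot v (P *m v) + (1 - `|v|).
have Fc : continuous F.
  apply: continuous_add.
    apply: (@continuous_dot _ _ _ id); [|apply: (@continuous_mulmx _ _ _ _ id)];
      by move=> ?; exact: cvg_id.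
  apply: continuous_add; first exact: cst_continuous.
  by apply: continuous_opp; apply: (@continuous_norm _ _ _ id); move=> ?; exact: cvg_id.
have [v vB|l l0 hl] := compact_pos_lower (@compact_cball R n 1) Fc.
  have [->|v0] := eqVneq v 0; first by rewrite /F dot0l normr0 subr0 add0r.
  by rewrite /F ltr_wpDr ?subr_ge0// pform_gt0.
exists l => // v; have [->|v0] := eqVneq v 0.
  by rewrite dot0l normr0 expr0n mulr0.
have nv : 0 < `|v| by rewrite normr_gt0.
have := hl (`|v|^-1 *: v); rewrite /F/= normrZ ger0_norm ?invr_ge0// mulVf ?gt_eqF//.
move=> /(_ (lexx _)); rewrite subrr addr0 -scalemxAr dotZl dotZr mulrA -expr2 exprVn.
by rewrite mulrC -ler_pdivrMr ?invr_gt0 ?exprn_gt0// invrK.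
Qed.

Lemma pform_diff (a b : 'cV[R]_n) :
  dot a (P *m a) - dot b (P *m b) = dot (a - b) (P *m (a + b)).
Proof. by rewrite mulmxDr !dotBl !dotDr [dot b (P *m a)]pform_sym//; ring. Qed.

Lemma tangent_cone0 (A : set 'cV[R]_n) x : A x -> tangent_cone A x 0.
Proof.
move=> Ax; exists (fun=> x), (fun k => k.+1%:R^-1); split=> //.
- exact: cvg_cst.
- exact: cvg_harmonic.
- rewrite (_ : (fun k => _) = fun=> 0); first exact: cvg_cst.
  by apply/funext => k; rewrite subrr scaler0.
Qed.

Variables (m : nat) (h : 'cV[R]_n -> R) (f : 'cV[R]_m * 'cV[R]_n -> 'cV[R]_n)
  (g : 'cV[R]_m * 'cV[R]_n -> 'cV[R]_m) (B : R).
Local Notation V := ('cV[R]_m * 'cV[R]_n)%type.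
Hypotheses (h_C1 : C1 h) (h_lip : locally_lipschitz (grad h)) (f_cont : continuous f)
  (g_cont : continuous g) (S_ball : forall x, 0 <= h x -> `|x| <= B).

(** Zero is tangent at every point of S, so the P-distance from the velocity to [f p] is at most the
    P-norm of [f p]. *)
Lemma pds_velocity_bound : exists2 C, 0 < C & forall p v : V, `|p.1| <= B ->
  pds h P f g p v -> `|v| <= C /\ `|v.2 - f p| <= C.
Proof.
have [l l0 hl] := posdef_lower.
have cK := @compact_cball_pair R m n B B.
have [Cf Cf0 hf] := continuous_compact_bounded cK f_cont.
have [Cg Cg0 hg] := continuous_compact_bounded cK g_cont.
have q_cont : continuous (fun p => dot (f p) (P *m f p)).
  by apply: continuous_dot; [|apply: continuous_mulmx]; exact: f_cont.
have [Cq Cq0 hq] := continuous_compact_bounded cK q_cont.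
pose r := Cq / l + 1.
have r1 : 1 <= r by rewrite lerDr divr_ge0// ltW.
have r0 : 0 < r by exact: lt_le_trans r1.
exists (r + Cf + Cg); first by rewrite addr_gt0// addr_gt0.
move=> p v pB [pS v1 [_ vmin]].
have pK : `|p.1| <= B /\ `|p.2| <= B by split=> //; exact: S_ball.
have vf : `|v.2 - f p| <= r.
  have := vmin 0 (tangent_cone0 pS); rewrite !pnorm_sqr// sub0r.
  rewrite mulmxN dotNl dotNr opprK => H.
  have H2 : l * `|v.2 - f p| ^+ 2 <= Cq.
    by rewrite (le_trans (hl _))// (le_trans H)// (le_trans (ler_norm _))// hq.
  rewrite leNgt; apply/negP => rv.
  have : r < `|v.2 - f p| ^+ 2.
    by rewrite expr2 (lt_le_trans rv)// ler_peMr// (le_trans r1)// ltW.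
  have : `|v.2 - f p| ^+ 2 <= Cq / l by rewrite ler_pdivlMr// mulrC.
  by rewrite /r; lra.
split; last by rewrite (le_trans vf)// -addrA lerDl addr_ge0// ltW.
apply: norm_pair_le.
  rewrite v1 (le_trans (hg _ pK))// lerDr addr_ge0 ?(ltW Cf0)//.
  by rewrite (le_trans ler01).
rewrite -(subrK (f p) v.2) (le_trans (ler_normD _ _))//.
rewrite -[leLHS]addr0 lerD ?(ltW Cg0)// lerD// hf//.
Qed.

(** [h] and its gradient have no common zero, and compactness makes this uniform; the gradient is
    then nondegenerate on a whole layer around the zero set of [h]. *)
Lemma grad_form_lower : (forall x, h x = 0 -> grad h x != 0) ->
  exists2 c, 0 < c & forall x, `|x| <= B -> c <= `|h x| + grad_form h P x.
Proof.
move=> grad_neq0.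
pose F x := `|h x| + grad_form h P x.
have Fc : continuous F.
  apply: continuous_add; last exact: grad_form_continuous.
  by apply: (@continuous_norm _ _ R^o h); apply: (C1_continuous h_C1).
have [x xB|c c0 hc] := compact_pos_lower (@compact_cball R n B) Fc.
  have [hx|hx] := eqVneq (h x) 0.
    by rewrite /F hx normr0 add0r invP_form_gt0// grad_neq0.
  rewrite /F ltr_wpDr ?normr_gt0// /grad_form.
  have [->|g0] := eqVneq (grad h x) 0; first by rewrite dot0l.
  by rewrite ltW// invP_form_gt0.
by exists c.
Qed.

(* One-sided regularity of the velocity of the projected system: [v - f p] lies
   in a proximal normal cone of the superlevel set, uniformly on compact sets. *)
Lemma pds_normal_ge : (forall x, h x = 0 -> grad h x != 0) ->
  exists2 C, 0 <= C & forall (p v : V) y, `|p.1| <= B -> 0 <= h y ->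
  pds h P f g p v -> - (C * `|y - p.2| ^+ 2) <= dot (P *m (y - p.2)) (v.2 - f p).
Proof.
move=> grad_neq0.
have [C C0 hC] := C11_taylor B h_C1 h_lip.
have [K K0 hK] := pds_velocity_bound.
have [G G0 hG] := continuous_compact_bounded (@compact_cball R n B) h_C1.2.
have [c c0 hc] := grad_form_lower grad_neq0.
have nGK : 0 <= n%:R * G * K by rewrite !mulr_ge0// ltW.
exists ((C / c) * (n%:R * G * K)).
  by rewrite mulr_ge0// divr_ge0// ltW.
move=> p v y pB hy vp; have [pS v1 vmin] := vp.
have [_ vfK] := hK p v pB vp.
have hp : 0 <= h p.2 by [].
have [hp0|hp0] := eqVneq (h p.2) 0; last first.
  have hpos : 0 < h p.2 by rewrite lt_neqAle eq_sym hp0.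
  have H : 0 <= dot (P *m (v.2 + (y - p.2) - v.2)) (v.2 - f p).
    apply: (variational_of_argmin P_posdef vmin) => s s0 s1.
    by apply: tangent_cone_strict => //; left.
  move: H; rewrite addrAC subrr add0r; apply: le_trans.
  by rewrite oppr_le0 mulr_ge0 ?exprn_ge0// mulr_ge0// divr_ge0// ltW.
set a := grad h p.2.
have qc : c <= dot a (invmx P *m a).
  by have := hc _ (S_ball hp); rewrite hp0 normr0 add0r.
have av : 0 <= dot a v.2 by have [vT _] := vmin; exact: tangent_cone_boundary vT.
have ay : - (C * `|y - p.2| ^+ 2) <= dot a (y - p.2).
  have := hC p.2 y (S_ball hp) (S_ball hy); rewrite hp0 subr0 => /ler_normlP[_ H].
  by move: H hy; rewrite -/a; move: (dot _ _) (h y) => u w; lra.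
have bound e : 0 < e ->
    - ((C / c * `|y - p.2| ^+ 2 + e) * (n%:R * G * K)) <=
    dot (P *m (y - p.2)) (v.2 - f p).
  move=> e0; pose k := C / c * `|y - p.2| ^+ 2 + e.
  have k0 : 0 <= k by rewrite addr_ge0 ?(ltW e0)// mulr_ge0 ?exprn_ge0// divr_ge0// ltW.
  (* By Taylor the chord points outwards by at most [C * |y - p.2| ^+ 2]. The shift by [k] along the
     inward normal overcompensates this, and [e] makes the direction strictly inward, hence
     tangent. *)
  pose w := y - p.2 + k *: (invmx P *m a).
  have aw : 0 < dot a w.
    have ck : C * `|y - p.2| ^+ 2 < k * c.
      rewrite mulrDl mulrAC divfK ?gt_eqF// ltrDl mulr_gt0//.
    rewrite dotDr dotZr -(addNr (C * `|y - p.2| ^+ 2)) ler_ltD//.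
    by rewrite (lt_le_trans ck)// ler_wpM2l.
  have H : 0 <= dot (P *m (v.2 + w - v.2)) (v.2 - f p).
    apply: (variational_of_argmin P_posdef vmin) => s s0 s1.
    apply: tangent_cone_strict => //; right.
    by rewrite -/a [v.2 + w]addrC addrK dotDr dotZr ltr_wpDl// mulr_gt0.
  move: H; rewrite addrAC subrr add0r /w mulmxDr dotDl -scalemxAr dotZl.
  rewrite mulmxA mulmxV ?posdef_unitmx// mul1mx => H.
  have D : `|dot a (v.2 - f p)| <= n%:R * G * K.
    by rewrite (le_trans (dot_le _ _))// ler_pM ?mulr_ge0// ler_wpM2l// hG//= S_ball.
  have kD : k * dot a (v.2 - f p) <= k * (n%:R * G * K).
    by rewrite ler_wpM2l// (le_trans (ler_norm _)).
  exact: opp_le_of H kD.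
apply/ler_addgt0Pr => e e0.
have nGK1 : 0 < n%:R * G * K + 1 by rewrite ltr_wpDl.
have e1 : 0 < e / (n%:R * G * K + 1) by rewrite divr_gt0.
have := bound _ e1; rewrite mulrDl.
have : e / (n%:R * G * K + 1) * (n%:R * G * K) <= e.
  by rewrite mulrAC ler_pdivrMr// ler_wpM2l ?(ltW e0)// lerDl.
rewrite [C / c * (n%:R * G * K) * _]mulrAC.
exact: opp_le_slack.
Qed.

Hypotheses (f_lip : locally_lipschitz f) (g_lip : locally_lipschitz g)
  (grad_neq0 : forall x, h x = 0 -> grad h x != 0).

(** The second components are paired through [P], the inner product of the normal inequality.
    Splitting off [f p - f q] leaves two normal terms, each costing [C], beside the Lipschitz terms
    of [f] and [g]. *)
Lemma pds_one_sided : exists2 C, 0 <= C & forall p q v w : V,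
  `|p.1| <= B -> `|q.1| <= B -> pds h P f g p v -> pds h P f g q w ->
  dot (p.1 - q.1) (v.1 - w.1) + dot (P *m (p.2 - q.2)) (v.2 - w.2) <= C * `|p - q| ^+ 2.
Proof.
have [C C0 hC] := pds_normal_ge grad_neq0.
have cK := @compact_cball_pair R m n B B.
have [Cf Cf0 hf] := locally_lipschitz_compact cK f_lip.
have [Cg Cg0 hg] := locally_lipschitz_compact cK g_lip.
have [CP CP0 hP] := mulmx_norm_le P.
exists (m%:R * Cg + C + C + n%:R * CP * Cf).
  by rewrite !addr_ge0// ?mulr_ge0// ltW.
move=> p q v w pB qB pv qw; have [pS v1 _] := pv; have [qS w1 _] := qw.
have pK : `|p.1| <= B /\ `|p.2| <= B by split=> //; exact: S_ball.
have qK : `|q.1| <= B /\ `|q.2| <= B by split=> //; exact: S_ball.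
set D := `|p - q|.
have D1 : `|p.1 - q.1| <= D by exact: (norm_fst_le (p - q)).
have D2 : `|p.2 - q.2| <= D by exact: (norm_snd_le (p - q)).
have D0 : 0 <= D by exact: normr_ge0.
have T1 : dot (p.1 - q.1) (v.1 - w.1) <= m%:R * Cg * D ^+ 2.
  rewrite v1 w1 (le_trans (ler_norm _))// (le_trans (dot_le _ _))//.
  rewrite (_ : m%:R * Cg * D ^+ 2 = m%:R * D * (Cg * D)); last by ring.
  by rewrite ler_pM ?mulr_ge0// ?ler_wpM2l// hg.
have sq y : `|y| <= D -> C * `|y : 'cV[R]_n| ^+ 2 <= C * D ^+ 2.
  by move=> yD; rewrite ler_wpM2l// lerXn2r ?nnegrE.
have T2 : dot (P *m (p.2 - q.2)) (v.2 - f p) <= C * D ^+ 2.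
  have := hC p v q.2 pB qS pv; rewrite -(opprB p.2 q.2) mulmxN dotNl lerN2 normrN.
  by move=> /le_trans; apply; exact: sq.
have T3 : - dot (P *m (p.2 - q.2)) (w.2 - f q) <= C * D ^+ 2.
  have := hC q w p.2 qB pS qw; rewrite lerNl => /le_trans; apply; exact: sq.
have T4 : dot (P *m (p.2 - q.2)) (f p - f q) <= n%:R * CP * Cf * D ^+ 2.
  rewrite (le_trans (ler_norm _))// (le_trans (dot_le _ _))//.
  rewrite (_ : n%:R * CP * Cf * D ^+ 2 = n%:R * (CP * D) * (Cf * D)); last by ring.
  rewrite ler_pM ?mulr_ge0// ?hf// ler_wpM2l// (le_trans (hP _))// ler_wpM2l//.
have -> : v.2 - w.2 = (v.2 - f p) + (f p - f q) - (w.2 - f q).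
  by rewrite addrA subrK opprB addrA subrK.
rewrite [dot (P *m _) (_ - _)]dotBr [dot (P *m _) (_ + _)]dotDr !mulrDl.
exact: four_le T1 T2 T3 T4.
Qed.

Lemma pds_unique T K (phi phi' : R -> V) : 0 <= T ->
  lipschitz_curve 0 T K phi -> lipschitz_curve 0 T K phi' -> phi 0 = phi' 0 ->
  (forall t, t \in `[0, T] -> `|(phi t).1| <= B /\ 0 <= h (phi t).2) ->
  (forall t, t \in `[0, T] -> `|(phi' t).1| <= B /\ 0 <= h (phi' t).2) ->
  {ae @lebesgue_measure R, forall t, t \in `[0, T] ->
    derivable phi t 1 /\ pds h P f g (phi t) (derive1 phi t)} ->
  {ae @lebesgue_measure R, forall t, t \in `[0, T] ->
    derivable phi' t 1 /\ pds h P f g (phi' t) (derive1 phi' t)} ->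
  phi T = phi' T.
Proof.
move=> T0 lip lip' phi0 in1 in2 ae1 ae2.
have [C C0 hC] := pds_one_sided.
have [l l0 hl] := posdef_lower.
have [CP CP0 hP] := mulmx_norm_le P.
pose w t := phi t - phi' t.
(* The energy whose derivative is twice the left side of the one-sided estimate; it dominates a
   multiple of [|w t| ^+ 2], which closes the Gronwall inequality. *)
pose E t := dot (w t).1 (w t).1 + dot (w t).2 (P *m (w t).2).
pose W := B + B.
have wW t : t \in `[0, T] -> `|(w t).1| <= W /\ `|(w t).2| <= W.
  move=> tI; have [a1 a2] := in1 t tI; have [b1 b2] := in2 t tI.
  by split; rewrite (le_trans (ler_normB _ _))// lerD// S_ball.
have wlip u v : 0 <= u -> u <= v -> v <= T -> `|w v - w u| <= 2 * K * (v - u).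
  move=> u0 uv vT; rewrite (_ : w v - w u = (phi v - phi u) - (phi' v - phi' u)).
    rewrite (le_trans (ler_normB _ _))// -mulrA mulr_natl mulr2n lerD//.
      exact: lip.
    exact: lip'.
  exact: subr_cross.
pose L := m%:R * (2 * K) * (W + W) + n%:R * (2 * K) * (CP * (W + W)).
have Elip : lipschitz_curve 0 T L E.
  move=> u v u0 uv vT.
  have uI : u \in `[0, T] by rewrite in_itv/= u0 (le_trans uv).
  have vI : v \in `[0, T] by rewrite in_itv/= vT (le_trans u0).
  have [u1 u2] := wW u uI; have [v1 v2] := wW v vI.
  have wl := wlip u v u0 uv vT.
  have wl1 : `|(w v).1 - (w u).1| <= 2 * K * (v - u) by apply: le_trans (norm_fst_le (w v - w u)) wl.
  have wl2 : `|(w v).2 - (w u).2| <= 2 * K * (v - u) by apply: le_trans (norm_snd_le (w v - w u)) wl.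
  have -> : E v - E u = dot ((w v).1 - (w u).1) ((w v).1 + (w u).1) +
      dot ((w v).2 - (w u).2) (P *m ((w v).2 + (w u).2)).
    by rewrite -dot_diff -pform_diff /E opprD addrACA.
  rewrite (le_trans (ler_normD _ _))// /L mulrDl lerD//.
    rewrite (le_trans (dot_le _ _))//.
    rewrite (_ : _ * (v - u) = m%:R * (2 * K * (v - u)) * (W + W)); last by ring.
    rewrite ler_pM ?mulr_ge0// ?ler_wpM2l//.
    by rewrite (le_trans (ler_normD _ _))// lerD.
  rewrite (le_trans (dot_le _ _))//.
  rewrite (_ : _ * (v - u) = n%:R * (2 * K * (v - u)) * (CP * (W + W))); last by ring.
  rewrite ler_pM ?mulr_ge0// ?ler_wpM2l// (le_trans (hP _))// ler_wpM2l//.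
  by rewrite (le_trans (ler_normD _ _))// lerD.
pose N := m%:R * W * W + n%:R * W * (CP * W).
have Ebnd t : t \in `[0, T] -> 0 <= E t <= N.
  move=> tI; have [w1 w2] := wW t tI.
  rewrite addr_ge0 ?dot_ge0 ?pform_ge0//= lerD// (le_trans (ler_norm _))// (le_trans (dot_le _ _))//.
    by rewrite ler_pM ?mulr_ge0// ler_wpM2l.
  by rewrite ler_pM ?mulr_ge0// ?ler_wpM2l// (le_trans (hP _))// ler_wpM2l.
have w0 : w 0 = 0 by rewrite /w phi0 subrr.
have E0 : E 0 = 0 by rewrite /E w0 dot0l dot0l addr0.
pose l' := Num.min 1 l.
have l'0 : 0 < l' by rewrite lt_min ltr01.
have Elow t : l' * `|w t| ^+ 2 <= E t.
  rewrite (le_trans (ler_wpM2l (ltW l'0) (norm_pair_sqr_le (w t))))// mulrDr lerD//.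
    rewrite (le_trans _ (norm_sqr_le_dot _))// ler_piMl ?exprn_ge0//.
    by rewrite ge_min lexx.
  by rewrite (le_trans _ (hl _))// ler_wpM2r ?exprn_ge0// ge_min lexx orbT.
pose k := 2 * C / l'.
have k0 : 0 <= k by rewrite divr_ge0 ?mulr_ge0// ltW.
have ET : E T = 0.
  apply: (gronwall_eq0 T0 k0 Elip Ebnd E0).
  apply: lebesgue_aeS (lebesgue_aeI ae1 ae2) => t [H1 H2] tI.
  have [d1 p1] := H1 tI; have [d2 p2] := H2 tI.
  have [dw Ew] : derivable w t 1 /\ derive1 w t = derive1 phi t - derive1 phi' t.
    exact: derivable_sub.
  have [dw1 dw2] := (derivable_pair w t).1 dw.
  have Ew' := derive1_pair dw.
  have [dP EP] := derivable_mulmx P dw2.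
  have [e1 F1] := derivable_dot dw1 dw1.
  have [e2 F2] := derivable_dot dw2 dP.
  have EE : E = (fun s => dot (w s).1 (w s).1) + (fun s => dot (w s).2 (P *m (w s).2)) by [].
  split; first by rewrite EE; exact: derivableD.
  rewrite EE derive1E deriveD// -!derive1E F1 F2 EP.
  have W1 : derive1 (fun s => (w s).1) t = (derive1 phi t).1 - (derive1 phi' t).1.
    by have H := congr1 fst Ew'; rewrite Ew in H; exact: esym H.
  have W2 : derive1 (fun s => (w s).2) t = (derive1 phi t).2 - (derive1 phi' t).2.
    by have H := congr1 snd Ew'; rewrite Ew in H; exact: esym H.
  have [a1 a2] := in1 t tI; have [b1 b2] := in2 t tI.
  have := hC _ _ _ _ a1 b1 p1 p2.
  rewrite -W1 -W2 -[(phi t).1 - (phi' t).1]/((w t).1) -[(phi t).2 - (phi' t).2]/((w t).2) -[phi t - phi' t]/(w t).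
  set x := derive1 _ t; set y := derive1 _ t => H.
  rewrite [dot x _]dotC [dot y _]dotC [dot (w t).2 (P *m y)]pform_sym// [dot y _]dotC.
  have kE : 2 * (C * `|w t| ^+ 2) <= k * E t.
    rewrite (_ : 2 * (C * _) = k * (l' * `|w t| ^+ 2)); first by rewrite ler_wpM2l.
    by rewrite /k [RHS]mulrA divfK ?gt_eqF// mulrA.
  by apply: (le_trans _ kE); exact: double_le H.
have : `|w T| ^+ 2 <= 0.
  by have := Elow T; rewrite ET pmulr_rle0.
rewrite le_eqVlt ltNge exprn_ge0// orbF expf_eq0/= normr_eq0 subr_eq0 => /eqP//.
Qed.

End Comparison.


(** * Distance to a set and uniform convergence *)

Lemma uniform_of_dist (R : realType) (V : normedModType R) (A : set R)
  (psi : nat -> R -> V) (phi : R -> V) :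
  (forall e, 0 < e -> \forall k \near \oo, forall t, A t -> `|psi k t - phi t| <= e) ->
  {uniform A, psi @ \oo --> phi}.
Proof.
move=> H Q /uniform_nbhs[E [entE EQ]].
move: entE; rewrite -entourage_ballE => -[e /= e0 eE].
have e2 : 0 < e / 2 by rewrite divr_gt0.
apply: filterS (H _ e2) => k Hk; apply: EQ => t At; apply: eE.
rewrite /= -ball_normE /= distrC (le_lt_trans (Hk t At))//.
by rewrite ltr_pdivrMr// ltr_pMr// ltr1n.
Qed.

Lemma subsequence_choice (Q : nat -> nat -> Prop) :
  (forall k N : nat, exists2 i, (N <= i)%N & Q k i) ->
  exists2 sigma : nat -> nat, {homo sigma : i j / (i < j)%N} & forall k, Q k (sigma k).
Proof.
move=> H.
have H' (kN : nat * nat) : exists i, (kN.2 <= i)%N /\ Q kN.1 i.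
  by case: kN => k N; have [i ? ?] := H k N; exists i.
have [pick Hp] := choice H'.
pose fix sigma k := if k is k'.+1 then pick (k, (sigma k').+1) else pick (0%N, 0%N).
exists sigma.
  by apply: homo_ltn => [? ? ?|i]; [exact: ltn_trans|exact: (Hp (i.+1, (sigma i).+1)).1].
by case=> [|k]; [exact: (Hp (0%N, 0%N)).2|exact: (Hp (k.+1, (sigma k).+1)).2].
Qed.

Section SetDistance.
Variables (R : realType) (V : normedModType R) (A : set V).
Hypothesis A0 : A !=set0.

Definition set_dist z := inf [set `|z - y| | y in A].

Let lb z : has_lbound [set `|z - y| | y in A].
Proof. by exists 0 => _ [y _ <-]. Qed.

Let ne z : [set `|z - y| | y in A] !=set0.
Proof. by have [y Ay] := A0; exists `|z - y|, y. Qed.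

Lemma set_dist_eq0 z : A z -> set_dist z = 0.
Proof.
move=> Az; apply/eqP; rewrite eq_le; apply/andP; split.
  by apply: ge_inf => //; exists z => //; rewrite subrr normr0.
by apply: lb_le_inf => // _ [y _ <-].
Qed.

Lemma set_dist_lt z e : set_dist z < e -> exists2 y, A y & `|z - y| < e.
Proof.
move=> ze; have e0 : 0 < e - set_dist z by rewrite subr_gt0.
have [_ [y Ay <-]] := inf_adherent e0 (conj (ne z) (lb z)).
by rewrite -/(set_dist z) subrKC; exists y.
Qed.

Lemma set_dist_lipschitz z w : `|set_dist z - set_dist w| <= `|z - w|.
Proof.
suff H u v : set_dist u <= set_dist v + `|u - v|.
  apply/ler_normlP; split; last by rewrite lerBlDl H.
  by rewrite opprB lerBlDl distrC H.
rewrite -lerBlDr; apply: lb_le_inf => // _ [y Ay <-]; rewrite lerBlDr.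
apply: (@le_trans _ _ `|u - y|); first by apply: ge_inf => //; exists y.
have -> : u - y = (u - v) + (v - y) by rewrite addrA subrK.
by rewrite [leRHS]addrC ler_normD.
Qed.

End SetDistance.

(** * Choice of the constants and conclusion *)

Lemma barrier_constants (R : realType) (m n : nat) (h : 'cV[R]_n -> R) (P : 'M[R]_n)
  (f : 'cV[R]_m * 'cV[R]_n -> 'cV[R]_n) (Z : set 'cV[R]_m) :
  compact (superlevel h) -> compact Z -> C1 h -> sym_posdef P -> continuous f ->
  (forall x, h x = 0 -> grad h x != 0) ->
  exists B c M, [/\ 0 < B, 0 < c, 0 <= M &
      forall x, `|x| <= B -> `|h x| <= c -> c <= grad_form h P x] /\
    [/\ forall p, `|p.1| <= B -> `|p.2| <= B -> `|lieD h f p| + 1 <= M,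
       forall x, `|x| = B -> h x < - c, forall x, 0 <= h x -> `|x| <= B - 1 &
       forall z, Z z -> `|z| <= B - 1].
Proof.
move=> S_compact Z_compact h_C1 P_posdef f_cont grad_neq0.
have [Bs Bs0 hBs] : exists2 C, 0 < C & forall x, superlevel h x -> `|x| <= C.
  by apply: (continuous_compact_bounded (F := id)) => // x; exact: cvg_id.
have [Bz Bz0 hBz] : exists2 C, 0 < C & forall x, Z x -> `|x| <= C.
  by apply: (continuous_compact_bounded (F := id)) => // x; exact: cvg_id.
pose B := Num.max Bs Bz + 1.
have B0 : 0 < B by rewrite addr_gt0// lt_max Bs0.
have S_ball x : 0 <= h x -> `|x| <= B - 1 by move=> hx; rewrite /B addrK le_max hBs.
have Z_ball x : Z x -> `|x| <= B - 1 by move=> hx; rewrite /B addrK le_max hBz ?orbT.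
have [e1 e10 he1] := grad_form_lower P_posdef B h_C1 grad_neq0.
(* Positive on the ball: inside by the first term, on the sphere because S, and with it every zero
   of [h], is at distance at least 1 from it. Its minimum bounds [|h|] from below on the sphere. *)
pose F x := (B - `|x|) + `|h x|.
have Fc : continuous F.
  apply: continuous_add; last first.
    by apply: (@continuous_norm _ _ R^o h); apply: (C1_continuous h_C1).
  apply: continuous_add; first exact: cst_continuous.
  by apply: continuous_opp; apply: (@continuous_norm _ _ _ id); move=> ?; exact: cvg_id.
have [x /= xB|e2 e20 he2] := compact_pos_lower (@compact_cball R n B) Fc.
  move: xB; rewrite le_eqVlt => /orP[/eqP xB|xB]; last by rewrite ltr_pwDl// subr_gt0.
  rewrite ltr_wpDl ?subr_ge0 ?xB// normr_gt0; apply/eqP => hx.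
  by have := S_ball x; rewrite hx xB => /(_ (lexx _)); lra.
(* Half of [e1] leaves [grad_form >= c] where [|h| <= c]; half of [e2] makes the inequality on the
   sphere strict. *)
pose c := Num.min (e1 / 2) (e2 / 2).
have c1 : c <= e1 / 2 by rewrite ge_min lexx.
have c2 : c <= e2 / 2 by rewrite ge_min lexx orbT.
have lc : continuous (lieD h f) by exact: lieD_continuous.
have [M M0 hM] := continuous_compact_bounded (@compact_cball_pair R m n B B) lc.
exists B, c, (M + 1); split; split=> //.
- by rewrite lt_min !divr_gt0.
- by rewrite addr_ge0// ltW.
- by move=> x xB hx; have := he1 x xB; lra.
- by move=> p p1 p2; rewrite lerD2r hM.
- move=> x xB; have := he2 x; rewrite /F/= xB subrr add0r => /(_ (lexx _)) hx.
  have hneg : h x < 0.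
    by rewrite ltNge; apply/negP => /S_ball; rewrite xB; lra.
  by move: hx; rewrite ltr0_norm//; lra.
Qed.

Theorem mainTheorem2 (R : realType) (m n : nat)
  (h : 'cV[R]_n -> R) (L : R) (gamma : R -> R) (P : 'M[R]_n)
  (f : 'cV[R]_m * 'cV[R]_n -> 'cV[R]_n) (g : 'cV[R]_m * 'cV[R]_n -> 'cV[R]_m)
  (Z Z0 Z' : set 'cV[R]_m) (eps r : R)
  (S_nonempty : superlevel h !=set0)
  (S_compact : compact (superlevel h))
  (h_C1 : C1 h)
  (gradh_lip : locally_lipschitz (grad h))
  (gradh_lip_S : forall x y, superlevel h x -> superlevel h y ->
    enorm (grad h x - grad h y) <= L * enorm (x - y))
  (gradh_neq0 : forall x, h x = 0 -> grad h x != 0)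
  (gamma_Kinfty : Kinfty gamma)
  (dist_gamma : forall x, superlevel h x ->
    dist x (boundary (superlevel h)) <= gamma (h x))
  (P_posdef : sym_posdef P)
  (f_lip : locally_lipschitz f)
  (g_cont : continuous g)
  (g_bnd : locally_bounded g)
  (Z_compact : compact Z)
  (eps_gt0 : 0 < eps) (eps_lt : eps < min_grad h)
  (r_gt0 : 0 < r)
  (Z0_compact : compact Z0) (Z'_compact : compact Z')
  (Z0_sub : Z0 `<=` Z')
  (Z'_sub : [set z + r *: b | z in Z' & b in @eball R m] `<=` Z)
  (z0 : 'cV[R]_m) (x0 : 'cV[R]_n) (T : R)
  (z0_in : Z0 z0) (x0_in : superlevel h x0) (T_gt0 : 0 < T)
  (* a solution of the PDS exists on [0, T], and every one stays in Z' x S *)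
  (pds_exists : exists phi, solution (pds h P f g) T (z0, x0) phi)
  (pds_inv : forall phi, solution (pds h P f g) T (z0, x0) phi ->
    forall t, t \in `[0, T] -> (Z' `*` superlevel h) (phi t)) :
  exists alpha' : R,
  [/\ alpha_star h f gamma L eps Z <= alpha',
      forall alpha : R, alpha' <= alpha -> 0 < alpha ->
        (exists psi, solution (cbf h P f g alpha) T (z0, x0) psi) /\
        (forall psi, solution (cbf h P f g alpha) T (z0, x0) psi ->
          forall t, t \in `[0, T] -> (Z `*` superlevel h) (psi t)) &
      forall (alpha_ : nat -> R) (psi_ : nat -> R -> 'cV[R]_m * 'cV[R]_n),
        nondecreasing_seq alpha_ ->
        (forall i, alpha' <= alpha_ i /\ 0 < alpha_ i) ->
        alpha_ @ \oo --> +oo ->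
        (forall i, solution (cbf h P f g (alpha_ i)) T (z0, x0) (psi_ i)) ->
        (exists (sigma : nat -> nat) (phi : R -> 'cV[R]_m * 'cV[R]_n),
          [/\ {homo sigma : i j / (i < j)%N},
              solution (pds h P f g) T (z0, x0) phi &
              cvg_loc_uniform T (psi_ \o sigma) phi]) /\
        (locally_lipschitz g ->
          exists phi : R -> 'cV[R]_m * 'cV[R]_n,
          [/\ solution (pds h P f g) T (z0, x0) phi,
              forall phi', solution (pds h P f g) T (z0, x0) phi' ->
                {in `[0, T], phi' =1 phi} &
              cvg_loc_uniform T psi_ phi])].
Proof.
have f_cont : continuous f := locally_lipschitz_continuous f_lip.
have [B [c [M [[B0 c0 M0 form_lo] [lieD_le sphere_neg S_ball Z_ball]]]]] :=
  barrier_constants S_compact Z_compact h_C1 P_posdef f_cont gradh_neq0.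
have S_ballB x : 0 <= h x -> `|x| <= B by move=> /S_ball; lra.
have [K1 K10 hK1] : exists2 C, 0 < C &
    forall alpha p, `|barrier_field h P f g B c M alpha p| <= C.
  exact: barrier_field_bounded.
have [K2 K20 hK2] := pds_velocity_bound P_posdef f_cont g_cont S_ballB.
pose K := Num.max K1 K2.
have field_le alpha p : `|barrier_field h P f g B c M alpha p| <= K.
  by rewrite le_max hK1.
have Z'Z : Z' `<=` Z.
  move=> z Z'z; apply: Z'_sub; exists z => //; exists 0; last by rewrite scaler0 addr0.
  by rewrite /eball/= /enorm dot0l sqrtr0.
have Z'_ball z : Z' z -> `|z| <= B by move=> /Z'Z/Z_ball; lra.
have pds_in phi : solution (pds h P f g) T (z0, x0) phi ->
    forall t, t \in `[0, T] -> `|(phi t).1| <= B /\ 0 <= h (phi t).2.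
  by move=> sol t /(pds_inv phi sol)[? ?]; split=> //; exact: Z'_ball.
have pds_lip phi : solution (pds h P f g) T (z0, x0) phi -> lipschitz_curve 0 T K phi.
  move=> sol; have [ac _ ae] := sol; apply: ac_lipschitz => //.
  apply: lebesgue_aeS ae => t H tI; have [dphi Hphi] := H tI.
  have [pB _] := pds_in _ sol t tI; have [vK _] := hK2 _ _ pB Hphi.
  by split; [exact: dphi|rewrite le_max vK orbT].
have Z'0 : Z' !=set0 by exists z0; exact: Z0_sub.
(* Curves are measured in the sup norm, [Z'_sub] in the Euclidean one. The squared Euclidean norm is
   at most [m] times the squared sup norm, so sup distance [r / (m + 1)] suffices; the half gives a
   strict inequality, hence a point of Z' that close. *)
pose rho := r / (m%:R + 1) / 2.
have m1 : 0 < m%:R + 1 :> R by rewrite ltr_wpDl.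
have rho0 : 0 < rho by rewrite !divr_gt0.
have near_Z z : set_dist Z' z <= rho -> Z z.
  move=> dz; have [|y Z'y zy] := set_dist_lt Z'0 (z := z) (e := r / (m%:R + 1)).
    by rewrite (le_lt_trans dz)// ltr_pdivrMr// ltr_pMr ?divr_gt0// ltr1n.
  apply: Z'_sub; exists y => //; exists (r^-1 *: (z - y)); last first.
    by rewrite scalerA divff ?gt_eqF// scale1r addrC subrK.
  have u1 : `|z - y| <= r / (m%:R + 1) := ltW zy.
  have u2 : `|z - y| <= r.
    by rewrite (le_trans u1)// ler_pdivrMr// ler_pMr// lerDr.
  rewrite /eball/= /enorm -sqrtr1 ler_sqrt// dotZl dotZr mulrA -invfM.
  rewrite mulrC ler_pdivrMr ?mulr_gt0// mul1r (le_trans (ler_norm _))//.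
  rewrite (le_trans (dot_le _ _))// ler_pM ?mulr_ge0//.
  rewrite (@le_trans _ _ (m%:R * (r / (m%:R + 1))))// ?ler_wpM2l//.
  by rewrite mulrCA ger_pMr// ler_pdivrMr// mul1r lerDl.
have d_ball z : set_dist Z' z <= rho -> `|z| < B.
  by move=> /near_Z/Z_ball; lra.
have d_lip := set_dist_lipschitz Z'0.
have d_eq0 := @set_dist_eq0 _ _ _ Z'0.
have p0_in : 0 <= h (z0, x0).2 by exact: x0_in.
have [phi0 phi0_sol] := pds_exists.
have [A hA] := no_escape h_C1 gradh_lip P_posdef f_cont g_cont B0 c0 M0 T_gt0 form_lo
  lieD_le field_le sphere_neg S_ball d_lip d_eq0 rho0 d_ball p0_in phi0_sol
  (pds_lip _ phi0_sol) pds_inv.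
(* [M / c] makes the CBF field agree with the barrier field on the relevant part of S, and [A]
   excludes escapes. *)
exists (Num.max (alpha_star h f gamma L eps Z) (Num.max (M / c) A)).
have alpha_ok alpha : Num.max (alpha_star h f gamma L eps Z) (Num.max (M / c) A) <= alpha ->
    M / c <= alpha /\ ~ escapes h P f g B c M K T (set_dist Z') rho (z0, x0) alpha.
  by rewrite !ge_max => /and3P[_ ? /hA ?].
split.
- by rewrite le_max lexx.
- move=> alpha /alpha_ok[Mc noesc] al0; split.
    exact: (cbf_exists h_C1 P_posdef f_cont g_cont B0 c0 M0 T_gt0 form_lo lieD_le field_le
      sphere_neg S_ball d_lip d_eq0 rho0 d_ball p0_in phi0_sol pds_inv al0 Mc noesc).
  move=> psi sol t tI.
  have [_ _ /(_ t tI)[dt ht]] := cbf_confined h_C1 P_posdef B0 c0 M0 T_gt0 form_lo lieD_le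
    field_le sphere_neg S_ball d_lip d_eq0 rho0 d_ball p0_in phi0_sol pds_inv al0 Mc noesc sol.
  by split=> //; exact: near_Z.
move=> alpha_ psi_ _ al al_oo sol.
have alk k : [/\ 0 < alpha_ k, M / c <= alpha_ k &
    ~ escapes h P f g B c M K T (set_dist Z') rho (z0, x0) (alpha_ k)].
  by have [/alpha_ok[? ?] ?] := al k.
have lim (U : set_system nat) : UltraFilter U -> \oo `<=` U ->
    exists2 z, solution (pds h P f g) T (z0, x0) z &
    forall e, 0 < e -> \forall k \near U, forall t, t \in `[0, T] -> `|psi_ k t - z t| <= e.
  move=> UU Uoo; have alU a : \forall k \near U, a <= alpha_ k.
    by apply: Uoo; move/cvgryPge : al_oo; exact.
  exact: (cbf_limit h_C1 gradh_lip P_posdef f_cont g_cont B0 c0 M0 T_gt0 form_lo lieD_le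
    field_le sphere_neg S_ball d_lip d_eq0 rho0 d_ball p0_in phi0_sol pds_inv UU Uoo alU alk sol).
have sub a b t : 0 <= a -> b < T -> `[a, b]%classic t -> t \in `[0, T].
  move=> a0 bT; rewrite /= !in_itv/= => /andP[at' tb].
  by rewrite (le_trans a0 at') (le_trans tb (ltW bT)).
split.
  have [U [UU Uoo]] := ultraFilterLemma (_ : ProperFilter \oo).
  have PU : ProperFilter U by exact: ultra_proper.
  have [z zsol zU] := lim U UU Uoo.
  (* Sets of the ultrafilter meet every tail, so increasing indices with uniform error at most
     [1 / (k + 1)] can be picked. *)
  have [k N|sigma sinc sQ] := @subsequence_choice
      (fun k i => forall t, t \in `[0, T] -> `|psi_ i t - z t| <= k.+1%:R^-1).
    have k0 : 0 < k.+1%:R^-1 :> R by rewrite invr_gt0.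
    have UN : U [set i | (N <= i)%N] by apply: Uoo; exact: nbhs_infty_ge.
    by have [i [Ni Hi]] := filter_ex (filterI UN (zU _ k0)); exists i.
  exists sigma, z; split=> // a b a0 ab bT; apply: uniform_of_dist => e e0.
  have := @cvg_harmonic R => /cvgrPdist_le/(_ e e0).
  apply: filterS => k; rewrite sub0r normrN ger0_norm /harmonic/= ?invr_ge0// => ke t tab.
  by apply: le_trans ke; apply: sQ; exact: (sub a b).
move=> g_lip.
have uniq phi phi' t : solution (pds h P f g) T (z0, x0) phi ->
    solution (pds h P f g) T (z0, x0) phi' -> t \in `[0, T] -> phi t = phi' t.
  move=> s1 s2; rewrite in_itv/= => /andP[t0 tT].
  have tI u : u \in `[0, t] -> u \in `[0, T].
    by rewrite !in_itv/= => /andP[-> /le_trans->].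
  have [_ i1 a1] := s1; have [_ i2 a2] := s2.
  apply: (pds_unique P_posdef h_C1 gradh_lip f_cont g_cont S_ballB f_lip g_lip gradh_neq0 t0
    (lipschitz_curveS (lexx _) tT (pds_lip _ s1))
    (lipschitz_curveS (lexx _) tT (pds_lip _ s2))).
  - by rewrite i1 i2.
  - by move=> u /tI; exact: pds_in.
  - by move=> u /tI; exact: pds_in.
  - by apply: lebesgue_aeS a1 => u H /tI.
  - by apply: lebesgue_aeS a2 => u H /tI.
exists phi0; split=> //.
  by move=> phi' sol' t tI; exact: uniq.
move=> a b a0 ab bT; apply: uniform_of_dist => e e0; apply: contrapT => nQ.
(* If convergence failed, some ultrafilter would live on the bad indices. Its limit is a PDS
   solution, equal to [phi0] by uniqueness, so some of these indices would be good. *)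
pose D := ~` [set k | forall t, `[a, b]%classic t -> `|psi_ k t - phi0 t| <= e].
have PF : ProperFilter (within D \oo).
  apply: Build_ProperFilter => H; apply: nQ.
  have {}H : \forall k \near \oo, D k -> False by exact: H.
  by apply: filterS H => k Dk; apply: contrapT => /Dk.
have [U [UU Uoo]] := ultraFilterLemma PF.
have PU : ProperFilter U by exact: ultra_proper.
have [|z zsol zU] := lim U UU.
  by move=> Q HQ; apply: Uoo; apply: filterS HQ => k Qk _.
have DD : \forall k \near \oo, D k -> D k by exact: nearW.
have UD : U D by apply: Uoo; exact: DD.
have [k [Dk Hk]] := filter_ex (filterI UD (zU e e0)).
apply: Dk => t tab; have tI := sub a b t a0 bT tab.
by rewrite (uniq phi0 z)//; exact: Hk.
Qed.
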